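(* Let $\Sigma_{g,p}$ be an orientable surface belonging to $\mathcal{F}_1\cup\mathcal{F}_2$ and let $n\geq 1$. The surface pure braid group $P_n(\Sigma_{g,p})$ has the R$_\infty$-property if and only if one of the following holds: (1) $\Sigma_{g,p}\in\mathcal{F}_2$ (and $n\geq 1$ arbitrary); (2) $\Sigma_{g,p}=\Sigma_{0,0}=\mathbb{S}^2$ and $n\geq 4$; (3) $\Sigma_{g,p}=\Sigma_{0,1}=\mathbb{S}^2\setminus\{x_1\}$ and $n\geq 3$; (4) $\Sigma_{g,p}=\Sigma_{0,2}=\mathbb{S}^2\setminus\{x_1,x_2\}$ and $n\geq 2$.
   Context: For a group $G$ and an endomorphism $\phi$ of $G$, two elements $x,y\in G$ are twisted conjugate if $x=zy\phi(z)^{-1}$ for some $z\in G$; the number of equivalence classes is the Reidemeister number $R(\phi)\in\mathbb{N}\cup\{\infty\}$. A group $G$ has the R$_\infty$-property if $R(\phi)=\infty$ for every automorphism $\phi$ of $G$. $\Sigma_{g,p}$ denotes the closed orientable surface of genus $g$ with $p\geq 0$ points removed. For a space $M$, $F_n(M)=\{(x_1,\dots,x_n)\in M^n : x_i\neq x_j \text{ for } i\neq j\}$ is the ordered configuration space, and $P_n(M)=\pi_1(F_n(M))$ is the $n$-string pure braid group of $M$; $B_n(M)=\pi_1(F_n(M)/S_n)$ is the $n$-string braid group ($S_n$ acting by permuting coordinates). Family $\mathcal{F}_1$ consists of $\Sigma_{0,0}=\mathbb{S}^2$, $\Sigma_{0,1}$, $\Sigma_{0,2}$. Family $\mathcal{F}_2$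 consists of: the closed orientable surfaces $\Sigma_{g,0}$ with $g\geq 2$; and the punctured surfaces $\Sigma_{0,p}$ with $p\geq 3$, $\Sigma_{1,p}$ with $p\geq 2$, and $\Sigma_{g,p}$ with $g\geq 2$, $p\geq 1$ (equivalently, $\mathcal{F}_2$ is the set of $\Sigma_{g,p}$ with Euler characteristic $2-2g-p<0$ other than $\Sigma_{1,1}$). *)

(* Defs.v *)
From HB Require Import structures.
From mathcomp Require Import all_boot all_order all_algebra.
From mathcomp Require Import all_classical all_reals topology normedtype.
Set Implicit Arguments. Unset Strict Implicit. Unset Printing Implicit Defensive.
Import Order.TTheory GRing.Theory Num.Theory numFieldNormedType.Exports.
Local Open Scope classical_set_scope.
Local Open Scope ring_scope.

Section GroupNotions.
Variables (G : Type) (mul : G -> G -> G) (inv : G -> G).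

Definition is_automorphism (phi : G -> G) : Prop :=
  bijective phi /\ forall x y, phi (mul x y) = mul (phi x) (phi y).

Definition twisted_conj (phi : G -> G) (x y : G) : Prop :=
  exists z, x = mul (mul z y) (inv (phi z)).

Definition reidemeister_classes (phi : G -> G) : set (set G) :=
  [set C | exists y, C = [set x | twisted_conj phi x y]].

Definition reidemeister_infinite (phi : G -> G) : Prop :=
  infinite_set (reidemeister_classes phi).

Definition R_infty_property : Prop :=
  forall phi, is_automorphism phi -> reidemeister_infinite phi.
End GroupNotions.

(* Surfaces Sigma_{g,p} as explicit subsets of R^3.                    *)
(* D_g := closed disk of radius 3g+3 centred at 0 minus the open unit  *)
(* disks centred at (3k,0), k = 1..g  (a disk with g holes);           *)
(* surf_phi g is positive in the interior of D_g, zero on its boundary *)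
(* and negative outside.  Sigma_g := {(x,y,z) | (x,y) in D_g,           *)
(* |z| = surf_phi g (x,y)} is the double of D_g along its boundary,    *)
(* a closed orientable surface of genus g (g = 0 : the sphere S^2).    *)
(* Sigma_{g,p} removes the p distinct points (0, k/(k+1), z>0), k < p. *)
Section Surfaces.
Variable R : realType.

Definition surf_phi (g : nat) (x y : R) : R :=
  foldr (fun k acc => Num.min acc (Num.sqrt ((x - 3 * k%:R) ^+ 2 + y ^+ 2) - 1))
        ((3 * g%:R + 3) - Num.sqrt (x ^+ 2 + y ^+ 2))
        (iota 1 g).

Definition closed_surface (g : nat) : set (R * R * R) :=
  [set q | 0 <= surf_phi g q.1.1 q.1.2 /\ `|q.2| = surf_phi g q.1.1 q.1.2].

Definition puncture_points (p : nat) : set (R * R * R) :=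
  [set q | q.1.1 = 0 /\ 0 < q.2 /\
           exists k : nat, (k < p)%N /\ q.1.2 = k%:R / (k.+1)%:R].

Definition Sigma (g p : nat) : set (R * R * R) :=
  closed_surface g `\` puncture_points p.
End Surfaces.

Section Braids.
Variables (R : realType) (T : topologicalType).

Definition conf_space (M : set T) (n : nat) : set ('I_n -> T) :=
  [set x | (forall i, M (x i)) /\ injective x].
Arguments conf_space : clear implicits.

Definition I01 : set R := `[0, 1].
Definition square01 : set (R * R) := I01 `*` I01.

Variables (M : set T) (n : nat) (x0 : 'I_n -> T).

(* A path in M^n is an n-tuple of paths in T (product topology on T^n);
   it lies in F_n(M) on [0,1]; loops are based at x0. *)
Definition is_loop (c : 'I_n -> R -> T) : Prop :=
  [/\ forall i, {within I01, continuous (c i)},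
      forall s, I01 s -> conf_space M n (fun i => c i s)
    & forall i, c i 0 = x0 i /\ c i 1 = x0 i].

Definition loop_homotopic (c d : 'I_n -> R -> T) : Prop :=
  exists H : 'I_n -> R * R -> T,
  [/\ forall i, {within square01, continuous (H i)},
      forall s t, I01 s -> I01 t -> conf_space M n (fun i => H i (s, t)),
      forall i s, I01 s -> H i (s, 0) = c i s /\ H i (s, 1) = d i s
    & forall i t, I01 t -> H i (0, t) = x0 i /\ H i (1, t) = x0 i].

Definition loop_concat (c d : 'I_n -> R -> T) : 'I_n -> R -> T :=
  fun i s => if s <= 2^-1 then c i (2 * s) else d i (2 * s - 1).

Definition loop_rev (c : 'I_n -> R -> T) : 'I_n -> R -> T :=
  fun i s => c i (1 - s).

Definition loop_class (c : 'I_n -> R -> T) : set ('I_n -> R -> T) :=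
  [set d | is_loop d /\ loop_homotopic c d].

Definition pure_braid_group : Type :=
  {C : set ('I_n -> R -> T) | exists c, is_loop c /\ C = loop_class c}.

Definition pb_rep (C : pure_braid_group) : 'I_n -> R -> T :=
  projT1 (cid (projT2 C)).

(* Turn a set of loops into an element of P_n(M) when it is a homotopy
   class; otherwise fall back to the default [dflt] (this fallback never
   happens for the operations below, since concatenations and reversals
   of loops are loops). *)
Definition pb_of_set (dflt : pure_braid_group) (S : set ('I_n -> R -> T)) :
    pure_braid_group :=
  match pselect (exists c, is_loop c /\ S = loop_class c) with
  | left h => exist _ S h
  | right _ => dflt
  end.

Definition pb_mul (C D : pure_braid_group) : pure_braid_group :=
  pb_of_set C (loop_class (loop_concat (pb_rep C) (pb_rep D))).

Definition pb_inv (C : pure_braid_group) : pure_braid_group :=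
  pb_of_set C (loop_class (loop_rev (pb_rep C))).
End Braids.
Arguments conf_space : clear implicits.

Definition in_F1 (g p : nat) : Prop := g = 0%N /\ (p <= 2)%N.
Definition in_F2 (g p : nat) : Prop :=
  [\/ (2 <= g)%N /\ p = 0%N, g = 0%N /\ (3 <= p)%N,
      g = 1%N /\ (2 <= p)%N | (2 <= g)%N /\ (1 <= p)%N].

(* Main.v *)
(* A finitely generated group G that maps onto Alt_k for infinitely many k has
   the R_infty-property.  Given an automorphism phi and f : G ->> Alt_k, finite
   generation yields d > 0 such that phi^d preserves the kernel of f; then
   x |-> f(x) f(phi x) ... f(phi^(d-1) x) sends phi-twisted conjugate elements to
   elements of Alt_k that are twisted conjugate under the automorphism induced
   by phi^d.  There are always at least two such classes in Alt_k, and by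
   Goursat's lemma they can be prescribed independently for different k, so
   the number of phi-twisted classes is unbounded.

   Pure braid groups are finitely generated by induction along the
   Fadell-Neuwirth fibrations, which also make P_(n+1) -> P_n surjective as soon
   as fibres are connected.  A surface in F_2 contains two disjoint arcs between
   punctures or closed curves, each crossed exactly once by a loop missing the
   other one; counting crossings with values in Alt_k, with the two curves
   labelled by two generators, maps P_1 onto Alt_k.  On the sphere with at most
   two punctures, four points among punctures and strands have a cross ratio,
   which maps the configuration space to C minus {0, 1}, where the same
   counting applies.  In the remaining cases the fibrations show that P_n is
   cyclic, and then the inversion has at most two twisted classes. *)
Require Import Defs.
From HB Require Import structures.
From mathcomp Require Import all_boot all_order all_fingroup all_solvable all_algebra.
From mathcomp Require Import all_classical all_reals topology normedtype realfun.
From mathcomp Require Import zify ring lra complex.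
Set Implicit Arguments. Unset Strict Implicit. Unset Printing Implicit Defensive.

(** * Alternating quotients and twisted conjugacy *)

(** Surjectivity onto a finite group is witnessed by two explicit loops, whereas a presentation of a
    pure braid group would require computing fundamental groups of configuration spaces. The
    criterion is therefore arranged to ask only for quotients and finite generation, and no kernel
    is ever computed. The degrees are k = q + 2 with q an odd prime. Then q divides the order of
    Alt_k exactly once, so Sylow's theorem controls the elements of order q, and the two points left
    over allow a parity correction; this replaces any knowledge of the automorphisms of Alt_k. Since
    k is odd, a full k-cycle is even and can serve as one of two generators. On the topological side
    every argument that would subdivide [0, 1] goes through [real_induction], and paths are total
    functions on the real line, so that gluing and reparametrisation never meet a subspace topology.
    Surjections onto Alt_k come from holonomies of locally multiplicative functions, whose homotopy
    invariance is proved directly, without covering spaces. *)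

Section AlternatingQuotients.
Import GroupScope.

Lemma odd_permX (T : finType) (s : {perm T}) n : (s ^+ n) = odd n && s :> bool.
Proof.
elim: n => [|n IH]; first by rewrite expg0 odd_perm1.
by rewrite expgS odd_permM IH /=; case: (odd n) (odd_perm s) => [] [].
Qed.

(** * Two generators of an alternating group of odd degree *)

Section AltGeneration.
Variable k : nat.
Hypothesis k_gt2 : 2 < k.

Let o (i : nat) : 'I_k := insubd (Ordinal k_gt2) i.
Let oE i : i < k -> o i = i :> nat. Proof. by move=> h; rewrite /o val_insubd h. Qed.
Let oK (i : 'I_k) : o i = i. Proof. by apply/val_inj; rewrite /= oE. Qed.
Let o_eq i j : i < k -> j < k -> (o i == o j) = (i == j).
Proof. by move=> hi hj; rewrite -val_eqE /= !oE. Qed.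

(** Products of permutations act from left to right, so this is the 3-cycle taking j to j + 1, j + 1
    to j + 2 and j + 2 to j. *)
Definition cyc3 (j : nat) : {perm 'I_k} := tperm (o j) (o j.+1) * tperm (o j) (o j.+2).

Lemma cyc3_1 j : j.+2 < k -> cyc3 j (o j) = o j.+1.
Proof.
move=> h; rewrite permM tpermL tpermD // o_eq; lia.
Qed.

Lemma cyc3_2 j : j.+2 < k -> cyc3 j (o j.+1) = o j.+2.
Proof. by move=> h; rewrite permM tpermR tpermL. Qed.

Lemma cyc3_fix j (x : 'I_k) : j.+2 < x -> cyc3 j x = x.
Proof.
move=> h; have := ltn_ord x => xk.
by rewrite permM !tpermD // -(oK x) o_eq //; lia.
Qed.

Lemma cyc3_even j : j.+2 < k -> cyc3 j \in 'Alt_('I_k).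
Proof.
move=> h; rewrite Alt_even odd_permM !odd_tperm !o_eq //; lia.
Qed.

(** Induction on the number of initial points that may move: an element of [H] brings the image of
    the last of them back to its place without disturbing the points above. *)
Lemma Alt_sub_gen_cyc3 (H : {group {perm 'I_k}}) :
  (forall j, j.+2 < k -> cyc3 j \in H) -> 'Alt_('I_k) \subset H.
Proof.
move=> HH.
(* The point j climbs to m one place at a time. The last place, from m - 1, is gained with the
   3-cycle on m - 2, m - 1, m, whence the condition 1 < m. *)
have move_up m : m < k -> 1 < m -> forall d j, j + d = m ->
    exists2 h, h \in H & [/\ h \in 'Alt_('I_k), h (o j) = o m
      & forall x : 'I_k, m < x -> h x = x].
  move=> mk m1; elim=> [|d IH] j jd.
    exists 1; first exact: group1.
    by split=> [||x _]; rewrite ?group1 // perm1 //; congr o; lia.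
  have [h hH [hA hj hx]] := IH j.+1 ltac:(lia).
  case: (ltnP j.+1 m) => jm.
    exists (cyc3 j * h); first by rewrite groupM // HH //; lia.
    split; first by rewrite groupM // cyc3_even //; lia.
      by rewrite permM cyc3_1 ?hj //; lia.
    by move=> x mx; rewrite permM cyc3_fix ?hx //; lia.
  have jE : j = m.-1 by lia.
  exists (cyc3 m.-2); first by rewrite HH //; lia.
  split; first by rewrite cyc3_even //; lia.
    have -> : j = m.-2.+1 by lia.
    by rewrite cyc3_2; [congr o; lia|lia].
  by move=> x mx; rewrite cyc3_fix //; lia.
suff key m (s : {perm 'I_k}) : m <= k -> s \in 'Alt_('I_k) ->
    (forall x : 'I_k, m <= x -> s x = x) -> s \in H.
  apply/fintype.subsetP => s sA; apply: (key k) => // x.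
  by rewrite leqNgt ltn_ord.
elim: m s => [|m IH] s mk sA sfix.
  by rewrite (_ : s = 1) ?group1 //; apply/permP => x; rewrite perm1 sfix.
(* For m at most 1 no 3-cycle fits; but an even permutation that moves at most the points 0 and 1 is
   trivial, the only other candidate being a transposition. *)
case: (ltnP 1 m) => m1; last first.
  apply: (IH s) => //; first lia.
  have s_or (x : 'I_k) : x < m.+1 -> s x < m.+1.
    move=> xm; rewrite ltnNge; apply/negP => sx.
    by have /perm_inj E := sfix _ sx; move: sx; rewrite E; lia.
  move=> x; rewrite leq_eqVlt => /orP[/eqP xm|]; last exact: sfix.
  have xm' : x < m.+1 by lia.
  have := s_or _ xm'; rewrite ltnS leq_eqVlt => /orP[/eqP E|lt].
    by apply/val_inj => /=; rewrite E xm.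
  have m_eq1 : m = 1%N by lia.
  have s1 : s = tperm (o 0) (o 1%N).
    have xo : x = o 1%N by rewrite -(oK x) -xm m_eq1.
    have s1 : s (o 1%N) = o 0 by rewrite -xo -(oK (s x)); congr o; lia.
    have s0 : s (o 0) = o 1%N.
      have : s (o 0) < m.+1 by apply: s_or; rewrite oE; lia.
      case: (s (o 0) =P o 1) => // /eqP ne h.
      have /perm_inj/eqP : s (o 0) = s (o 1%N).
        rewrite s1 -(oK (s (o 0))); congr o.
        by move: ne; rewrite -{1}(oK (s (o 0))) o_eq //; lia.
      by rewrite o_eq //; lia.
    apply/permP => y; case: tpermP => [->|->|y0 y1] //.
    apply: sfix; rewrite m_eq1 ltnNge; apply/negP => yle.
    have : (y : nat) = 0 \/ (y : nat) = 1%N by lia.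
    by case=> e; [apply: y0|apply: y1]; rewrite -(oK y) e.
  by move: sA; rewrite s1 Alt_even odd_tperm o_eq //; lia.
have mo : o m = m :> nat by rewrite oE.
have sm : s (o m) <= m.
  rewrite leqNgt; apply/negP => sx; have /perm_inj E := sfix _ sx.
  by move: sx; rewrite E mo ltnn.
have [h hH [hA hj hx]] := move_up m mk m1 (m - s (o m)) (s (o m)) ltac:(lia).
have : s * h \in H.
  apply: IH; [lia|by rewrite groupM|] => x mx.
  rewrite permM; move: mx; rewrite leq_eqVlt => /orP[/eqP mx|mx].
    have -> : x = o m by rewrite -(oK x) -mx.
    by rewrite -[s (o m)]oK hj.
  by rewrite sfix // hx.
by rewrite groupMr.
Qed.

Definition rot1_fun (i : 'I_k) : 'I_k := o (i.+1 %% k).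
Lemma rot1_inj : injective rot1_fun.
Proof.
have lt a : a %% k < k by rewrite ltn_mod; lia.
move=> i j /(congr1 val); rewrite /= !oE // => E; apply/val_inj => /=.
have := ltn_ord i; have := ltn_ord j.
case: (ltnP i.+1 k) E => hi; case: (ltnP j.+1 k) => hj; rewrite ?(modn_small hi) ?(modn_small hj) //.
- by case.
- move=> E hj1 _; have je : j.+1 = k by lia. by move: E; rewrite je modnn.
- move=> E _ hi1; have je : i.+1 = k by lia. by move: E; rewrite je modnn.
- lia.
Qed.
Definition rot1 : {perm 'I_k} := perm rot1_inj.

Lemma rot1E i : i.+1 < k -> rot1 (o i) = o i.+1.
Proof. by move=> h; rewrite permE /rot1_fun oE ?modn_small //; lia. Qed.

Lemma rot1X n (x : 'I_k) : (rot1 ^+ n) x = o ((x + n) %% k).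
Proof.
have lt a : a %% k < k by rewrite ltn_mod; lia.
elim: n => [|n IH]; first by rewrite expg0 perm1 addn0 modn_small // oK.
by rewrite expgSr permM IH permE /rot1_fun oE // -addn1 modnDml addn1 addnS.
Qed.

Lemma rot1_order : rot1 ^+ k = 1.
Proof.
by apply/permP => x; rewrite rot1X perm1 modnDr modn_small.
Qed.

Lemma rot1_even : odd k -> rot1 \in 'Alt_('I_k).
Proof.
move=> ok; rewrite Alt_even; apply/negP => h.
by have := congr1 (@odd_perm _) rot1_order; rewrite odd_permX h ok odd_perm1.
Qed.

Lemma cyc3J j : j.+3 < k -> cyc3 j ^ rot1 = cyc3 j.+1.
Proof. by move=> h; rewrite conjMg !tpermJ !rot1E //; lia. Qed.

(** Conjugation by the rotation carries the first 3-cycle to each of the consecutive ones. *)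
Lemma Alt_gen2 : 'Alt_('I_k) \subset <<[set cyc3 0; rot1]>>.
Proof.
apply: Alt_sub_gen_cyc3; elim=> [|j IH] h.
  by apply: mem_gen; rewrite set21.
rewrite -cyc3J // groupJ ?IH //; first lia.
by apply: mem_gen; rewrite set22.
Qed.
End AltGeneration.

(** Two generators are wanted because two cuts on a surface give two loops whose holonomies can be
    prescribed. *)
Lemma two_generated_Alt k : 2 < k -> odd k ->
  exists a b : {perm 'I_k}, [/\ a \in 'Alt_('I_k), b \in 'Alt_('I_k) & 'Alt_('I_k) \subset <<[set a; b]>>].
Proof.
move=> k2 ok; exists (cyc3 k2 0), (rot1 k2); split; last exact: Alt_gen2.
- exact: cyc3_even.
- exact: rot1_even.
Qed.

(** * Cycles of prime length q in the alternating group of degree q + 2 *)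

Section PrimeCycle.
Variable q : nat.
Hypotheses (q_pr : prime q) (q_gt2 : 2 < q).
Notation k := q.+2.
Let q0 : 0 < q. Proof. lia. Qed.
Let lt a : a %% q < q. Proof. by rewrite ltn_mod. Qed.

(** The affine map x |-> a x + b of the field with q elements, acting on the first q points; the
    last two points are kept free for a transposition that corrects parity. *)
Definition aff_fun (a b : nat) (i : 'I_k) : 'I_k :=
  if i < q then inord ((a * i + b) %% q) else i.

Arguments aff_fun : simpl never.
Lemma aff_val a b (i : 'I_k) : i < q -> aff_fun a b i = (a * i + b) %% q :> nat.
Proof. by move=> h; rewrite /aff_fun h inordK //; have := lt (a * i + b); lia. Qed.

Lemma aff_out a b (i : 'I_k) : q <= i -> aff_fun a b i = i.
Proof. by rewrite /aff_fun leqNgt => /negbTE ->. Qed.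

Lemma aff_inj a b : coprime q a -> injective (aff_fun a b).
Proof.
move=> cop i j.
case: (ltnP i q) => hi; case: (ltnP j q) => hj.
- move/(congr1 val); rewrite /= !aff_val // => /eqP.
  rewrite eqn_modDr.
  wlog ij : i j hi hj / j <= i.
    move=> W; case: (leqP j i) => h; first exact: W.
    by rewrite eq_sym => E; apply/esym; apply: W => //; apply: ltnW.
  rewrite eqn_mod_dvd ?leq_mul // -mulnBr Gauss_dvdr // => dv.
  apply/val_inj => /=; case: (posnP (i - j)) => [|h]; first lia.
  by have := dvdn_leq h dv; lia.
- by move/(congr1 val) => /=; rewrite aff_val // aff_out //; have := lt (a * i + b); lia.
- by move/(congr1 val) => /=; rewrite (aff_val _ _ hj) aff_out //; have := lt (a * j + b); lia.
- by rewrite !aff_out.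
Qed.

Definition pcyc : {perm 'I_k} := perm (@aff_inj 1%N 1%N (coprimen1 q)).

Lemma pcycX n (x : 'I_k) : (pcyc ^+ n) x = aff_fun 1%N n x.
Proof.
elim: n => [|n IH].
  rewrite expg0 perm1; apply/val_inj => /=; case: (ltnP x q) => h.
    by rewrite aff_val // mul1n addn0 modn_small.
  by rewrite aff_out.
rewrite expgSr permM IH permE; apply/val_inj => /=; case: (ltnP x q) => h.
  have h' : aff_fun 1%N n x < q by rewrite aff_val.
  by rewrite !aff_val // !mul1n modnDml addn1 addnS.
by rewrite !aff_out // aff_out.
Qed.

Lemma pcyc_order : #[pcyc] = q.
Proof.
apply: nt_prime_order => //.
  apply/permP => x; rewrite pcycX perm1; apply/val_inj => /=; case: (ltnP x q) => h.
    by rewrite aff_val // mul1n modnDr modn_small.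
  by rewrite aff_out.
apply/eqP => /permP/(_ ord0); rewrite perm1 permE => /(congr1 val) /=.
by rewrite aff_val // muln0 modn_small //; lia.
Qed.

Lemma pcyc_even : pcyc \in 'Alt_('I_k).
Proof.
rewrite Alt_even; apply/negP => h.
have oq : odd q by case: (even_prime q_pr) => //; lia.
have := congr1 (@odd_perm _) (expg_order pcyc).
by rewrite pcyc_order odd_permX h oq odd_perm1.
Qed.

(** Multiplication by a conjugates the translation x |-> x + 1 to x |-> x + a. If it is an odd
    permutation, it is multiplied by the transposition of the two spare points, which commutes with
    the cycle. *)
Lemma pcyc_conj a : coprime q a ->
  exists2 w, w \in 'Alt_('I_k) & pcyc ^+ a = pcyc ^ w.
Proof.
move=> cop; pose m : {perm 'I_k} := perm (@aff_inj a 0%N cop).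
have mE : pcyc * m = m * pcyc ^+ a.
  apply/permP => x; rewrite !permM pcycX !permE; apply/val_inj => /=.
  case: (ltnP x q) => h.
    have h' : aff_fun 1%N 1%N x < q by rewrite aff_val.
    have h2 : aff_fun a 0 x < q by rewrite aff_val.
    by rewrite !aff_val // !mul1n !addn0 modnDml modnMmr mulnDr muln1.
  by rewrite !aff_out // aff_out.
have mJ : pcyc ^+ a = pcyc ^ m by rewrite conjgE mE mulKg.
case: (boolP (m \in 'Alt_('I_k))) => hm; first by exists m.
pose t : {perm 'I_k} := tperm (inord q) (inord q.+1).
have tq (x : 'I_k) : x < q -> t x = x.
  by move=> h; rewrite tpermD // -val_eqE /= inordK; lia.
have tp : pcyc ^ t = pcyc.
  apply/conjg_fixP/commgP/permP => x; rewrite !permM.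
  case: (ltnP x q) => h.
    have h' : aff_fun 1%N 1%N x < q by rewrite aff_val.
    have -> : t x = x by exact: tq.
    by apply: tq; rewrite permE.
  have h' (y : 'I_k) : q <= y -> pcyc y = y by move=> hy; rewrite permE aff_out.
  rewrite (h' x) // h' //.
  by rewrite /t; case: tpermP => // _; rewrite inordK; lia.
exists (t * m); last by rewrite conjgM tp.
rewrite Alt_even odd_permM odd_tperm; move: hm; rewrite Alt_even negbK => ->.
by rewrite -val_eqE /= !inordK //; lia.
Qed.

(** In (q + 2)! the prime q occurs only once as q > 2, so a subgroup of order q is a Sylow
    subgroup. *)
Lemma card_Alt_q : exists2 n, #|'Alt_('I_k)| = (q * n)%N & coprime q n.
Proof.
have c := @card_Alt 'I_k; rewrite card_ord in c.
have {}c := c isT.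
have qd : q %| #|'Alt_('I_k)|.
  have : q %| 2 * #|'Alt_('I_k)| by rewrite c dvdn_fact // q0 /= !leqW.
  rewrite Gauss_dvdr // prime_coprime //; apply/negP => /dvdn_leq; lia.
case/dvdnP: qd => n nE; exists n; first by rewrite nE mulnC.
rewrite prime_coprime //; apply/negP => /dvdnP[n' n'E].
have : q * q %| k`! by rewrite -c nE n'E; apply/dvdnP; exists (2 * n')%N; rewrite !mulnA.
have -> : k`! = (q * (k * q.+1 * q.-1`!))%N.
  have qf : q`! = (q * q.-1`!)%N by rewrite -{1}(prednK q0) factS (prednK q0).
  by rewrite 2!factS qf; lia.
rewrite dvdn_pmul2l // !Euclid_dvdM //.
case/orP=> [/orP[]|].
- move=> d; have : q %| 2 by rewrite -(dvdn_addr _ (dvdnn q)) addn2.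
  by move/dvdn_leq; lia.
- move=> d; have : q %| 1 by rewrite -(dvdn_addr _ (dvdnn q)) addn1.
  by move/dvdn_leq; lia.
- suff S j : j <= q.-1 -> q %| j`! -> False by exact: S.
  elim: j => [|j IH] jq.
    by rewrite fact0 => /dvdn_leq; lia.
  rewrite factS Euclid_dvdM // => /orP[/(dvdn_leq (ltn0Sn _)) h|]; first by lia.
  by apply: IH; lia.
Qed.

(** Sylow's theorem conjugates the cyclic groups into each other, and [pcyc_conj] absorbs the
    remaining exponent. *)
Lemma Alt_order_q_conj (z : {perm 'I_k}) : z \in 'Alt_('I_k) -> #[z] = q ->
  exists2 w, w \in 'Alt_('I_k) & z = pcyc ^ w.
Proof.
move=> zA oz.
have syl y : y \in 'Alt_('I_k) -> #[y] = q -> q.-Sylow('Alt_('I_k)) <[y]>.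
  move=> yA oy; rewrite pHallE cycle_subG yA /= -orderE oy.
  have [n -> cop] := card_Alt_q.
  have n_gt0 : 0 < n by case: (n) cop => //; rewrite /coprime gcdn0 => /eqP; lia.
  by rewrite p_part (lognM _ q0 n_gt0) logn_prime // eqxx (logn_coprime cop) expn1.
have [w wA E] := Sylow_trans (syl _ pcyc_even pcyc_order) (syl z zA oz).
have : z \in <[pcyc]> :^ w by rewrite -E cycle_id.
case/imsetP => y /cycleP[a ->] zE.
have cop : coprime q a.
  rewrite prime_coprime //; apply/negP => /dvdnP[b bE].
  have p1 : pcyc ^+ q = 1 by have := expg_order pcyc; rewrite pcyc_order.
  move: zE; rewrite bE mulnC expgM p1 expg1n conj1g => z1.
  by move: oz; rewrite z1 order1; lia.
have [w' w'A E'] := pcyc_conj cop.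
by exists (w' * w); [rewrite groupM|rewrite conjgM -E'].
Qed.
End PrimeCycle.

Lemma finite_set_enum (T : Type) (F : set T) (t0 : T) : finite_set F ->
  exists n (g : nat -> T), forall y, F y -> exists2 i, i < n & g i = y.
Proof.
move=> /finite_setP[n /card_set_bijP[f [fI finj _]]]; exists n.
pose g i := if pselect (exists2 y, F y & f y = i) is left h
            then projT1 (cid2 h) else t0.
exists g => y Fy; exists (f y); first exact: fI.
rewrite /g; case: pselect => [h|]; last by case; exists y.
by case: (cid2 h) => z /= Fz; apply: finj; rewrite inE.
Qed.

(** * Normal subgroups, finite simple quotients and Goursat's lemma *)

Section AbstractGroup.
Variables (G : Type) (mul : G -> G -> G) (inv : G -> G) (one : G).

(** The pure braid group is given as a bare type with operations that choose representatives, so its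
    group laws are a fact to be established later and are abstracted here as a hypothesis. *)
Record group_laws : Prop := GroupLaws {
  gmulA : forall x y z, mul x (mul y z) = mul (mul x y) z;
  gmul1 : forall x, mul one x = x;
  gmulx1 : forall x, mul x one = x;
  gmulV : forall x, mul (inv x) x = one;
  gmulxV : forall x, mul x (inv x) = one }.

Hypothesis GL : group_laws.

Inductive gen (F : set G) : G -> Prop :=
| gen1 : gen F one
| gen_in x : F x -> gen F x
| genM x y : gen F x -> gen F y -> gen F (mul x y)
| genV x : gen F x -> gen F (inv x).

Definition fin_gen := exists F : set G, finite_set F /\ forall x, gen F x.

Lemma ginvK x : inv (inv x) = x.
Proof. by rewrite -[LHS](gmulx1 GL) -(gmulV GL x) (gmulA GL) (gmulV GL) (gmul1 GL). Qed.

Lemma gmulIx x y z : mul x z = mul y z -> x = y.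
Proof.
by move/(congr1 (fun t => mul t (inv z))); rewrite -!(gmulA GL) (gmulxV GL) !(gmulx1 GL).
Qed.

Lemma ginvE x y : mul x y = one -> inv x = y.
Proof.
by move=> h; rewrite -[LHS](gmulx1 GL) -h (gmulA GL) (gmulV GL) (gmul1 GL).
Qed.

Lemma ginvM x y : inv (mul x y) = mul (inv y) (inv x).
Proof.
apply: ginvE; rewrite (gmulA GL) -[mul (mul x y) _](gmulA GL) (gmulxV GL).
by rewrite (gmulx1 GL) (gmulxV GL).
Qed.

Section Homs.
Variables (gT : finGroupType) (f : G -> gT).
Definition hom := forall x y, f (mul x y) = f x * f y.
Hypothesis fM : hom.
Lemma hom1 : f one = 1.
Proof. by apply: (mulgI (f one)); rewrite mulg1 -fM (gmul1 GL). Qed.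
Lemma homV x : f (inv x) = (f x)^-1.
Proof. by apply/eqP; rewrite eq_sym eq_invg_mul -fM (gmulxV GL) hom1. Qed.
End Homs.

Definition onto (gT : finGroupType) (f : G -> gT) (S : {group gT}) :=
  (forall x, f x \in S) /\ forall s, s \in S -> exists x, f x = s.

Definition normal_pred (K : G -> Prop) :=
  [/\ K one, (forall x y, K x -> K y -> K (mul x y)), (forall x, K x -> K (inv x))
    & forall x y, K x -> K (mul (mul y x) (inv y))].

Lemma normal_ker (gT : finGroupType) (f : G -> gT) : hom f -> normal_pred (fun x => f x = 1).
Proof.
move=> fM; split; first exact: hom1.
- by move=> x y fx fy; rewrite fM fx fy mulg1.
- by move=> x fx; rewrite homV // fx invg1.
- by move=> x y fx; rewrite !fM fx mulg1 homV // mulgV.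
Qed.

Definition fimage (gT : finGroupType) (f : G -> gT) (K : G -> Prop) : {set gT} :=
  [set s | `[< exists2 x, K x & f x = s >]].

Lemma fimage_group (gT : finGroupType) (f : G -> gT) (K : G -> Prop) :
  hom f -> normal_pred K -> group_set (fimage f K).
Proof.
move=> fM [K1 KM KV KJ]; apply/group_setP; split.
  by rewrite inE; apply/asboolP; exists one => //; exact: hom1.
move=> s t; rewrite !inE => -[x Kx <-] [y Ky <-].
by exists (mul x y); [exact: KM|rewrite fM].
Qed.

Lemma fimage_normal (gT : finGroupType) (f : G -> gT) (S : {group gT}) (K : G -> Prop) :
  hom f -> onto f S -> normal_pred K -> fimage f K <| S.
Proof.
move=> fM [fS fsurj] NK; have [K1 KM KV KJ] := NK; apply/andP; split.
  by apply/fintype.subsetP => s; rewrite inE => /asboolP[x _ <-].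
apply/fintype.subsetP => s sS; rewrite inE; apply/fintype.subsetP => u /imsetP[t].
rewrite inE => /asboolP[x Kx <-] ->; have [y fy] := fsurj _ (groupVr sS).
rewrite inE; apply/asboolP; exists (mul (mul y x) (inv y)); first exact: KJ.
by rewrite !fM homV // fy conjgE invgK mulgA.
Qed.

(** A surjection maps a normal subgroup to a normal subgroup, and a simple group has only two. *)
Lemma simple_fimage (gT : finGroupType) (f : G -> gT) (S : {group gT}) (K : G -> Prop) :
  hom f -> onto f S -> simple S -> normal_pred K ->
  (forall x, K x -> f x = 1) \/ (forall s, s \in S -> exists2 x, K x & f x = s).
Proof.
move=> fM fo /simpleP[_ sS] NK.
have NK' := fimage_normal fM fo NK.
have [E|E] := sS (group (fimage_group fM NK)) NK'.
  left=> x Kx; apply/set1P; rewrite -[[set 1]]E /= inE.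
  by apply/asboolP; exists x.
by right=> s; rewrite -E /= inE => /asboolP.
Qed.

(** A commutator of an element of [A] with one of [K] lies in both. If the intersection had trivial
    image, all elements of [S] would therefore commute. *)
Lemma fimage_inter (gT : finGroupType) (f : G -> gT) (S : {group gT}) (A K : G -> Prop) :
  hom f -> onto f S -> simple S -> ~~ abelian S -> normal_pred A -> normal_pred K ->
  (forall s, s \in S -> exists2 x, A x & f x = s) ->
  (forall s, s \in S -> exists2 x, K x & f x = s) ->
  forall s, s \in S -> exists2 x, A x /\ K x & f x = s.
Proof.
move=> fM fo sS nab NA NK fA fK.
have [A1 AM AV AJ] := NA; have [K1 KM KV KJ] := NK.
have NAK : normal_pred (fun x => A x /\ K x).
  split=> //.
  - by move=> x y [? ?] [? ?]; split; [exact: AM|exact: KM].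
  - by move=> x [? ?]; split; [exact: AV|exact: KV].
  - by move=> x y [? ?]; split; [exact: AJ|exact: KJ].
have [triv|//] := simple_fimage fM fo sS NAK.
case/negP: nab; apply/centsP => s sS' t tS.
have [x Ax fx] := fA _ sS'; have [y Ky fy] := fK _ tS.
have AKc : A (mul (mul (mul x y) (inv x)) (inv y)) /\ K (mul (mul (mul x y) (inv x)) (inv y)).
  split; last by apply: KM; [exact: KJ|exact: KV].
  have -> : mul (mul (mul x y) (inv x)) (inv y) = mul x (mul (mul y (inv x)) (inv y)).
    by rewrite !(gmulA GL).
  by apply: AM => //; apply: AJ; exact: AV.
have := triv _ AKc; rewrite !fM !homV // fx fy.
by move=> /(canRL (mulgKV t)); rewrite mul1g => /(canRL (mulgKV s)).
Qed.

(** The subgroups are intersected one at a time by [fimage_inter]. With kernels for the [K i], a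
    value of [f] can be prescribed while finitely many other homomorphisms vanish. *)
Lemma goursat (gT : finGroupType) (f : G -> gT) (S : {group gT}) n (K : nat -> G -> Prop) :
  hom f -> onto f S -> simple S -> ~~ abelian S ->
  (forall i, i < n -> normal_pred (K i)) ->
  (forall i, i < n -> forall s, s \in S -> exists2 x, K i x & f x = s) ->
  forall s, s \in S -> exists2 x, (forall i, i < n -> K i x) & f x = s.
Proof.
move=> fM fo sS nab; elim: n => [|n IH] NK fK s sS'.
  by have [x <-] := fo.2 _ sS'; exists x.
have NA : normal_pred (fun x => forall i, i < n -> K i x).
  split.
  - by move=> i /ltnW h; case: (NK i h).
  - move=> x y Kx Ky i h; have [_ KM _ _] := NK i (ltnW h); apply: KM; [exact: Kx|exact: Ky].
  - move=> x Kx i h; have [_ _ KV _] := NK i (ltnW h); apply: KV; exact: Kx.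
  - move=> x y Kx i h; have [_ _ _ KJ] := NK i (ltnW h); apply: KJ; exact: Kx.
have fA : forall s, s \in S -> exists2 x, (forall i, i < n -> K i x) & f x = s.
  by apply: IH => i h; [apply: NK|apply: fK]; exact: ltnW.
have [x [Ax Kx] fx] := fimage_inter fM fo sS nab NA (NK n (ltnSn n)) fA (fK n (ltnSn n)) sS'.
by exists x => // i; rewrite ltnS leq_eqVlt => /orP[/eqP->|/Ax].
Qed.

(** The homomorphism [f'] factors through [f]; the map [g] is the factor. *)
Lemma ker_sub_card (gT gT' : finGroupType) (f : G -> gT) (f' : G -> gT')
    (S : {group gT}) (S' : {group gT'}) :
  hom f -> hom f' -> onto f S -> onto f' S' -> (forall x, f x = 1 -> f' x = 1) ->
  #|S'| <= #|S|.
Proof.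
move=> fM fM' fo fo' sub.
pose g (s : gT) := if pselect (exists x, f x = s) is left h then f' (projT1 (cid h)) else 1.
have gf x : g (f x) = f' x.
  rewrite /g; case: pselect => [h|]; last by case; exists x.
  case: (cid h) => y /= fy; apply/eqP; rewrite eq_mulgV1 -(homV fM') -fM'.
  by apply/eqP/sub; rewrite fM homV // fy mulgV.
apply: leq_trans (leq_imset_card g _); apply: subset_leq_card.
apply/fintype.subsetP => t /fo'.2[x <-]; rewrite -gf; apply: imset_f; exact: fo.1.
Qed.

(** If the kernel of [f'] does not map onto [S], it is contained in the kernel of [f]. Were the
    inclusion strict, the kernel of [f] would map onto [S'], so every element would agree with one
    of that kernel modulo the kernel of [f'], and [f] would be trivial. *)
Lemma ker_dichotomy (gT gT' : finGroupType) (f : G -> gT) (f' : G -> gT')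
    (S : {group gT}) (S' : {group gT'}) :
  hom f -> hom f' -> onto f S -> onto f' S' -> simple S -> simple S' ->
  (forall x, f x = 1 <-> f' x = 1) \/ (forall s, s \in S -> exists2 x, f' x = 1 & f x = s).
Proof.
move=> fM fM' fo fo' sS sS'.
have [sub|] := simple_fimage fM fo sS (normal_ker fM'); last by right.
have [sub'|full] := simple_fimage fM' fo' sS' (normal_ker fM).
  by left=> x; split; [apply: sub'|apply: sub].
case/simpleP: sS => /eqP ntS _; case: ntS; apply/trivgP/fintype.subsetP => s /fo.2[y <-].
have [x fx f'x] := full _ (fo'.1 y).
have /sub : f' (mul y (inv x)) = 1 by rewrite fM' homV // f'x mulgV.
by rewrite fM homV // fx invg1 mulg1 => ->; rewrite inE.
Qed.

(** * Iterates of an automorphism and the twisted norm *)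

Section Automorphism.
Variable phi : G -> G.
Hypothesis phi_aut : is_automorphism mul phi.

Let phiM : forall x y, phi (mul x y) = mul (phi x) (phi y) := phi_aut.2.
Notation phin j := (iter j phi).

Lemma iterM j x y : phin j (mul x y) = mul (phin j x) (phin j y).
Proof. by elim: j => //= j ->. Qed.

Lemma aut1 : phi one = one.
Proof. by apply: (@gmulIx _ _ (phi one)); rewrite -phiM !(gmul1 GL). Qed.

Lemma autV x : phi (inv x) = inv (phi x).
Proof. by apply/esym/ginvE; rewrite -phiM (gmulxV GL) aut1. Qed.

Lemma iterV j x : phin j (inv x) = inv (phin j x).
Proof. by elim: j => //= j ->; rewrite autV. Qed.

Lemma iter_surj j y : exists x, phin j x = y.
Proof.
case: phi_aut.1 => g gK Kg; elim: j y => [|j IH] y; first by exists y.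
by have [x xE] := IH (g y); exists x; rewrite /= xE Kg.
Qed.

Section OneHom.
Variables (gT : finGroupType) (f : G -> gT) (S : {group gT}).
Hypotheses (fM : hom f) (fo : onto f S).

Lemma hom_iter j : hom (fun x => f (phin j x)).
Proof. by move=> x y; rewrite iterM fM. Qed.

Lemma onto_iter j : onto (fun x => f (phin j x)) S.
Proof.
split=> [x|s /fo.2[y <-]]; first exact: fo.1.
by have [x <-] := iter_surj j y; exists x.
Qed.

Lemma hom_gen (gT' : finGroupType) (f1 f2 : G -> gT') F : hom f1 -> hom f2 ->
  (forall x, F x -> f1 x = f2 x) -> forall x, gen F x -> f1 x = f2 x.
Proof.
move=> h1 h2 E x; elim=> [|y Fy|y z _ Ey _ Ez|y _ Ey].
- by rewrite !hom1.
- exact: E.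
- by rewrite h1 h2 Ey Ez.
- by rewrite !homV // Ey.
Qed.

(** A homomorphism is determined by its values on a finite generating set, so two of the composites
    of [f] with the iterates of [phi] coincide by the pigeonhole principle; the smaller iterate
    cancels because it is surjective. *)
Lemma hom_periodic : fin_gen -> exists2 m, 0 < m & forall x, f (phin m x) = f x.
Proof.
move=> [F [/(finite_set_enum one)[n [g gsurj]] FG]].
pose h (j : nat) : {ffun 'I_n -> gT} := [ffun i : 'I_n => f (phin j (g i))].
pose N := #|{ffun 'I_n -> gT}|.
have [inj|] := boolP (injectiveb (fun j : 'I_N.+1 => h j)).
  by have := leq_card _ (injectiveP _ inj); rewrite card_ord ltnn.
case/injectivePn => j [j' jj' E].
wlog lt : j j' jj' E / j < j'.
  move=> W; case: (ltngtP j j') => [h1|h1|h1].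
  - exact: W E h1.
  - by apply: W (esym E) h1; rewrite eq_sym.
  - by rewrite (val_inj h1) eqxx in jj'.
have {}E x : f (phin j x) = f (phin j' x).
  apply: (hom_gen (hom_iter j) (hom_iter j') _ (FG x)) => y /gsurj[i ilt <-].
  by move/ffunP/(_ (Ordinal ilt)): E; rewrite !ffunE.
exists (j' - j); first by rewrite subn_gt0.
move=> y; have [x <-] := iter_surj j y.
by rewrite -iterD subnK ?E // ltnW.
Qed.

(** Minimality of d separates the kernel of [f] from those of its composites with the iterates
    strictly between 0 and d, which is what makes Goursat's lemma applicable to them. *)
Lemma ker_period : fin_gen -> exists d, [/\ 0 < d,
   forall x, f (phin d x) = 1 <-> f x = 1 &
   forall j, 0 < j < d -> ~ (forall x, f (phin j x) = 1 <-> f x = 1)].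
Proof.
move=> /hom_periodic[m m0 mP].
pose P d := (0 < d) && `[< forall x, f (phin d x) = 1 <-> f x = 1 >].
have exP : exists d, P d by exists m; rewrite /P m0; apply/asboolP => x; rewrite mP.
case: (ex_minnP exP) => d /andP[d0 /asboolP dP] dmin; exists d; split=> // j /andP[j0 jd] jP.
by have := dmin j; rewrite /P j0 leqNgt jd /= (asboolT jP) => /(_ isT).
Qed.

Definition twisted_norm d x := \prod_(j < d) f (phin j x).

(** The product telescopes: the inverse of the j-th image of [phi z] cancels against the (j + 1)-st
    image of [z]. *)
Lemma twisted_normE d x z : 
  twisted_norm d (mul (mul z x) (inv (phi z))) = f z * twisted_norm d x * (f (phin d z))^-1.
Proof.
elim: d => [|d IH]; first by rewrite /twisted_norm !big_ord0 mulg1 mulgV.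
rewrite /twisted_norm !big_ord_recr /= in IH *; rewrite IH !iterM iterV -iterSr !fM homV //.
by rewrite !mulgA mulgKV.
Qed.
End OneHom.
End Automorphism.
End AbstractGroup.

Lemma fact_inj_pos m n : m`! = n`! -> 0 < m -> 0 < n -> m = n.
Proof.
move=> E m0 n0; case: (ltngtP m n) => // h.
  by have := ltn_fact m0 h; rewrite E ltnn.
by have := ltn_fact n0 h; rewrite E ltnn.
Qed.

Lemma card_Alt_inj m n : #|'Alt_('I_m.+2)| = #|'Alt_('I_n.+2)| -> m = n.
Proof.
have c k := @card_Alt 'I_k; move=> E.
have := c m.+2; rewrite card_ord E => /(_ isT).
have := c n.+2; rewrite card_ord => /(_ isT) -> /fact_inj_pos; lia.
Qed.

Lemma nonabelian_Alt k : 4 < k -> ~~ abelian 'Alt_('I_k).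
Proof.
move=> k4; apply/negP => /abelian_sol.
by rewrite solvable_AltF ?card_ord.
Qed.

(** * The criterion, and the failure of the property for cyclic groups *)

Section Main.
Variables (G : Type) (mul : G -> G -> G) (inv : G -> G) (one : G).
Hypothesis GL : group_laws mul inv one.
Notation hom := (hom mul).

Lemma hom_pow (gT : finGroupType) (f : G -> gT) x n : hom f -> f (iter n (mul x) one) = f x ^+ n.
Proof.
move=> fM; elim: n => [|n IH] /=; first by rewrite (hom1 GL).
by rewrite fM IH expgS.
Qed.

(* Otherwise [u |-> f u * (f' u)^-1] would be onto, hence injective, on the
   finite group, i.e. the automorphism [f u |-> f' u] would have no nontrivial
   fixed point; but it maps a q-cycle to a conjugate of itself. *)
Lemma Alt_twisted_nontrivial q (f f' : G -> {perm 'I_q.+2}) :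
  prime q -> 2 < q -> hom f -> hom f' -> onto f 'Alt_('I_q.+2)%G -> onto f' 'Alt_('I_q.+2)%G ->
  (forall x, f x = 1 <-> f' x = 1) ->
  exists2 s, s \in 'Alt_('I_q.+2) & forall z, s <> f z * (f' z)^-1.
Proof.
move=> q_pr q2 fM fM' fo fo' ker; apply: contrapT => no.
have full s : s \in 'Alt_('I_q.+2) -> exists z, s = f z * (f' z)^-1.
  move=> sA; apply: contrapT => nz; apply: no; exists s => // z zE; apply: nz.
  by exists z.
have eqf x y : f x = f y <-> f' x = f' y.
  have -> : f x = f y <-> f (mul x (inv y)) = 1.
    by rewrite fM (homV GL fM); split=> [->|/eqP]; rewrite ?mulgV // -eq_mulgV1 => /eqP.
  by rewrite ker fM' (homV GL fM'); split=> [/eqP|->]; rewrite ?mulgV // -eq_mulgV1 => /eqP.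
have [x0 fx0] := fo.2 _ (pcyc_even q_pr q2).
have pc1 : pcyc q_pr q2 != 1 by rewrite -order_eq1 (pcyc_order q_pr q2); lia.
have o' : #[f' x0] = q.
  apply: nt_prime_order => //.
    by rewrite -(hom_pow x0 q fM'); apply/ker; rewrite (hom_pow x0 q fM) fx0; have := expg_order (pcyc q_pr q2); rewrite pcyc_order.
  by apply/eqP => /ker; rewrite fx0; apply/eqP.
have [w wA wE] := Alt_order_q_conj q_pr q2 (fo'.1 x0) o'.
(* The conjugator itself has the form f z (f' z)^-1; conjugating [x0] by [z] then makes the two
   homomorphisms agree on [y]. *)
have [z zE] := full w wA.
pose y := mul (mul (inv z) x0) z.
have fy : f y = pcyc q_pr q2 ^ f z by rewrite /y !fM (homV GL fM) fx0 conjgE mulgA.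
have fy' : f' y = f y.
  rewrite fy /y !fM' (homV GL fM') wE zE !conjgE invMg invgK !mulgA mulVg mul1g.
  by rewrite mulgKV.
(* By [eqf] the value does not depend on the preimage. A map of a finite set onto itself is
   injective, but this one takes the value 1 both at 1 and at the nontrivial element [f y]. *)
pose h (s : {perm 'I_q.+2}) := if pselect (exists x, f x = s) is left h
   then f (projT1 (cid h)) * (f' (projT1 (cid h)))^-1 else 1.
have hf x : h (f x) = f x * (f' x)^-1.
  rewrite /h; case: pselect => [H|]; last by case; exists x.
  by case: (cid H) => x1 /= e; rewrite e; move/eqf: e => ->.
have : h @: 'Alt_('I_q.+2) = 'Alt_('I_q.+2).
  apply/eqP; rewrite finset.eqEsubset; apply/andP; split; apply/fintype.subsetP => t.
    case/imsetP => s /fo.2[x <-] ->; rewrite hf groupM ?groupV //; [exact: fo.1|exact: fo'.1].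
  by move=> /full[x ->]; rewrite -hf; apply: imset_f; exact: fo.1.
move/(congr1 (fun A : {set _} => #|A|))/eqP/imset_injP => /(_ (f y) (f one)).
rewrite !hf fy' (hom1 GL fM) (hom1 GL fM') invg1 !mulgV mulg1 fo.1 group1 => /(_ isT isT erefl).
by rewrite fy => /eqP; rewrite conjg_eq1; apply/negP.
Qed.

(** Some strictly increasing sequence of odd primes; primes may be skipped, since only infinitude
    matters. *)
Definition nth_prime i := iter i (fun p => s2val (prime_above p)) 3.
Lemma nth_prime_pr i : prime (nth_prime i) /\ 2 < nth_prime i.
Proof.
elim: i => //= i [_ IH]; case: prime_above => p /= lt pr; split=> //; lia.
Qed.
Lemma nth_prime_inj : injective nth_prime.
Proof.
have lt i j : i < j -> nth_prime i < nth_prime j.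
  elim: j => // j IH; rewrite ltnS leq_eqVlt /nth_prime /= => /orP[/eqP->|/IH h];
    by case: prime_above => p /= ? ? //; apply: ltn_trans h _.
by move=> i j E; case: (ltngtP i j) => // /lt; rewrite E ltnn.
Qed.

Theorem R_infty_of_Alt_quotients : fin_gen mul inv one ->
  (forall q, prime q -> 2 < q -> exists2 f : G -> {perm 'I_q.+2}, hom f & onto f 'Alt_('I_q.+2)%G) ->
  R_infty_property mul inv.
Proof.
move=> fg quo phi phi_aut.
pose p := nth_prime.
have prp i : prime (p i) := (nth_prime_pr i).1.
have p2 i : 2 < p i := (nth_prime_pr i).2.
pose f i : G -> {perm 'I_(p i).+2} := s2val (cid2 (quo (p i) (prp i) (p2 i))).
have fM i : hom (f i) := s2valP (cid2 (quo (p i) (prp i) (p2 i))).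
have fo i : onto (f i) 'Alt_('I_(p i).+2)%G := s2valP' (cid2 (quo (p i) (prp i) (p2 i))).
pose fj i j x := f i (iter j phi x).
have fjM i j : hom (fj i j) := hom_iter phi_aut (fM i) j.
have fjo i j : onto (fj i j) 'Alt_('I_(p i).+2)%G := onto_iter phi_aut (fo i) j.
have simp i : simple 'Alt_('I_(p i).+2) by apply: simple_Alt5; rewrite card_ord; have := p2 i; lia.
have nab i : ~~ abelian 'Alt_('I_(p i).+2) by apply: nonabelian_Alt; have := p2 i; lia.
pose d i := projT1 (cid (ker_period GL phi_aut (fM i) fg)).
have dP i : [/\ 0 < d i, forall x, fj i (d i) x = 1 <-> f i x = 1 &
    forall j, 0 < j < d i -> ~ (forall x, fj i j x = 1 <-> f i x = 1)].
  exact: (projT2 (cid (ker_period GL phi_aut (fM i) fg))).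
(* In other words, [s i] lies outside the class of 1 for the twisted conjugacy induced by the
   [d i]-th iterate of [phi]. *)
have exs i : exists2 s, s \in 'Alt_('I_(p i).+2) & forall z, s <> f i z * (fj i (d i) z)^-1.
  apply: Alt_twisted_nontrivial => // x; have [_ h _] := dP i; by rewrite h.
pose s i := s2val (cid2 (exs i)).
have sA i : s i \in 'Alt_('I_(p i).+2) := s2valP (cid2 (exs i)).
have sN i z : s i <> f i z * (fj i (d i) z)^-1 := s2valP' (cid2 (exs i)) z.
(* These conditions make the i-th twisted norm of x equal to [s i] and its other norms trivial. *)
have exx r i : i < r -> exists x, [/\ f i x = s i,
    forall j, 0 < j < d i -> fj i j x = 1 &
    forall i' j, i' < r -> i' != i -> j < d i' -> fj i' j x = 1].
  move=> ir.
  (* All pairs (index, iterate) whose homomorphism has to vanish at x; the pair (i, 0), where the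
     value [s i] is prescribed, is left out. *)
  pose L := [seq u <- [seq (i', j) | i' <- iota 0 r, j <- iota 0 (d i')] | u != (i, 0)].
  have LP u : u \in L = [&& u.1 < r, u.2 < d u.1 & u != (i, 0)].
    rewrite mem_filter andbC; case: u => a b; rewrite andbA; congr (_ && _).
    apply/allpairsPdep/andP => [[a' [b' []]]|[/= ar bd]].
      by rewrite !mem_iota /= !add0n => ? ? [-> ->].
    by exists a, b; rewrite !mem_iota /= !add0n.
  pose K n := let u := nth (0, 0) L n in fun x => fj u.1 u.2 x = 1.
  have [||x Kx fx] := @goursat _ _ _ _ GL _ (f i) _ (size L) K (fM i) (fo i) (simp i) (nab i) _ _ (s i) (sA i).
  - by move=> n _; apply: (normal_ker GL); exact: fjM.
  - move=> n nL; have := mem_nth (0, 0) nL; rewrite LP /K.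
    case: (nth _ _ _) => a b /= /and3P[ar bd ne].
    have [E|//] := ker_dichotomy GL (fM i) (fjM a b) (fo i) (fjo a b) (simp i) (simp a).
    (* Equal kernels give quotients of equal order, hence the same degree; the minimality of [d i]
       then excludes a positive iterate. *)
    have ai : a = i.
      apply: nth_prime_inj; apply: card_Alt_inj; apply/eqP; rewrite eqn_leq.
      apply/andP; split.
        by apply: (ker_sub_card GL (fM i) (fjM a b) (fo i) (fjo a b)) => x /E.
      by apply: (ker_sub_card GL (fjM a b) (fM i) (fjo a b) (fo i)) => x /E.
    subst a; have [_ _ h] := dP i; exfalso; apply: (h b).
      by rewrite bd andbT lt0n; apply: contra ne => /eqP->.
    by move=> x; exact: iff_sym (E x).
  have Kx' a b : (a, b) \in L -> fj a b x = 1.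
    move=> ab; have := Kx (index (a, b) L); rewrite index_mem ab => /(_ isT).
    by rewrite /K nth_index.
  exists x; split=> // [j /andP[j0 jd]|a b ar ai bd]; apply: Kx'; rewrite LP /=.
    by rewrite ir jd /= xpair_eqE eqxx /=; lia.
  by rewrite ar bd /= xpair_eqE negb_and ai.
rewrite /reidemeister_infinite => fin.
have [l lE] := (finite_seqP _).1 fin.
pose r := (size l).+1.
pose x i := if pselect (i < r) is left h then projT1 (cid (exx r i h)) else one.
have xP i : i < r -> [/\ f i (x i) = s i,
    forall j, 0 < j < d i -> fj i j (x i) = 1 &
    forall i' j, i' < r -> i' != i -> j < d i' -> fj i' j (x i) = 1].
  by move=> ir; rewrite /x; case: pselect => // h; case: (cid _).
pose X i := [set y | twisted_conj mul inv phi y (x i)]%classic.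
have : uniq [seq X i | i <- iota 0 r].
  rewrite map_inj_in_uniq ?iota_uniq // => i i'; rewrite !mem_iota /= !add0n => ir ir' E.
  apply: contrapT => ne.
  have : X i (x i).
    exists one; rewrite (aut1 GL phi_aut) (gmul1 GL).
    by rewrite (ginvE GL (gmul1 GL one)) (gmulx1 GL).
  rewrite E => -[z zE].
  (* The i-th norm takes the value [s i] at [x i] and 1 at [x i'], so a twisted conjugacy would
     write [s i] in the excluded form. *)
  have := twisted_normE GL phi_aut (fM i) (d i) (x i') z; rewrite -zE /twisted_norm.
  have [d0 _ _] := dP i.
  have -> : \prod_(j < d i) f i (iter j phi (x i)) = s i.
    have [fx fx0 _] := xP i ir; move: fx0; case: (d i) d0 => // n _ fx0.
    rewrite big_ord_recl /= fx big1 ?mulg1 // => j _.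
    exact: (fx0 j.+1 (ltn_ord j)).
  rewrite big1 => [|j _]; last first.
    by have [_ _ h] := xP i' ir'; apply: h => //; apply/eqP.
  by rewrite mulg1; apply: sN.
move/uniq_leq_size => /(_ l).
rewrite size_map size_iota ltnn => H; suff : false by []; apply: H => C /mapP[i _ ->].
have : reidemeister_classes mul inv phi (X i) by exists (x i).
by rewrite lE.
Qed.

(** A cyclic group is commutative, so inversion is an automorphism. Its twisted conjugates of y are
    the products of y with squares, and modulo squares only 1 and g remain. *)
Lemma not_R_infty_cyclic g : (forall x, gen mul inv one [set g]%classic x) ->
  ~ R_infty_property mul inv.
Proof.
move=> cyc; have mA := gmulA GL; have m1 := gmul1 GL; have mx1 := gmulx1 GL.
have commV x y : mul x y = mul y x -> mul (inv x) y = mul y (inv x).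
  move=> xy; apply: (gmulIx GL (z := x)); apply/esym.
  rewrite -!mA (gmulV GL) mx1 -[mul y x]xy.
  by rewrite mA (gmulV GL) m1.
have comm x y : mul x y = mul y x.
  have commg : mul g y = mul y g.
    elim: {x} (cyc y) => [|z ->|z t _ Hz _ Ht|z _ Hz] //.
    - by rewrite m1 mx1.
    - by rewrite mA Hz -mA Ht mA.
    - by apply/esym/commV.
  elim: (cyc x) => [|z ->|z t _ Hz _ Ht|z _ Hz] //.
  - by rewrite m1 mx1.
  - by rewrite -mA Ht mA Hz mA.
  - exact: commV.
have mAC x y z : mul (mul x y) z = mul (mul x z) y by rewrite -!mA (comm y).
have mACA x y z t : mul (mul x y) (mul z t) = mul (mul x z) (mul y t).
  by rewrite !mA (mAC x y z).
have aut : is_automorphism mul inv.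
  split; first by exists inv => x; exact: (ginvK GL).
  by move=> x y; rewrite (ginvM GL) comm.
pose C (y : G) := [set x | twisted_conj mul inv inv x y]%classic.
have sq x : exists z, x = mul z z \/ x = mul g (mul z z).
  elim: (cyc x) => [|y ->|y t _ [z zE] _ [w wE]|y _ [z zE]].
  - by exists one; left; rewrite m1.
  - by exists one; right; rewrite m1 mx1.
  - case: zE wE => -> [] ->.
    + by exists (mul z w); left; rewrite mACA.
    + exists (mul z w); right; rewrite mA (comm _ g) -!mA; congr mul.
      by rewrite mA mACA.
    + by exists (mul z w); right; rewrite -!mA; congr mul; rewrite !mA -[LHS]mA mACA !mA.
    + exists (mul g (mul z w)); left; rewrite mACA -[RHS]mACA; congr mul.
      by rewrite mACA.
  - case: zE => ->.
      by exists (inv z); left; rewrite (ginvM GL).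
    exists (mul (inv g) (inv z)); right.
    by rewrite !(ginvM GL) mACA !mA (gmulxV GL) m1 comm !mA.
have sub y z : (C (mul (mul z y) z) `<=` C y)%classic.
  move=> x [w ->]; exists (mul w z); rewrite !(ginvK GL) !mA; exact: mAC.
have CE y z : C (mul (mul z y) z) = C y.
  apply/seteqP; split; first exact: sub.
  have {1}-> : y = mul (mul (inv z) (mul (mul z y) z)) (inv z); last exact: sub.
  by rewrite !mA (gmulV GL) m1 -mA (gmulxV GL) mx1.
move=> /(_ inv aut); apply.
apply: (@sub_finite_set _ _ [set C one; C g]%classic); last exact: finite_set2.
move=> _ [y ->]; have [z [->|->]] := sq y.
  by left; rewrite -[C one](CE one z) mx1.
by right; rewrite -[C g](CE g z) (comm z g) mA.
Qed.
End Main.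

End AlternatingQuotients.

Import Order.TTheory GRing.Theory Num.Theory numFieldNormedType.Exports.
Local Open Scope classical_set_scope.
Local Open Scope ring_scope.

(** * Paths and homotopies *)

(** Both pieces are continuous on the whole space and agree on the zero set of [h], so the pasting
    needs no closed subspaces. *)
Lemma continuous_glue (R : realType) (Z Y : topologicalType) (h : Z -> R) (f g : Z -> Y) :
  continuous h -> continuous f -> continuous g -> (forall z, h z = 0 -> f z = g z) ->
  continuous (fun z => if h z <= 0 then f z else g z).
Proof.
move=> ch cf cg E z U /=.
have [hz|hz|hz] := ltgtP (h z) 0 => Uf;
  change (nbhs z [set x | U (if h x <= 0 then f x else g x)]).
- have := cf z _ Uf; have : nbhs z (h @^-1` _) := ch z _ (lt_nbhsl hz).
  by apply: filterS2 => x /= hx; rewrite ltW.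
- have := cg z _ Uf; have : nbhs z (h @^-1` _) := ch z _ (lt_nbhsr hz).
  by apply: filterS2 => x /= hx; rewrite leNgt hx.
- have Ug : nbhs (g z) U by rewrite -E.
  have := cg z _ Ug; have : nbhs z (f @^-1` _) := cf z _ Uf; apply: filterS2 => x /= ? ?; by case: ifP.
Qed.

(** A supremum argument: from a point close to c = sup one can always step past c, or reach 1. It
    stands in for Lebesgue numbers and subdivisions. *)
Lemma real_induction (R : realType) (P : R -> Prop) : P 0 ->
  (forall s, 0 <= s <= 1 -> exists2 e, 0 < e & forall u v, 0 <= u -> u <= v -> v <= 1 ->
     `|u - s| < e -> `|v - s| < e -> P u -> P v) -> P 1.
Proof.
move=> P0 step; pose A := [set s : R | 0 <= s <= 1 /\ P s].
have A0 : A 0 by split => //; rewrite lexx ler01.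
have ubA : ubound A 1 by move=> s [/andP[]].
have hs : has_sup A by split; [exists 0|exists 1].
pose c := sup A.
have c01 : 0 <= c <= 1.
  by rewrite (ub_le_sup _ A0) ?ge_sup //=; [exists 0|exists 1].
have [e e0 he] := step c c01.
have [u [/andP[u0 u1] Pu] cu] := sup_adherent e0 hs.
have uc : u <= c by apply: ub_le_sup => //; [exists 1|split; [rewrite u0 u1|]].
pose v := Num.min 1 (c + e / 2).
have uv : u <= v by rewrite le_min u1 /=; lra.
have v1 : v <= 1 by rewrite ge_min lexx.
have vc : `|v - c| < e.
  rewrite /v; case: (leP 1 (c + e / 2)) => h; rewrite ltr_norml; apply/andP; split; lra.
have Pv : P v by apply: (he u v) => //; rewrite ltr_norml; apply/andP; split; rewrite -/c in cu *; lra.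
have Av : A v by split => //; rewrite v1 (le_trans u0).
have : v <= c by apply: ub_le_sup => //; exists 1.
move: Pv; rewrite /v; case: (leP 1 (c + e / 2)) => // h _; lra.
Qed.

Lemma ct_cst (Z Y : topologicalType) (y : Y) : continuous (fun _ : Z => y).
Proof. by move=> z; exact: cvg_cst. Qed.
Lemma ct_id (Z : topologicalType) : continuous (fun z : Z => z).
Proof. by move=> z; exact: cvg_id. Qed.

Section ContinuousRules.
Variables (R : realType) (Z Y Y' : topologicalType).
Implicit Types f g : Z -> R.

Lemma ct_comp (f : Z -> Y) (g : Y -> Y') : continuous f -> continuous g -> continuous (fun z => g (f z)).
Proof. by move=> cf cg z; apply: continuous_comp; [exact: cf|exact: cg]. Qed.
Lemma ctD f g : continuous f -> continuous g -> continuous (fun z => f z + g z).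
Proof. by move=> cf cg z; apply: cvgD; [exact: cf|exact: cg]. Qed.
Lemma ctN f : continuous f -> continuous (fun z => - f z).
Proof. by move=> cf z; apply: cvgN; exact: cf. Qed.
Lemma ctM f g : continuous f -> continuous g -> continuous (fun z => f z * g z).
Proof. by move=> cf cg z; apply: cvgM; [exact: cf|exact: cg]. Qed.
Lemma ctX f n : continuous f -> continuous (fun z => f z ^+ n).
Proof.
move=> cf; elim: n => [|n IH]; first exact: ct_cst.
by under eq_fun do rewrite exprS; exact: ctM.
Qed.
Lemma ct_norm f : continuous f -> continuous (fun z => `|f z|).
Proof. by move=> cf z; apply: cvg_norm; exact: cf. Qed.
Lemma ct_max f g : continuous f -> continuous g -> continuous (fun z => Num.max (f z) (g z)).
Proof.
move=> cf cg; have -> : (fun z => Num.max (f z) (g z)) = (fun z => (f z + g z + `|f z - g z|) * 2^-1).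
  apply/funext => z; by case: (lerP (f z) (g z)) => h; lra.
by apply: ctM; [apply: ctD; [exact: ctD|apply: ct_norm; apply: ctD => //; exact: ctN]|exact: ct_cst].
Qed.
Lemma ct_min f g : continuous f -> continuous g -> continuous (fun z => Num.min (f z) (g z)).
Proof.
move=> cf cg; have -> : (fun z => Num.min (f z) (g z)) = (fun z => (f z + g z - `|f z - g z|) * 2^-1).
  apply/funext => z; by case: (lerP (f z) (g z)) => h; lra.
by apply: ctM; [apply: ctD; [exact: ctD|apply: ctN; apply: ct_norm; apply: ctD => //; exact: ctN]|exact: ct_cst].
Qed.
Lemma ct_sqrt f : continuous f -> continuous (fun z => Num.sqrt (f z)).
Proof. by move=> cf z; apply: continuous_comp; [exact: cf|exact: sqrt_continuous]. Qed.
Lemma ct_inv f : continuous f -> (forall z, f z != 0) -> continuous (fun z => (f z)^-1).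
Proof. by move=> cf nz z; apply: cvgV; [exact: nz|exact: cf]. Qed.
Lemma ct_pair (f : Z -> Y) (g : Z -> Y') : continuous f -> continuous g -> continuous (fun z => (f z, g z)).
Proof. by move=> cf cg z; apply: cvg_pair; [exact: cf|exact: cg]. Qed.
Lemma ct_fst (f : Z -> Y * Y') : continuous f -> continuous (fun z => (f z).1).
Proof. by move=> cf z; apply: (continuous_comp (cf z)); exact: cvg_fst. Qed.
Lemma ct_snd (f : Z -> Y * Y') : continuous f -> continuous (fun z => (f z).2).
Proof. by move=> cf z; apply: (continuous_comp (cf z)); exact: cvg_snd. Qed.
End ContinuousRules.

Ltac cont1 := match goal with
 | |- continuous (fun z => z) => exact: ct_id
 | H : continuous ?f |- continuous ?f => exact: H
 | |- continuous (fun z => @?f z + @?g z) => apply: ctD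
 | |- continuous (fun z => - @?f z) => apply: ctN
 | |- continuous (fun z => @?f z * @?g z) => apply: ctM
 | |- continuous (fun z => @?f z ^+ _) => apply: ctX
 | |- continuous (fun z => `| @?f z |) => apply: ct_norm
 | |- continuous (fun z => Num.max (@?f z) (@?g z)) => apply: ct_max
 | |- continuous (fun z => Num.min (@?f z) (@?g z)) => apply: ct_min
 | |- continuous (fun z => Num.sqrt (@?f z)) => apply: ct_sqrt
 | |- continuous (fun z => (@?f z, @?g z)) => apply: ct_pair
 | |- continuous (fun z => fst (@?f z)) => apply: ct_fst
 | |- continuous (fun z => snd (@?f z)) => apply: ct_snd
 | |- continuous fst => exact: (ct_fst (@ct_id _))
 | |- continuous snd => exact: (ct_snd (@ct_id _))
 | |- continuous (fun _ => _) => exact: ct_cst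
 | H : continuous ?g |- continuous (fun z => ?g (@?f z)) => apply: (ct_comp _ H)
 | |- continuous ?f =>
     lazymatch f with (fun _ => _) => fail | _ => change (continuous (fun z => f z)) end
 end.
Ltac cont := repeat cont1.

Section Clamp.
Variable R : realType.
(** The retraction of the line onto [0, 1]. Composing with it turns data on the interval or the
    square into maps that are continuous, and stay in the given space, everywhere. *)
Definition cl (s : R) : R := Num.max 0 (Num.min 1 s).
Lemma ct_cl : continuous cl. Proof. rewrite /cl; cont. Qed.
Lemma cl01 s : 0 <= cl s <= 1.
Proof. by rewrite /cl le_max lexx /= ge_max ler01 /= ge_min lexx. Qed.
Lemma clE s : 0 <= s <= 1 -> cl s = s.
Proof. by move=> /andP[h0 h1]; rewrite /cl (min_idPr h1) (max_idPr h0). Qed.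
Lemma cl0 : cl 0 = 0. Proof. by rewrite clE // lexx ler01. Qed.
Lemma cl1 : cl 1 = 1. Proof. by rewrite clE // lexx ler01. Qed.
End Clamp.

Section Paths.
Variables (R : realType) (Y : topologicalType).
Implicit Types (X : set Y) (x y z : Y) (c d e : R -> Y).

(** A path is a continuous map on the whole line that stays in [X] throughout; only its values on
    [0, 1] matter up to [hty], which compares paths through [cl]. *)
Definition pth X x y c := [/\ continuous c, forall s, X (c s), c 0 = x & c 1 = y].

Definition hty X c d := exists H : R * R -> Y,
  [/\ continuous H, forall p, X (H p), (forall s, H (s, 0) = c (cl s) /\ H (s, 1) = d (cl s))
    & forall t, H (0, t) = c 0 /\ H (1, t) = c 1].

Lemma hty_intro X c d (H : R * R -> Y) : continuous H ->
  (forall s t, 0 <= s <= 1 -> 0 <= t <= 1 -> X (H (s, t))) ->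
  (forall s, 0 <= s <= 1 -> H (s, 0) = c s /\ H (s, 1) = d s) ->
  (forall t, 0 <= t <= 1 -> H (0, t) = c 0 /\ H (1, t) = c 1) -> hty X c d.
Proof.
move=> cH XH Hcd Hends; exists (fun p => H (cl p.1, cl p.2)); split.
- by have := @ct_cl R => ccl; cont.
- by move=> p; apply: XH; exact: cl01.
- by move=> s /=; rewrite cl0 cl1; apply: Hcd; exact: cl01.
- by move=> t /=; rewrite cl0 cl1; apply: Hends; exact: cl01.
Qed.

Lemma hty_ends X c d : hty X c d -> c 0 = d 0 /\ c 1 = d 1.
Proof.
move=> [H [_ _ Hcd He]]; split.
  by have [_ e] := Hcd 0; have [e' _] := He 1; rewrite cl0 in e; rewrite -e' e.
by have [_ e] := Hcd 1; have [_ e'] := He 1; rewrite cl1 in e; rewrite -e' e.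
Qed.

Lemma hty_eq X c d : continuous c -> (forall s, X (c s)) ->
  (forall s, 0 <= s <= 1 -> c s = d s) -> hty X c d.
Proof.
move=> cc Xc E; apply: (@hty_intro X c d (fun p => c p.1)) => //=; first by cont.
by move=> s /E.
Qed.

Lemma hty_refl X c : continuous c -> (forall s, X (c s)) -> hty X c c.
Proof. by move=> cc Xc; exact: hty_eq. Qed.

Lemma hty_sym X c d : hty X c d -> hty X d c.
Proof.
move=> h; have [h0 h1] := hty_ends h; move: h => [H [cH XH Hcd He]].
apply: (@hty_intro X d c (fun p => H (p.1, 1 - p.2))) => //=; first by cont.
- by move=> s s01; rewrite subr0 subrr; have [-> ->] := Hcd s; rewrite clE.
- by move=> t _; have [-> ->] := He (1 - t).
Qed.

Lemma hty_trans X c d e : hty X c d -> hty X d e -> hty X c e.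
Proof.
move=> h; have [h0 h1] := hty_ends h; move: h => [H [cH XH Hcd He]] [K [cK XK Kde Ke]].
pose L p := if p.2 - 2^-1 <= 0 then H (p.1, 2 * p.2) else K (p.1, 2 * p.2 - 1).
apply: (@hty_intro X c e L).
- apply: continuous_glue; [by cont|by cont|by cont|].
  move=> [s t] /= th; have -> : 2 * t = 1 by lra.
  by rewrite subrr; have [_ ->] := Hcd s; have [->] := Kde s.
- by move=> s t _ _; rewrite /L; case: ifP.
- move=> s s01; rewrite /L /=; have -> : (0 - 2^-1 <= 0 :> R) by lra.
  have -> : (1 - 2^-1 <= 0 :> R) = false by apply/negbTE; rewrite -ltNge; lra.
  rewrite mulr0; have -> : 2 * 1 - 1 = 1 :> R by lra.
  by have [-> _] := Hcd s; have [_ ->] := Kde s; rewrite clE.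
- move=> t _; rewrite /L /=; case: ifP => _; first by have [-> ->] := He (2 * t).
  by have [-> ->] := Ke (2 * t - 1).
Qed.

(** Since [c] is defined on the whole line, the linear interpolation of the two parameters is always
    admissible. The unit, inverse and associativity laws below are instances. *)
Lemma hty_reparam X c (u v : R -> R) : continuous c -> (forall s, X (c s)) ->
  continuous u -> continuous v -> u 0 = v 0 -> u 1 = v 1 ->
  hty X (fun s => c (u s)) (fun s => c (v s)).
Proof.
move=> cc Xc cu cv E0 E1.
apply: (@hty_intro _ _ _ (fun p => c ((1 - p.2) * u p.1 + p.2 * v p.1))) => //=; first by cont.
- by move=> s _; split; congr c; ring.
- by move=> t _; rewrite -E0 -E1; split; congr c; ring.
Qed.

Definition concat c d : R -> Y := fun s => if s <= 2^-1 then c (2 * s) else d (2 * s - 1).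
Definition revp c : R -> Y := fun s => c (1 - s).

Lemma ct_concat c d : continuous c -> continuous d -> c 1 = d 0 -> continuous (concat c d).
Proof.
move=> cc cd E.
have -> : concat c d = fun s => if s - 2^-1 <= 0 then c (2 * s) else d (2 * s - 1).
  by apply/funext => s; rewrite /concat subr_le0.
apply: continuous_glue; [by cont|by cont|by cont|].
move=> s h; have -> : 2 * s = 1 by lra.
by rewrite subrr.
Qed.

Lemma concat0 c d : concat c d 0 = c 0.
Proof. by rewrite /concat ifT ?mulr0 //; lra. Qed.
Lemma concat1 c d : concat c d 1 = d 1.
Proof. by rewrite /concat ifF ?mulr1; [congr d; lra|apply/negbTE; rewrite -ltNge; lra]. Qed.

Lemma pth_concat X x y z c d : pth X x y c -> pth X y z d -> pth X x z (concat c d).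
Proof.
move=> [cc Xc c0 c1] [cd Xd d0 d1]; split.
- by apply: ct_concat => //; rewrite c1 d0.
- by move=> s; rewrite /concat; case: ifP.
- by rewrite concat0.
- by rewrite concat1.
Qed.

Lemma pth_rev X x y c : pth X x y c -> pth X y x (revp c).
Proof.
move=> [cc Xc c0 c1]; split=> //.
- by rewrite /revp; cont.
- by move=> s; exact: Xc.
- by rewrite /revp subr0.
- by rewrite /revp subrr.
Qed.

Lemma pth_cst X x : X x -> pth X x x (fun=> x).
Proof. by move=> Xx; split=> //; cont. Qed.

Lemma hty_concat X c c' d d' : hty X c c' -> hty X d d' -> c 1 = d 0 ->
  hty X (concat c d) (concat c' d').
Proof.
move=> [H [cH XH Hc He]] [K [cK XK Kd Ke]] E.
apply: (@hty_intro X _ _ (fun p => if p.1 - 2^-1 <= 0 then H (2 * p.1, p.2) else K (2 * p.1 - 1, p.2))).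
- apply: continuous_glue; [by cont|by cont|by cont|].
  move=> [s t] /= sh; have -> : 2 * s = 1 by lra.
  by rewrite subrr; have [_ ->] := He t; have [-> _] := Ke t.
- by move=> s t _ _; case: ifP.
- move=> s /andP[s0 s1]; rewrite /concat /= subr_le0; case: ifP => h.
    by have [-> ->] := Hc (2 * s); rewrite !clE //; lra.
  have {}h : 2^-1 < s by rewrite ltNge h.
  by have [-> ->] := Kd (2 * s - 1); rewrite !clE //; lra.
- move=> t _; rewrite concat0 concat1 /=.
  have -> : (0 - 2^-1 <= 0 :> R) by lra.
  have -> : (1 - 2^-1 <= 0 :> R) = false by apply/negbTE; rewrite -ltNge; lra.
  have [h0 _] := He t; have [_ h1] := Ke t.
  by rewrite mulr0 h0; split=> //; rewrite -h1; congr K; congr pair; lra.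
Qed.

Lemma hty_rev X c d : hty X c d -> hty X (revp c) (revp d).
Proof.
move=> [H [cH XH Hc He]].
apply: (@hty_intro X _ _ (fun p => H (1 - p.1, p.2))) => //=; first by cont.
- move=> s /andP[s0 s1]; rewrite /revp; have [-> ->] := Hc (1 - s).
  by rewrite !clE //; lra.
- by move=> t _; rewrite /revp subr0 subrr; have [-> ->] := He t.
Qed.

Lemma hty_sub X X' c d : X `<=` X' -> hty X c d -> hty X' c d.
Proof. by move=> s [H [cH XH Hc He]]; exists H; split=> // p; apply: s. Qed.

Lemma pth_sub X X' x y c : X `<=` X' -> pth X x y c -> pth X' x y c.
Proof. by move=> s [cc Xc c0 c1]; split=> // t; apply: s. Qed.

Definition seg c u v : R -> Y := fun s => c (u + (v - u) * cl s).

Lemma pth_seg_in X x y c u v : continuous c -> u <= v -> (forall s, u <= s <= v -> X (c s)) ->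
  c u = x -> c v = y -> pth X x y (seg c u v).
Proof.
move=> cc uv Xc <- <-; have ccl := @ct_cl R; rewrite /seg; split.
- by cont.
- move=> s; apply: Xc; have /andP[h0 h1] := cl01 s; apply/andP; split.
    by rewrite lerDl mulr_ge0 // subr_ge0.
  by rewrite -lerBrDl ler_piMr // subr_ge0.
- by rewrite cl0 mulr0 addr0.
- by rewrite cl1 mulr1 subrKC.
Qed.

Lemma pth_seg X x y c u v : continuous c -> (forall s, X (c s)) ->
  c u = x -> c v = y -> pth X x y (seg c u v).
Proof.
move=> cc Xc <- <-; have ccl := @ct_cl R; rewrite /seg; split => //.
- by cont.
- by rewrite cl0 mulr0 addr0.
- by rewrite cl1 mulr1 subrKC.
Qed.

Lemma hty_seg X c u v w : continuous c -> (forall s, X (c s)) ->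
  hty X (concat (seg c u v) (seg c v w)) (seg c u w).
Proof.
move=> cc Xc; have ccl := @ct_cl R.
pose f (s : R) := if s - 2^-1 <= 0 then u + (v - u) * cl (2 * s) else v + (w - v) * cl (2 * s - 1).
have cf : continuous f.
  apply: continuous_glue; [by cont|by cont|by cont|].
  move=> s h; have h2 : 2 * s = 1 :> R by lra.
  by rewrite h2 subrr cl0 cl1; ring.
have -> : concat (seg c u v) (seg c v w) = fun s => c (f s).
  by apply/funext => s; rewrite /concat /seg /f subr_le0; case: ifP.
apply: hty_reparam => //; first by cont.
  by rewrite /f ifT ?mulr0 ?cl0 //; lra.
rewrite /f ifF; last by apply/negbTE; rewrite -ltNge; lra.
have e21 : 2 * 1 - 1 = 1 :> R by lra.
by rewrite e21 cl1; ring.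
Qed.

Lemma hty_concat_rev X c : continuous c -> (forall s, X (c s)) ->
  hty X (concat c (revp c)) (fun=> c 0).
Proof.
move=> cc Xc.
pose f (s : R) := Num.min (2 * s) (2 - 2 * s).
have -> : concat c (revp c) = fun s => c (f s).
  apply/funext => s; rewrite /concat /revp /f; case: leP => h.
    by have -> : Num.min (2 * s) (2 - 2 * s) = 2 * s by apply/min_idPl; lra.
  have -> : Num.min (2 * s) (2 - 2 * s) = 2 - 2 * s by apply/min_idPr; lra.
  by congr c; lra.
by apply: (@hty_reparam X c f (fun=> 0)) => //; rewrite /f; cont; case: leP; lra.
Qed.

Lemma hty_concat_cst X c x : continuous c -> (forall s, X (c s)) -> x = c 1 ->
  hty X (concat c (fun=> x)) c.
Proof.
move=> cc Xc ->; pose f (s : R) := Num.min (2 * s) 1.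
have -> : concat c (fun=> c 1) = fun s => c (f s).
  apply/funext => s; rewrite /concat /f; case: leP => h.
    by have -> : Num.min (2 * s) 1 = 2 * s by apply/min_idPl; lra.
  by have -> : Num.min (2 * s) 1 = 1 by apply/min_idPr; lra.
by apply: (@hty_reparam X c f id) => //; rewrite /f; cont; case: leP; lra.
Qed.

Lemma hty_cst_concat X c x : continuous c -> (forall s, X (c s)) -> x = c 0 ->
  hty X (concat (fun=> x) c) c.
Proof.
move=> cc Xc ->; pose f (s : R) := Num.max (2 * s - 1) 0.
have -> : concat (fun=> c 0) c = fun s => c (f s).
  apply/funext => s; rewrite /concat /f; case: leP => h.
    by have -> : Num.max (2 * s - 1) 0 = 0 by apply/max_idPr; lra.
  by have -> : Num.max (2 * s - 1) 0 = 2 * s - 1 by apply/max_idPl; lra.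
by apply: (@hty_reparam X c f id) => //; rewrite /f; cont; case: leP; lra.
Qed.

Lemma hty_concatA X c d e : continuous c -> (forall s, X (c s)) ->
   continuous d -> (forall s, X (d s)) -> continuous e -> (forall s, X (e s)) ->
   c 1 = d 0 -> d 1 = e 0 ->
  hty X (concat c (concat d e)) (concat (concat c d) e).
Proof.
move=> cc Xc cd Xd ce Xe E1 E2.
pose g := concat (concat c d) e.
(* The piecewise linear map taking 0, 1/2, 3/4, 1 to 0, 1/4, 1/2, 1, the break points of the two
   bracketings. *)
pose f (s : R) := if s - 2^-1 <= 0 then s / 2 else Num.max (s - 4^-1) (2 * s - 1).
have cf : continuous f.
  apply: continuous_glue; [by cont|by cont|by cont|].
  move=> s h; have se : s = 2^-1 by lra.
  by rewrite se; case: leP => ?; lra.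
have cg : continuous g by apply: ct_concat => //; [exact: ct_concat|rewrite concat1].
have Xg s : X (g s) by rewrite /g /concat; do 2?case: ifP.
apply: (@hty_trans X _ (fun s => g (f s))).
  apply: hty_eq; first by apply: ct_concat => //; [exact: ct_concat|rewrite concat0].
    by move=> s; rewrite /concat; do 2?case: ifP.
  move=> s /andP[s0 s1]; rewrite /concat /g /concat /f subr_le0.
  case: (leP s 2^-1) => h.
    by rewrite !ifT; [congr c|..]; lra.
  case: (leP (2 * s - 1) 2^-1) => h2.
    have -> : Num.max (s - 4^-1) (2 * s - 1) = s - 4^-1 by apply/max_idPl; lra.
    rewrite ifT; last lra.
    case: leP => h3; last by congr d; lra.
    by exfalso; clear E1 E2; lra.
  have -> : Num.max (s - 4^-1) (2 * s - 1) = 2 * s - 1 by apply/max_idPr; lra.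
  by rewrite ifF //; apply/negbTE; rewrite -ltNge.
apply: (@hty_reparam X g f id) => //; first by cont.
  by rewrite /f ifT; lra.
by rewrite /f ifF; [case: leP; lra|apply/negbTE; rewrite -ltNge; lra].
Qed.

End Paths.

(** * The fundamental groupoid of a subset, and generation from a cover *)

Section Groupoid.
Variables (R : realType) (Y : topologicalType).
Implicit Types (X V : set Y) (c d e : R -> Y).

Definition cls X x y c : set (R -> Y) := [set d | pth X x y d /\ hty X c d].

(** Classes are sets of paths, so that homotopy becomes equality; the end points are indices, so
    that composability is a matter of typing. *)
Definition P X x y : Type := {S : set (R -> Y) | exists2 c, pth X x y c & S = cls X x y c}.

Definition pcl X x y c (h : pth X x y c) : P X x y := exist _ (cls X x y c) (ex_intro2 _ _ c h erefl).

Definition rep X x y (a : P X x y) : R -> Y := s2val (cid2 (proj2_sig a)).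
Lemma repP X x y (a : P X x y) : pth X x y (rep a).
Proof. exact: (s2valP (cid2 (proj2_sig a))). Qed.

Lemma pclE X x y c d (hc : pth X x y c) (hd : pth X x y d) : hty X c d -> pcl hc = pcl hd.
Proof.
move=> h; apply: eq_exist; apply/seteqP; split=> e [he cd]; split=> //.
  exact: hty_trans (hty_sym h) cd.
exact: hty_trans h cd.
Qed.

Lemma pcl_irr X x y c (h h' : pth X x y c) : pcl h = pcl h'.
Proof. by apply: pclE; case: h => ? ? _ _; exact: hty_refl. Qed.

Lemma pcl_hty X x y c d (hc : pth X x y c) (hd : pth X x y d) : pcl hc = pcl hd -> hty X c d.
Proof.
move=> /(congr1 (@proj1_sig _ _)) /= /seteqP[_ /(_ d)]; case=> //; split=> //.
by case: hd => ? ? _ _; exact: hty_refl.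
Qed.

Lemma repK X x y (a : P X x y) : pcl (repP a) = a.
Proof.
case: a => S hS; apply: eq_exist; rewrite /rep /=.
exact/esym/(s2valP' (cid2 hS)).
Qed.

Lemma pclP X x y (a : P X x y) : exists c (h : pth X x y c), a = pcl h.
Proof. by exists (rep a), (repP a); rewrite repK. Qed.

Definition pmul X x y z (a : P X x y) (b : P X y z) : P X x z :=
  pcl (pth_concat (repP a) (repP b)).
Definition pinv X x y (a : P X x y) : P X y x := pcl (pth_rev (repP a)).
Definition pone X x (hx : X x) : P X x x := pcl (pth_cst R hx).

Lemma hty_rep X x y c (h : pth X x y c) : hty X (rep (pcl h)) c.
Proof. by apply: (@pcl_hty _ _ _ _ _ (repP (pcl h)) h); rewrite repK. Qed.

Lemma pmulE X x y z c d (hc : pth X x y c) (hd : pth X y z d) :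
  pmul (pcl hc) (pcl hd) = pcl (pth_concat hc hd).
Proof.
apply: pclE; apply: hty_concat; [exact: hty_rep|exact: hty_rep|].
by have [_ _ _ ->] := repP (pcl hc); have [_ _ -> _] := repP (pcl hd).
Qed.

Lemma pinvE X x y c (hc : pth X x y c) : pinv (pcl hc) = pcl (pth_rev hc).
Proof. by apply: pclE; apply: hty_rev; exact: hty_rep. Qed.

Lemma pmulA X x y z t (a : P X x y) (b : P X y z) (c : P X z t) :
  pmul a (pmul b c) = pmul (pmul a b) c.
Proof.
have [c1 [h1 ->]] := pclP a; have [c2 [h2 ->]] := pclP b; have [c3 [h3 ->]] := pclP c.
rewrite !pmulE; apply: pclE.
case: h1 h2 h3 => ? ? _ e1 [? ? e2 e3] [? ? e4 _].
by apply: hty_concatA => //; congruence.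
Qed.

Lemma pmulp1 X x y (hy : X y) (a : P X x y) : pmul a (pone hy) = a.
Proof.
have [c [h ->]] := pclP a; rewrite pmulE; apply: pclE; case: h => ? ? _ e1.
by apply: hty_concat_cst.
Qed.

Lemma pmul1p X x y (hx : X x) (a : P X x y) : pmul (pone hx) a = a.
Proof.
have [c [h ->]] := pclP a; rewrite pmulE; apply: pclE; case: h => ? ? e1 _.
by apply: hty_cst_concat.
Qed.

Lemma pmulpV X x y (hx : X x) (a : P X x y) : pmul a (pinv a) = pone hx.
Proof.
have [c [h ->]] := pclP a; rewrite pinvE pmulE; apply: pclE; case: h => ? ? e1 _.
by rewrite -e1; apply: hty_concat_rev.
Qed.

Lemma pinvK X x y (a : P X x y) : pinv (pinv a) = a.
Proof.
have [c [h ->]] := pclP a; rewrite !pinvE; apply: pclE; case: h => ? ? _ _.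
have -> : revp (revp c) = c by apply/funext => s; rewrite /revp; congr c; ring.
exact: hty_refl.
Qed.

Lemma pmulVp X x y (hy : X y) (a : P X x y) : pmul (pinv a) a = pone hy.
Proof. by rewrite -{2}(pinvK a) pmulpV. Qed.

Lemma P_src X x y (a : P X x y) : X x.
Proof. by have [_ Xc e _] := repP a; have := Xc 0; rewrite e. Qed.
Lemma P_tgt X x y (a : P X x y) : X y.
Proof. by have [_ Xc _ e] := repP a; have := Xc 1; rewrite e. Qed.

Lemma pmulVK X x y z (a : P X x y) (b : P X y z) : pmul (pinv a) (pmul a b) = b.
Proof. by rewrite pmulA (pmulVp (P_tgt a)) pmul1p. Qed.
Lemma pmulK X x y z (a : P X x y) (b : P X y z) : pmul (pmul a b) (pinv b) = a.
Proof. by rewrite -pmulA (pmulpV (P_src b)) pmulp1. Qed.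
Lemma pmulKp X x y z (a : P X x y) (b : P X z y) : pmul (pmul a (pinv b)) b = a.
Proof. by rewrite -pmulA (pmulVp (P_tgt b)) pmulp1. Qed.

Lemma pmulI X x y z (a : P X x y) (b b' : P X y z) : pmul a b = pmul a b' -> b = b'.
Proof. by move=> h; rewrite -(pmulVK a b) h pmulVK. Qed.

Lemma pinvM X x y z (a : P X x y) (b : P X y z) : pinv (pmul a b) = pmul (pinv b) (pinv a).
Proof.
apply: (@pmulI _ _ _ _ (pmul a b)); rewrite (pmulpV (P_src a)) pmulA pmulK.
by rewrite (pmulpV (P_src a)).
Qed.

Lemma pmul_seg X c u v w x y z (cc : continuous c) (Xc : forall s, X (c s))
  (h1 : pth X x y (seg c u v)) (h2 : pth X y z (seg c v w)) (h3 : pth X x z (seg c u w)) :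
  pmul (pcl h1) (pcl h2) = pcl h3.
Proof. by rewrite pmulE; apply: pclE; exact: hty_seg. Qed.

Lemma pcl_seg01 X x y c (h1 : pth X x y (seg c 0 1)) (h2 : pth X x y c) : pcl h1 = pcl h2.
Proof.
apply: pclE; have [? ? _ _] := h1; apply: hty_eq => // s s01.
by rewrite /seg add0r subr0 mul1r clE.
Qed.

Lemma continuous_near01 c (s : R) (U : set Y) : continuous c -> nbhs (c s) U ->
  exists2 e, 0 < e & forall r, `|r - s| < e -> U (c r).
Proof.
move=> cc /(cc s); rewrite /= => /nbhs_ballP[e /= e0 he]; exists e => // r rs.
by apply: he; rewrite /ball /= distrC.
Qed.

(** The generation half of van Kampen's theorem, in a form that allows disconnected intersections: a
    subgroup containing the loops that pass from one set of the cover to another at a common point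
    contains all loops. *)
Lemma nerve_generation X x0 (I : Type) (V : I -> set Y) (p : I -> Y)
    (E : forall i, P X x0 (p i)) (H : P X x0 x0 -> Prop) (VX : forall i, V i `<=` X) :
  (forall a b, H a -> H b -> H (pmul a b)) ->
  (forall a, H a -> H (pinv a)) ->
  (forall x, X x -> exists i, \forall y \near x, X y -> V i y) ->
  (forall i x, V i x -> exists c, pth (V i) (p i) x c) ->
  (forall i a (h : pth (V i) (p i) x0 a), H (pmul (E i) (pcl (pth_sub (@VX i) h)))) ->
  (forall i j u a b (ha : pth (V i) (p i) u a) (hb : pth (V j) (p j) u b),
    H (pmul (pmul (E i) (pcl (pth_sub (@VX i) ha))) (pinv (pmul (E j) (pcl (pth_sub (@VX j) hb)))))) ->
  forall l, H l.
Proof.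
move=> HM HV cover pc base pair l.
have [c [hc ->]] := pclP l; have [cc Xc c0 c1] := hc.
have h0 s : pth X x0 (c s) (seg c 0 s) by apply: pth_seg.
(* The initial piece of the loop up to the parameter s, closed up through any set of the cover that
   contains [c s], belongs to [H]. *)
pose Q s := forall i a (h : pth (V i) (p i) (c s) a),
  H (pmul (pcl (h0 s)) (pinv (pmul (E i) (pcl (pth_sub (@VX i) h))))).
suff Q1 : Q 1.
  have [i ni] := cover _ (Xc 1).
  have [a ha] := pc i (c 1) (nbhs_singleton ni (Xc 1)).
  have ha' : pth (V i) (p i) x0 a by case: ha => ? ? ? ?; split=> //; rewrite -c1.
  have := HM _ _ (Q1 i a ha) (base i a ha').
  set m := pmul _ _; have -> // : m = pcl hc.
  rewrite /m {m}; move: (h0 1) ha => {Q1}; rewrite c1 => h1 ha.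
  by rewrite (pcl_irr _ (pth_sub (@VX i) ha')) pmulKp pcl_seg01.
apply: real_induction.
  move=> i a; have : seg c 0 0 = fun=> x0 by apply/funext => s; rewrite /seg subr0 mul0r addr0.
  move: (h0 0); rewrite c0 => h1 e ha.
  have := HV _ (base i a ha).
  suff -> : pcl h1 = pone (P_src l) by rewrite pmul1p.
  by apply: pclE; rewrite e; case: (pth_cst R (P_src l)) => ? ? _ _; exact: hty_refl.
move=> s _; have [k nk] := cover _ (Xc s).
have [e e0 he] := continuous_near01 cc nk; exists e => // u v u0 uv v1 us vs Qu i a ha.
have Vk r : u <= r <= v -> V k (c r).
  move=> /andP[ur rv]; apply: he => //; move: us vs; rewrite !ltr_norml.
  by move=> /andP[? ?] /andP[? ?]; apply/andP; split; lra.
have [b hb] := pc k (c u) (Vk u ltac:(by rewrite lexx)).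
have huv : pth (V k) (c u) (c v) (seg c u v) by exact: pth_seg_in.
have hb' := pth_concat hb huv.
have := HM _ _ (Qu k b hb) (pair k i (c v) _ a hb' ha).
have -> : pcl (pth_sub (@VX k) hb') = pmul (pcl (pth_sub (@VX k) hb)) (pcl (pth_sub (@VX k) huv)).
  by rewrite pmulE; exact: pcl_irr.
by rewrite [pinv (pmul (E k) _)]pinvM -!pmulA !pmulVK pmulA (pmul_seg cc Xc _ _ (h0 v)).
Qed.
End Groupoid.

(* [delta] is an Alexander-Spanier 1-cocycle: it is multiplicative for nearby
   points only, and [hol] integrates it along a path. *)
Section Holonomy.
Variables (R : realType) (Y : topologicalType) (gT : finGroupType).
Variables (X : set Y) (delta : Y -> Y -> gT).
Local Open Scope group_scope.
Local Notation "0" := (GRing.zero : R). Local Notation "1r" := (GRing.one _ : R).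

Definition local_cocycle := forall x, X x -> exists2 N, nbhs x N &
  forall u v w, N u -> N v -> N w -> X u -> X v -> X w -> delta u v * delta v w = delta u w.
Hypothesis dcoc : local_cocycle.

Lemma delta_refl x : X x -> delta x x = 1.
Proof.
move=> Xx; have [N nN h] := dcoc Xx; have Nx := nbhs_singleton nN.
by apply: (mulgI (delta x x)); rewrite mulg1 h.
Qed.

(** Here [f] is the running product of [delta] along [c]; the relation is required only between
    parameters close to a common one, where [delta] is multiplicative. *)
Definition flat (c : R -> Y) (f : R -> gT) := forall s : R, (0 <= s <= 1r)%R ->
  exists2 e : R, (0 < e)%R & forall u v, (0 <= u <= 1r)%R -> (0 <= v <= 1r)%R ->
    (`|u - s| < e)%R -> (`|v - s| < e)%R -> f u * delta (c u) (c v) = f v.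

Lemma flat_uniq c f f' : flat c f -> flat c f' -> f 0 = f' 0 -> f 1r = f' 1r.
Proof.
move=> hf hf' h0; apply: (@real_induction R (fun s => f s = f' s)) => // s s01.
have [e e0 he] := hf s s01; have [e' e0' he'] := hf' s s01.
exists (Num.min e e'); first by rewrite lt_min e0.
move=> u v u0 uv v1; rewrite !lt_min => /andP[h1 h2] /andP[h3 h4] E.
have u01 : (0 <= u <= 1r)%R by rewrite u0 (le_trans uv).
have v01 : (0 <= v <= 1r)%R by rewrite v1 (le_trans u0).
by rewrite -(he u v) // -(he' u v) // E.
Qed.

(** Along a stretch of the path inside one neighbourhood where [delta] is multiplicative, the local
    relations multiply to a single one. *)
Lemma flat_segment c f N u v : flat c f -> (0 <= u)%R -> (u <= v)%R -> (v <= 1r)%R ->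
  (forall a b d, N a -> N b -> N d -> X a -> X b -> X d -> delta a b * delta b d = delta a d) ->
  (forall s, X (c s)) -> (forall s, (u <= s <= v)%R -> N (c s)) ->
  f u * delta (c u) (c v) = f v.
Proof.
move=> hf u0 uv v1 hN Xc Nc.
pose g (r : R) := (u + (v - u) * r)%R.
have g01 (r : R) : (0 <= r)%R -> (r <= 1r)%R -> (u <= g r <= v)%R.
  move=> r0 r1; apply/andP; split; first by rewrite /g lerDl mulr_ge0 // subr_ge0.
  by rewrite /g -lerBrDl ler_piMr // subr_ge0.
suff : f u * delta (c u) (c (g 1r)) = f (g 1r) by rewrite /g mulr1 subrKC.
apply: (@real_induction R (fun r => f u * delta (c u) (c (g r)) = f (g r))).
  by rewrite /g mulr0 addr0 delta_refl // mulg1.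
move=> s /andP[s0 s1]; have /andP[gs0 gs1] := g01 s s0 s1.
have [|e e0 he] := hf (g s); first by rewrite (le_trans u0) // (le_trans gs1).
exists e => // a b a0 ab b1 ha hb E.
have close (r : R) : (`|r - s| < e)%R -> (`|g r - g s| < e)%R.
  move=> h; have -> : (g r - g s = (v - u) * (r - s))%R by rewrite /g; ring.
  rewrite normrM; apply: le_lt_trans h; rewrite ler_piMl // ger0_norm ?subr_ge0 //; lra.
have /andP[ga0 ga1] := g01 a a0 (le_trans ab b1).
have /andP[gb0 gb1] := g01 b (le_trans a0 ab) b1.
rewrite -(he (g a) (g b)); last 4 first.
- by rewrite (le_trans u0) // (le_trans ga1).
- by rewrite (le_trans u0) // (le_trans gb1).
- exact: close.
- exact: close.
rewrite -E -mulgA hN //; apply: Nc; [by rewrite lexx|by rewrite ga0|by rewrite gb0].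
Qed.

Lemma flat_exists c : continuous c -> (forall s, X (c s)) -> exists2 f, f 0 = 1 & flat c f.
Proof.
move=> cc Xc.
pose Q (t : R) := exists2 f : R -> gT, f 0 = 1 & forall s : R, (0 <= s <= t)%R ->
  exists2 e : R, (0 < e)%R & forall u v, (0 <= u <= t)%R -> (0 <= v <= t)%R ->
    (`|u - s| < e)%R -> (`|v - s| < e)%R -> f u * delta (c u) (c v) = f v.
suff: Q 1r by [].
apply: real_induction.
  exists (fun=> 1) => // s _; exists 1r => // u v /andP[u0 u1] /andP[v0 v1] _ _.
  have -> : u = 0 by apply/le_anti; rewrite u0 u1.
  have -> : v = 0 by apply/le_anti; rewrite v0 v1.
  by rewrite delta_refl ?mulg1.
move=> s _; have [N nN hN] := dcoc (Xc s).
have [e e0 he] := continuous_near01 cc nN; exists e => // u v u0 uv v1 us vs [f f0 hf].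
have Nr (r : R) : (u <= r <= v)%R -> N (c r).
  move=> /andP[ur rv]; apply: he => //; move: us vs; rewrite !ltr_norml.
  by move=> /andP[? ?] /andP[? ?]; apply/andP; split; lra.
(* Past u the solution is continued by a single factor, because the piece between u and v stays
   where [delta] is multiplicative. *)
exists (fun r => if (r <= u)%R then f r else f u * delta (c u) (c r)); first by rewrite u0.
move=> r /andP[r0 rv]; have [ru|ur|ru] := ltgtP r u.
- have [|e1 e10 h1] := hf r; first by rewrite r0 ltW.
  exists (Num.min e1 (u - r)); first by rewrite lt_min e10 subr_gt0.
  move=> a b /andP[a0 _] /andP[b0 _]; rewrite !lt_min => /andP[ha ha'] /andP[hb hb'].
  have au : (a <= u)%R by move: ha'; rewrite ltr_norml => /andP[_ ?]; lra.
  have bu : (b <= u)%R by move: hb'; rewrite ltr_norml => /andP[_ ?]; lra.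
  by rewrite au bu; apply: h1 => //; rewrite ?a0 ?b0.
- exists (r - u)%R; first by rewrite subr_gt0.
  move=> a b /andP[a0 av] /andP[b0 bv]; rewrite !ltr_norml => /andP[ha _] /andP[hb _].
  have au : (u < a)%R by lra.
  have bu : (u < b)%R by lra.
  rewrite !leNgt au bu /= -mulgA hN //; apply: Nr; rewrite ?lexx ?uv //; apply/andP; split; lra.
- have [|e1 e10 h1] := hf u; first by rewrite u0 lexx.
  exists (Num.min e1 (e - `|u - s|)); first by rewrite lt_min e10 subr_gt0.
  have key (a : R) : (0 <= a <= v)%R -> (`|a - r| < Num.min e1 (e - `|u - s|))%R ->
      (if (a <= u)%R then f a else f u * delta (c u) (c a)) = f u * delta (c u) (c a) /\ N (c a).
    move=> /andP[a0 av]; rewrite lt_min ru => /andP[ha ha']; split.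
      by case: ifP => // au; rewrite h1 ?lexx ?u0 ?a0 ?subrr ?normr0.
    by apply: he; apply: le_lt_trans (ler_distD u a s) _; lra.
  move=> a b a0v b0v ha hb; have [-> Na] := key a a0v ha; have [-> Nb] := key b b0v hb.
  by rewrite -mulgA hN //; apply: Nr; rewrite lexx.
Qed.

(** For a continuous path in [X] the default is not taken, by [flat_exists], and the choice of [f]
    does not matter, by [flat_uniq]. *)
Definition hol c : gT := if pselect (exists2 f, f 0 = 1 & flat c f) is left h
  then s2val (cid2 h) 1r else 1.

Lemma holE c f : f 0 = 1 -> flat c f -> hol c = f 1r.
Proof.
move=> f0 hf; rewrite /hol; case: pselect => [h|]; last by case; exists f.
by case: (cid2 h) => g g0 hg /=; apply: (flat_uniq hg hf); rewrite g0.
Qed.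

Lemma hol_concat c d : continuous c -> (forall s, X (c s)) -> continuous d ->
  (forall s, X (d s)) -> c 1r = d 0 -> hol (concat c d) = hol c * hol d.
Proof.
move=> cc Xc cd Xd E.
have cE := ct_concat cc cd E.
have XE s : X (concat c d s) by rewrite /concat; case: ifP.
have [f f0 hf] := flat_exists cE XE.
rewrite (holE f0 hf).
have hc : hol c = f (2^-1)%R.
  rewrite (@holE c (fun s => f (s / 2)%R)); [by rewrite mul1r|by rewrite mul0r|].
  move=> s /andP[s0 s1]; have [|e e0 he] := hf (s / 2)%R; first by apply/andP; split; lra.
  exists e => // u v /andP[u0 u1] /andP[v0 v1]; rewrite !ltr_norml => /andP[? ?] /andP[? ?].
  rewrite -(he (u / 2) (v / 2))%R ?ltr_norml; [|apply/andP; split; lra..].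
  rewrite /concat !ifT; [|lra..].
  by congr (_ * delta (c _) (c _)); lra.
have hd : hol d = (f (2^-1)%R)^-1 * f 1r.
  rewrite (@holE d (fun s => (f (2^-1)%R)^-1 * f ((1 + s) / 2)%R)).
  - by congr (_ * f _); lra.
  - by rewrite addr0 mul1r mulVg.
  move=> s /andP[s0 s1]; have [|e e0 he] := hf ((1 + s) / 2)%R; first by apply/andP; split; lra.
  exists e => // u v /andP[u0 u1] /andP[v0 v1]; rewrite !ltr_norml => /andP[? ?] /andP[? ?].
  rewrite -(he ((1 + u) / 2) ((1 + v) / 2))%R ?ltr_norml; [|apply/andP; split; lra..].
  have dE (w : R) : (0 <= w)%R -> concat c d ((1 + w) / 2) = d w.
    move=> w0; rewrite /concat; case: leP => h.
      have -> : w = 0 by lra.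
      by rewrite -E; congr c; lra.
    by congr d; lra.
  by rewrite !dE // mulgA.
by rewrite hc hd mulKVg.
Qed.

Lemma hol_hty c d : hty X c d -> hol c = hol d.
Proof.
move=> [H [cH XH Hcd He]].
have cHt (t : R) : continuous (fun s => H (s, t)) by cont.
have hF t := flat_exists (cHt t) (fun s => XH (s, t)).
pose f t := s2val (cid2 (hF t)).
have f0 t : f t 0 = 1 := s2valP (cid2 (hF t)).
have fl t : flat (fun s => H (s, t)) (f t) := s2valP' (cid2 (hF t)).
have hE (e : R -> Y) b : (forall s, H (s, b) = e (cl s)) -> hol e = f b 1r.
  move=> h; apply: holE => // s s01; have [eps eps0 heps] := fl b s s01; exists eps => // u v u01 v01 hu hv.
  by rewrite -(heps u v) // !h !clE.
rewrite (hE c 0); last by move=> s; have [] := Hcd s.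
rewrite (hE d 1r); last by move=> s; have [] := Hcd s.
(* It is enough that the end value is locally constant in the homotopy parameter. *)
suff loc t0 : (0 <= t0 <= 1r)%R -> exists2 e : R, (0 < e)%R & forall t : R, (0 <= t <= 1r)%R -> (`|t - t0| < e)%R -> f t 1r = f t0 1r.
  apply: (@real_induction R (fun t => f 0 1r = f t 1r)) => // t0 t01.
  have [e e0 he] := loc t0 t01; exists e => // u v u0 uv v1 hu hv ->.
  by rewrite (he u) ?(he v) // ?u0 ?v1 ?(le_trans u0) // (le_trans uv).
move=> t01.
(* The running products at the levels t and t0 differ by the factor [delta] across the gap. This
   relation is carried along s through small squares, and the gap closes at the fixed end point. *)
pose Q (s : R) := exists2 e : R, (0 < e)%R & forall t : R, (0 <= t <= 1r)%R -> (`|t - t0| < e)%R ->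
  f t s * delta (H (s, t)) (H (s, t0)) = f t0 s.
suff [e e0 he] : Q 1r.
  exists e => // t ht h; rewrite -(he t ht h).
  have [_ e1] := He t; have [_ e2] := He t0.
  by rewrite e1 e2 delta_refl ?mulg1 // -e1.
apply: real_induction.
  exists 1r => // t _ _; have [e1 _] := He t; have [e2 _] := He t0.
  by rewrite e1 e2 delta_refl ?mulg1 ?f0 // -e1.
move=> s _; have [N nN hN] := dcoc (XH (s, t0)).
have /nbhs_ballP[e /= e0 he] : nbhs (s, t0) (H @^-1` N) by exact: cH.
have NH (r t : R) : (`|r - s| < e)%R -> (`|t - t0| < e)%R -> N (H (r, t)).
  by move=> h1 h2; apply: (he (r, t)); split; rewrite /ball /= distrC.
exists e => // u v u0 uv v1 us vs [e2 e20 h2].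
exists (Num.min e e2); first by rewrite lt_min e0.
move=> t tt; rewrite lt_min => /andP[ht ht2].
have inuv (r : R) : (u <= r <= v)%R -> (`|r - s| < e)%R.
  move=> /andP[ur rv]; move: us vs; rewrite !ltr_norml.
  by move=> /andP[? ?] /andP[? ?]; apply/andP; split; lra.
have t00 : (`|t0 - t0| < e)%R by rewrite subrr normr0.
have stp (b : R) : (`|b - t0| < e)%R -> f b u * delta (H (u, b)) (H (v, b)) = f b v.
  move=> hb; apply: (flat_segment (fl b) u0 uv v1 hN) => // r /inuv hr; exact: NH.
rewrite -(stp t) // -(stp t0) // -(h2 t) // -!mulgA !hN //; exact: NH.
Qed.

Lemma hol_exact c g : (forall u v : R, (0 <= u <= 1r)%R -> (0 <= v <= 1r)%R ->
   delta (c u) (c v) = (g u)^-1 * g v) -> hol c = (g 0)^-1 * g 1r.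
Proof.
move=> h; apply: (@holE c (fun s => (g 0)^-1 * g s)); first by rewrite mulVg.
move=> s _; exists 1r => // u v u01 v01 _ _.
by rewrite h // -!mulgA mulKVg.
Qed.
End Holonomy.

(** * Maps between spaces and their effect on path classes *)

Section PathMap.
Variables (R : realType).

Lemma square_hty (Y : topologicalType) (X : set Y) (K : R * R -> Y) (u v : R -> R * R) :
  continuous K -> (forall p, X (K p)) -> continuous u -> continuous v -> u 0 = v 0 -> u 1 = v 1 ->
  hty X (fun s => K (u s)) (fun s => K (v s)).
Proof.
move=> cK XK cu cv E0 E1.
apply: (@hty_intro _ _ _ _ _ (fun p => K ((1 - p.2) * (u p.1).1 + p.2 * (v p.1).1,
                                      (1 - p.2) * (u p.1).2 + p.2 * (v p.1).2))) => //=.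
- by cont.
- move=> s _; split; rewrite ?subr0 ?subrr ?mul1r ?mul0r ?addr0 ?add0r; congr K; by case: (_ s).
- move=> t _; rewrite -E0 -E1.
  by split; congr K; case: (u _) => a b /=; congr pair; ring.
Qed.

(** Continuity tested only against maps of the plane into [X]. This is all that paths and homotopies
    need, and it covers maps such as a stereographic projection that are continuous only away from a
    point. *)
Definition tcont (Y Y' : topologicalType) (X : set Y) (g : Y -> Y') :=
  forall h : R * R -> Y, continuous h -> (forall p, X (h p)) -> continuous (fun p => g (h p)).

Lemma tcont_continuous (Y Y' : topologicalType) (X : set Y) (g : Y -> Y') :
  continuous g -> tcont X g.
Proof. by move=> cg h ch _; cont. Qed.

Lemma tcont1 (Y Y' : topologicalType) (X : set Y) (g : Y -> Y') (c : R -> Y) :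
  tcont X g -> continuous c -> (forall s, X (c s)) -> continuous (fun s => g (c s)).
Proof.
move=> tg cc Xc; have ch : continuous (fun p : R * R => c p.1) by cont.
have cg := tg _ ch (fun p => Xc p.1).
by apply: (@ct_comp _ _ _ (fun s : R => (s, 0 : R)) _ _ cg); cont.
Qed.

Variables (Y Y' : topologicalType) (X : set Y) (X' : set Y') (g : Y -> Y').
Hypotheses (tg : tcont X g) (gX : forall x, X x -> X' (g x)).

Lemma pth_map x y (c : R -> Y) : pth X x y c -> pth X' (g x) (g y) (fun s => g (c s)).
Proof.
move=> [cc Xc c0 c1]; split; [exact: (tcont1 tg cc Xc)|by move=> s; exact: gX|by rewrite c0|by rewrite c1].
Qed.

Lemma hty_map (c d : R -> Y) : hty X c d -> hty X' (fun s => g (c s)) (fun s => g (d s)).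
Proof.
move=> [H [cH XH Hcd He]]; exists (fun p => g (H p)); split.
- exact: tg.
- by move=> p; exact: gX.
- by move=> s; have [-> ->] := Hcd s.
- by move=> t; have [-> ->] := He t.
Qed.

Definition pmap x y (a : P R X x y) : P R X' (g x) (g y) := pcl (pth_map (repP a)).

Lemma pmapE x y (c : R -> Y) (h : pth X x y c) (h' : pth X' (g x) (g y) (fun s => g (c s))) :
  pmap (pcl h) = pcl h'.
Proof. by apply: pclE; apply: hty_map; exact: hty_rep. Qed.

Lemma pmapM x y z (a : P R X x y) (b : P R X y z) : pmap (pmul a b) = pmul (pmap a) (pmap b).
Proof.
have [c [h ->]] := pclP a; have [d [k ->]] := pclP b.
rewrite pmulE (pmapE h (pth_map h)) (pmapE k (pth_map k)) pmulE (pmapE _ (pth_map (pth_concat h k))).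
apply: pclE; set e := (X in hty _ X _).
have -> : e = concat (fun s => g (c s)) (fun s => g (d s)).
  by apply/funext => s; rewrite /e /concat; case: ifP.
by case: (pth_concat (pth_map h) (pth_map k)) => ? ? _ _; exact: hty_refl.
Qed.

Lemma pmapV x y (a : P R X x y) : pmap (pinv a) = pinv (pmap a).
Proof.
have [c [h ->]] := pclP a.
rewrite pinvE (pmapE h (pth_map h)) pinvE (pmapE _ (pth_map (pth_rev h))).
exact: pcl_irr.
Qed.

Lemma pmap1 x (hx : X x) (hx' : X' (g x)) : pmap (pone R hx) = pone R hx'.
Proof. by rewrite (pmapE _ (pth_cst R hx')). Qed.
End PathMap.

(** * Loop groups and change of base point *)

Section LoopGroups.
Variables (R : realType) (Y : topologicalType).
Implicit Types X : set Y.

Lemma loop_laws X x (hx : X x) : group_laws (@pmul R Y X x x x) (@pinv R Y X x x) (pone R hx).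
Proof.
split; [exact: pmulA|exact: pmul1p|exact: pmulp1|exact: pmulVp|exact: pmulpV].
Qed.

Definition pconn X := forall x y, X x -> X y -> exists c : R -> Y, pth X x y c.

Definition loop_gen X x (hx : X x) := gen (@pmul R Y X x x x) (@pinv R Y X x x) (pone R hx).

Definition cyc X x (hx : X x) := exists g, forall l, loop_gen hx [set g] l.

Definition loop_fg X x (hx : X x) := fin_gen (@pmul R Y X x x x) (@pinv R Y X x x) (pone R hx).

Definition pconj X x y (a : P R X x y) (l : P R X x x) : P R X y y := pmul (pmul (pinv a) l) a.

Lemma conj_gen X x y (hx : X x) (hy : X y) (a : P R X x y) F l :
  loop_gen hx F l -> loop_gen hy (pconj a @` F) (pconj a l).
Proof.
elim=> [|b Fb|b b' _ h _ h'|b _ h].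
- by rewrite /pconj pmulp1 (pmulVp hy); exact: gen1.
- by apply: gen_in; exists b.
- have -> : pconj a (pmul b b') = pmul (pconj a b) (pconj a b') by rewrite /pconj !pmulA pmulK.
  exact: genM.
- have -> : pconj a (pinv b) = pinv (pconj a b) by rewrite /pconj !pinvM pinvK pmulA.
  exact: genV.
Qed.

Lemma conj_surj X x y (a : P R X x y) l : exists l', l = pconj a l'.
Proof. by exists (pmul (pmul a l) (pinv a)); rewrite /pconj -!pmulA pmulVK pmulA pmulKp. Qed.

Lemma cyc_conj X x y (hx : X x) (hy : X y) (a : P R X x y) : cyc hx -> cyc hy.
Proof.
move=> [g hg]; exists (pconj a g) => l; have [l' ->] := conj_surj a l.
by have := conj_gen hy a (hg l'); rewrite image_set1.
Qed.
End LoopGroups.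

(** * Fibrations *)

Section Fibration.
Variables (R : realType) (Y T : topologicalType) (B : set Y) (Fib : Y -> set T).
Definition total : set (Y * T) := [set z | B z.1 /\ Fib z.1 z.2].

(** A weakening of local triviality: [tau y1 y2] carries the fibre over y1 into the fibre over y2
    continuously and is the identity for y1 = y2, but it need not be invertible. Homotopy lifting
    needs no more. *)
Definition local_transport := forall y, B y -> exists (N : set Y) (tau : Y -> Y -> T -> T), 
  [/\ nbhs y N,
   (forall y1 y2 x, N y1 -> B y1 -> N y2 -> B y2 -> Fib y1 x -> Fib y2 (tau y1 y2 x)),
   (forall y1 x, N y1 -> B y1 -> Fib y1 x -> tau y1 y1 x = x) &
   (forall (a b : R * R -> Y) (c : R * R -> T), continuous a -> continuous b -> continuous c ->
     (forall z, N (a z)) -> (forall z, B (a z)) -> (forall z, N (b z)) -> (forall z, B (b z)) ->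
     (forall z, Fib (a z) (c z)) -> continuous (fun z => tau (a z) (b z) (c z)))].
Hypothesis loc : local_transport.

Let clp (u v r : R) : R := Num.max u (Num.min v r).
Let ct_clp u v : continuous (clp u v). Proof. rewrite /clp; cont. Qed.
Let clp_bd u v r : u <= v -> u <= clp u v r <= v.
Proof. by move=> uv; rewrite /clp le_max lexx /= ge_max uv ge_min lexx. Qed.
Let clpE u v r : u <= r <= v -> clp u v r = r.
Proof. by move=> /andP[h0 h1]; rewrite /clp (min_idPr h1) (max_idPr h0). Qed.

(** A thin strip is filled box by box from left to right. In a new box the lift is known on the left
    edge and on the bottom edge; every other point is reached by moving diagonally from one of these
    edges and transporting along. *)
Lemma strip_lift (H : R * R -> Y) (t0 : R) : continuous H -> (forall p, B (H p)) ->
  exists2 e : R, 0 < e & forall u v : R, u <= v -> `|u - t0| < e -> `|v - t0| < e ->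
    forall xi : R -> T, continuous xi -> (forall r : R, 0 <= r <= 1 -> Fib (H (r, u)) (xi r)) ->
    exists X : R * R -> T, [/\ continuous X,
      (forall r t : R, 0 <= r <= 1 -> u <= t <= v -> Fib (H (r, t)) (X (r, t))) &
      forall r : R, 0 <= r <= 1 -> X (r, u) = xi r].
Proof.
move=> cH BH.
pose Q (s : R) := exists2 e : R, 0 < e & forall u v : R, u <= v -> `|u - t0| < e -> `|v - t0| < e ->
    forall xi : R -> T, continuous xi -> (forall r : R, 0 <= r <= 1 -> Fib (H (r, u)) (xi r)) ->
    exists X : R * R -> T, [/\ continuous X,
      (forall r t : R, 0 <= r <= s -> u <= t <= v -> Fib (H (r, t)) (X (r, t))) &
      forall r : R, 0 <= r <= s -> X (r, u) = xi r].
have box (s : R) : exists (N : set Y) (tau : Y -> Y -> T -> T) (e : R), 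
   [/\ 0 < e, forall r t : R, `|r - s| < e -> `|t - t0| < e -> N (H (r, t)),
   (forall y1 y2 x, N y1 -> B y1 -> N y2 -> B y2 -> Fib y1 x -> Fib y2 (tau y1 y2 x)),
   (forall y1 x, N y1 -> B y1 -> Fib y1 x -> tau y1 y1 x = x) &
   (forall (a b : R * R -> Y) (c : R * R -> T), continuous a -> continuous b -> continuous c ->
     (forall z, N (a z)) -> (forall z, B (a z)) -> (forall z, N (b z)) -> (forall z, B (b z)) ->
     (forall z, Fib (a z) (c z)) -> continuous (fun z => tau (a z) (b z) (c z)))].
  have [N [tau [nN h1 h2 h3]]] := loc (BH (s, t0)).
  have /nbhs_ballP[e /= e0 he] : nbhs (s, t0) (H @^-1` N) by exact: cH.
  exists N, tau, e; split=> // r t hr ht.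
  by apply: (he (r, t)); split; rewrite /ball /= distrC.
have near_mid (u v e t : R) : `|u - t0| < e -> `|v - t0| < e -> u <= t <= v -> `|t - t0| < e.
  rewrite !ltr_norml => /andP[? ?] /andP[? ?] /andP[? ?]; apply/andP; split; lra.
have near_mid' (s u v e t : R) : `|u - s| < e -> `|v - s| < e -> u <= t <= v -> `|t - s| < e.
  rewrite !ltr_norml => /andP[? ?] /andP[? ?] /andP[? ?]; apply/andP; split; lra.
suff: Q 1 by [].
apply: real_induction.
  have [N [tau [e [e0 hN h1 h2 h3]]]] := box 0; exists e => // u v uv hu hv xi cxi Fxi.
  have NH t : N (H (0, clp u v t)).
    by apply: hN; [rewrite subrr normr0|apply: near_mid hu hv _; exact: clp_bd].
  have NHu : N (H (0, u)) by apply: hN => //; rewrite subrr normr0.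
  have F0 : Fib (H (0, u)) (xi 0) by apply: Fxi; rewrite lexx ler01.
  exists (fun p => tau (H (0, u)) (H (0, clp u v p.2)) (xi 0)); split.
  - by have := @ct_clp u v => ?; apply: h3 => //; cont.
  - move=> r t /andP[r0 r0'] utv; have -> : r = 0 by apply/le_anti; rewrite r0 r0'.
    by rewrite /= -{1}(clpE utv); apply: h1.
  - move=> r /andP[r0 r0']; have -> : r = 0 by apply/le_anti; rewrite r0 r0'.
    by rewrite /= clpE ?lexx //; apply: h2.
move=> s _; have [N [tau [e1 [e10 hN h1 h2 h3]]]] := box s.
exists e1 => // s1 s2 s10 s12 s21 hs1 hs2 [e2 e20 Q1].
exists (Num.min e1 e2); first by rewrite lt_min e10.
move=> u v uv; rewrite !lt_min => /andP[hu hu2] /andP[hv hv2] xi cxi Fxi.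
have [X1 [cX1 FX1 X1u]] := Q1 u v uv hu2 hv2 xi cxi Fxi.
pose r' (p : R * R) := clp s1 s2 p.1; pose t' (p : R * R) := clp u v p.2.
have cr : continuous r' by have := @ct_clp s1 s2 => ?; rewrite /r'; cont.
have ct : continuous t' by have := @ct_clp u v => ?; rewrite /t'; cont.
have hr p : s1 <= r' p <= s2 by exact: clp_bd.
have ht p : u <= t' p <= v by exact: clp_bd.
(* The diagonal distance from a point of the box to its left or bottom edge; [L] is the known lift
   at the point of the edge reached, and the two edges agree at the corner. *)
pose m p := Num.min (r' p - s1) (t' p - u).
have cm : continuous m by rewrite /m; cont.
pose L p := if (r' p - s1) - (t' p - u) <= 0 then X1 (s1, t' p - (r' p - s1)) else xi (r' p - (t' p - u)).
have cL : continuous L.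
  apply: continuous_glue; [by cont|by cont|by cont|].
  move=> p E; have e3 : t' p - (r' p - s1) = u by lra.
  have e4 : r' p - (t' p - u) = s1 by lra.
  by rewrite e3 e4 X1u // s10 lexx.
pose a p := H (r' p - m p, t' p - m p).
pose b p := H (r' p, t' p).
have s11 : s1 <= 1 by exact: le_trans s12 s21.
have Fa p : Fib (a p) (L p).
  have /andP[hr1 hr2] := hr p; have /andP[ht1 ht2] := ht p.
  rewrite /a /L /m; case: ifP => h.
    have -> : Num.min (r' p - s1) (t' p - u) = r' p - s1 by apply/min_idPl; lra.
    rewrite subKr; apply: FX1; first by rewrite s10 lexx.
    by apply/andP; split; lra.
  have {}h : 0 < r' p - s1 - (t' p - u) by rewrite ltNge h.
  have -> : Num.min (r' p - s1) (t' p - u) = t' p - u by apply/min_idPr; lra.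
  rewrite subKr; apply: Fxi; apply/andP; split; lra.
have Na p : N (a p).
  have /andP[hr1 hr2] := hr p; have /andP[ht1 ht2] := ht p.
  have [m0 mr mt] : [/\ 0 <= m p, m p <= r' p - s1 & m p <= t' p - u].
    by split; rewrite /m ?le_min ?ge_min ?lexx ?orbT // !subr_ge0 hr1 ht1.
  apply: hN.
    by apply: near_mid' hs1 hs2 _; apply/andP; split; lra.
  by apply: near_mid hu hv _; apply/andP; split; lra.
have Nb p : N (b p).
  by apply: hN; [apply: near_mid' hs1 hs2 (hr p)|apply: near_mid hu hv (ht p)].
pose K p := tau (a p) (b p) (L p).
have cK : continuous K by apply: h3 => //; rewrite /a /b; cont.
have FK p : Fib (b p) (K p) by apply: (h1 (a p)) => //; exact: BH.
exists (fun p => if p.1 - s1 <= 0 then X1 (p.1, t' p) else K p); split.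
- apply: continuous_glue; [by cont|by cont|by []|].
  move=> p E; have E1 : p.1 = s1 by lra.
  have er : r' p = s1 by rewrite /r' E1 clpE // lexx.
  have em : m p = 0.
    by rewrite /m er subrr; apply/min_idPl; rewrite subr_ge0; case/andP: (ht p).
  rewrite /K; have -> : a p = b p by rewrite /a /b em !subr0.
  have ab : a p = b p by rewrite /a /b em !subr0.
  rewrite h2; [|exact: Nb|exact: BH|by rewrite -ab; exact: Fa].
  rewrite /L er subrr sub0r ifT; first by rewrite subr0 E1.
  by rewrite oppr_le0 subr_ge0; case/andP: (ht p).
- move=> r t /andP[r0 rs] utv /=; have et : t' (r, t) = t by rewrite /t' clpE.
  case: ifP => h; first by rewrite et; apply: FX1 => //; rewrite r0 /=; lra.
  have er : r' (r, t) = r.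
    by rewrite /r' clpE //= rs andbT; move/negbT: h; rewrite -ltNge; lra.
  by have := FK (r, t); rewrite /b er et.
- move=> r /andP[r0 rs] /=; have et : t' (r, u) = u by rewrite /t' clpE // lexx.
  case: ifP => h; first by rewrite et; apply: X1u; rewrite r0 /=; lra.
  have hrs : s1 < r by move/negbT: h; rewrite -ltNge; lra.
  have er : r' (r, u) = r by rewrite /r' clpE //= rs andbT ltW.
  have em : m (r, u) = 0 by rewrite /m et subrr; apply/min_idPr; rewrite er; lra.
  rewrite /K; have -> : a (r, u) = b (r, u) by rewrite /a /b em !subr0.
  have EL : L (r, u) = xi r.
    rewrite /L er et subrr subr0 ifF ?subr0 //; apply/negbTE; rewrite -ltNge; lra.
  rewrite EL h2; [by []|exact: Nb|exact: BH|].
  by rewrite /b er et; apply: Fxi; apply/andP; split; lra.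
Qed.

(** Thin strips are stacked by real induction in the second variable. *)
Lemma homotopy_lift (H : R * R -> Y) (xi : R -> T) : continuous H -> (forall p, B (H p)) ->
  continuous xi -> (forall r : R, 0 <= r <= 1 -> Fib (H (r, 0)) (xi r)) ->
  exists X : R * R -> T, [/\ continuous X,
    (forall r t : R, 0 <= r <= 1 -> 0 <= t <= 1 -> Fib (H (r, t)) (X (r, t))) &
    forall r : R, 0 <= r <= 1 -> X (r, 0) = xi r].
Proof.
move=> cH BH cxi Fxi.
pose Q (t : R) := exists X : R * R -> T, [/\ continuous X,
    (forall r t' : R, 0 <= r <= 1 -> 0 <= t' <= t -> Fib (H (r, t')) (X (r, t'))) &
    forall r : R, 0 <= r <= 1 -> X (r, 0) = xi r].
suff: Q 1 by [].
apply: real_induction.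
  exists (fun p => xi p.1); split => //; first by cont.
  move=> r t r01 /andP[t0 t1]; have -> : t = 0 by apply/le_anti; rewrite t0 t1.
  exact: Fxi.
move=> t0 _; have [e e0 he] := strip_lift t0 cH BH; exists e => // u v u0 uv v1 hu hv [X [cX FX X0]].
have cXu : continuous (fun r => X (cl r, u)) by have := @ct_cl R => ?; cont.
have [|Z [cZ FZ Z0]] := he u v uv hu hv _ cXu.
  by move=> r r01; rewrite clE //; apply: FX => //; rewrite u0 lexx.
exists (fun p => if p.2 - u <= 0 then X (cl p.1, p.2) else Z (cl p.1, p.2)); split.
- apply: continuous_glue; have := @ct_cl R => ?; [by cont|by cont|by cont|].
  move=> p E; have -> : p.2 = u by lra.
  by rewrite Z0 ?cl01 // (clE (cl01 p.1)).
- move=> r t r01 /andP[t0' tv] /=; rewrite clE //; case: ifP => h.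
    by apply: FX => //; rewrite t0' /=; lra.
  by apply: FZ => //; rewrite tv andbT; move/negbT: h; rewrite -ltNge; lra.
- by move=> r r01 /=; rewrite sub0r oppr_le0 u0 clE // X0.
Qed.
End Fibration.

Section Exactness.
Variables (R : realType) (Y T : topologicalType) (B : set Y) (Fib : Y -> set T).
Hypothesis loc : @local_transport R Y T B Fib.
Notation E := (total B Fib).

Lemma fst_total z : E z -> B z.1. Proof. by case. Qed.
Lemma tcont_fst : @tcont R (Y * T)%type Y E fst. Proof. by apply: tcont_continuous; cont. Qed.
Lemma incl_total y : B y -> forall x, Fib y x -> E (y, x). Proof. by move=> By x Fx; split. Qed.
Lemma tcont_incl y : @tcont R T (Y * T)%type (Fib y) (fun x => (y, x)).
Proof. by apply: tcont_continuous; cont. Qed.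

Definition proj_cl z z' (a : P R E z z') : P R B z.1 z'.1 := pmap tcont_fst fst_total a.
Definition incl_cl y (By : B y) x x' (a : P R (Fib y) x x') : P R E (y, x) (y, x') :=
  pmap (@tcont_incl y) (@incl_total y By) a.

(** A path is a homotopy of constant paths, so homotopy lifting applies with a constant initial
    lift. *)
Lemma lift_path (c : R -> Y) x : continuous c -> (forall s, B (c s)) -> Fib (c 0) x ->
  exists d : R -> Y * T, pth E (c 0, x) (c 1, (d 1).2) d /\ forall s, (d s).1 = c (cl s).
Proof.
move=> cc Bc Fx; have ccl := @ct_cl R.
have cH : continuous (fun p : R * R => c p.2) by cont.
have cx : continuous (fun _ : R => x) by cont.
have [X [cX FX X0]] := homotopy_lift loc cH (fun p => Bc p.2) cx (fun _ _ => Fx).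
exists (fun s => (c (cl s), X (0, cl s))); split => //; split; rewrite ?cl0 ?cl1 //.
- by cont.
- by move=> s; split; [exact: Bc|apply: FX; rewrite ?lexx ?ler01 // cl01].
- by rewrite X0 // lexx ler01.
Qed.

Lemma total_pconn : @pconn R Y B -> (forall y, B y -> @pconn R T (Fib y)) -> @pconn R _ E.
Proof.
move=> cB cF [y x] [y' x'] [/= By Fx] [/= By' Fx'].
have [c [cc Bc c0 c1]] := cB _ _ By By'.
have [|d [hd dE]] := @lift_path c x cc Bc; first by rewrite c0.
rewrite c0 c1 in hd; have [_ Ed _ d1] := hd.
have [k hk] : exists k, @pth R _ (Fib y') (d 1).2 x' k.
  by apply: cF => //; have [_] := Ed 1; rewrite {1}d1.
have hk' := pth_map (@tcont_incl y') (@incl_total y' By') hk.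
by exists (concat d (fun s => (y', k s))); apply: pth_concat hd hk'.
Qed.

(** Exactness in the middle: a contraction of the projected loop is lifted to a square whose bottom
    side is the loop. The other three sides lie over the base point, and together they form a loop
    of the fibre. *)
Lemma fib_exact y (By : B y) x (l : P R E (y, x) (y, x)) :
  proj_cl l = pone R By -> exists k : P R (Fib y) x x, l = incl_cl By k.
Proof.
have [c [hc ->]] := pclP l; have ccl := @ct_cl R.
rewrite /proj_cl (pmapE _ _ hc (pth_map tcont_fst fst_total hc)) => /pcl_hty.
move=> [H [cH BH Hc He]]; have [cc Ec c0 c1] := hc.
have cxi : continuous (fun s => (c s).2) by cont.
have H0 (t : R) : H (0, t) = y by have [-> _] := He t; rewrite c0.
have H1 (t : R) : H (1, t) = y by have [_ ->] := He t; rewrite c1.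
have Ht (s : R) : H (s, 1) = y by have [_ ->] := Hc s.
have [|X [cX FX X0]] := homotopy_lift loc cH BH cxi.
  by move=> r r01; have [-> _] := Hc r; rewrite clE //; have [] := Ec r.
pose K (p : R * R) := (H (cl p.1, cl p.2), X (cl p.1, cl p.2)).
have cK : continuous K by rewrite /K; cont.
have EK p : E (K p) by split=> /=; [exact: BH|apply: FX; exact: cl01].
have K0 (t : R) : K (0, t) = (y, X (0, cl t)) by rewrite /K /= cl0 H0.
have K1 (t : R) : K (1, t) = (y, X (1, cl t)) by rewrite /K /= cl1 H1.
have Kt (s : R) : K (s, 1) = (y, X (cl s, 1)) by rewrite /K /= cl1 Ht.
have Kb (s : R) : K (s, 0) = c (cl s).
  by rewrite /K /= cl0 X0 ?cl01 //; have [-> _] := Hc (cl s); rewrite (clE (cl01 s)); case: (c _).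
have FK s t : (K (s, t)).1 = y -> Fib y (X (cl s, cl t)) by move=> e; have [_] := EK (s, t); rewrite /= -[H _]/((K (s, t)).1) e.
have p1 : pth (Fib y) x (X (0, 1)) (fun t => X (0, cl t)).
  split; rewrite ?cl0 ?cl1 //; first by cont.
    by move=> t; have := @FK 0 t; rewrite K0 cl0; apply.
  by rewrite X0 ?lexx ?ler01 // c0.
have p2 : pth (Fib y) (X (0, 1)) (X (1, 1)) (fun s => X (cl s, 1)).
  split; rewrite ?cl0 ?cl1 //; first by cont.
  by move=> s; have := @FK s 1; rewrite Kt cl1; apply.
have p3 : pth (Fib y) x (X (1, 1)) (fun t => X (1, cl t)).
  split; rewrite ?cl0 ?cl1 //; first by cont.
    by move=> t; have := @FK 1 t; rewrite K1 cl1; apply.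
  by rewrite X0 ?lexx ?ler01 // c1.
exists (pmul (pmul (pcl p1) (pcl p2)) (pinv (pcl p3))).
pose im x1 x2 c (h : pth (Fib y) x1 x2 c) := pth_map (@tcont_incl y) (@incl_total y By) h.
rewrite /incl_cl !pmapM pmapV (pmapE _ _ p1 (im _ _ _ p1)) (pmapE _ _ p2 (im _ _ _ p2)) (pmapE _ _ p3 (im _ _ _ p3)).
have q0 : pth E (y, x) (y, x) (fun s => K (s, 0)).
  by split; rewrite ?Kb ?cl0 ?cl1 //; cont.
have -> : pcl hc = pcl q0.
  by apply: pclE; apply: hty_eq => // s s01; rewrite Kb clE.
suff -> : pmul (pcl (im _ _ _ p1)) (pcl (im _ _ _ p2)) = pmul (pcl q0) (pcl (im _ _ _ p3)) by rewrite pmulK.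
rewrite !pmulE; apply: pclE.
(* [u] runs along the left and top sides of the square, [v] along the bottom and right sides. *)
pose u (s : R) : R * R := if s - 2^-1 <= 0 then (0, 2 * s) else (2 * s - 1, 1).
pose v (s : R) : R * R := if s - 2^-1 <= 0 then (2 * s, 0) else (1, 2 * s - 1).
have cu : continuous u.
  apply: continuous_glue; [by cont|by cont|by cont|].
  by move=> s h; congr pair; lra.
have cv : continuous v.
  apply: continuous_glue; [by cont|by cont|by cont|].
  by move=> s h; congr pair; lra.
have := @square_hty R _ E K u v cK EK cu cv.
have -> : (fun s => K (u s)) = concat (fun s => (y, X (0, cl s))) (fun s => (y, X (cl s, 1))).
  by apply/funext => s; rewrite /u /concat subr_le0; case: ifP => _; rewrite ?K0 ?Kt.
have -> : (fun s => K (v s)) = concat (fun s => K (s, 0)) (fun s => (y, X (1, cl s))).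
  by apply/funext => s; rewrite /v /concat subr_le0; case: ifP => _; rewrite ?K1.
apply.
- by rewrite /u /v !ifT ?mulr0 //; lra.
- by rewrite /u /v !ifF; [congr pair; lra|..]; apply/negbTE; rewrite -ltNge; lra.
Qed.

(** The lift of a loop ends somewhere in the fibre over the base point, and connectedness of the
    fibre closes it up there. *)
Lemma fib_surj y (By : B y) x (Fx : Fib y x) (b : P R B y y) : @pconn R T (Fib y) ->
  exists l : P R E (y, x) (y, x), proj_cl l = b.
Proof.
move=> cF; have [c [hc ->]] := pclP b; have [cc Bc c0 c1] := hc.
have [|d [hd dE]] := @lift_path c x cc Bc; first by rewrite c0.
rewrite c0 c1 in hd; have [cd Ed _ d1] := hd.
have [k hk] : exists k, @pth R _ (Fib y) (d 1).2 x k.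
  by apply: cF => //; have [_] := Ed 1; rewrite {1}d1.
exists (pmul (pcl hd) (incl_cl By (pcl hk))).
rewrite /proj_cl pmapM (pmapE _ _ hd (pth_map tcont_fst fst_total hd)).
rewrite /incl_cl (pmapE _ _ hk (pth_map (@tcont_incl y) (@incl_total y By) hk)).
rewrite (pmapE _ _ _ (pth_map tcont_fst fst_total (pth_map (@tcont_incl y) (@incl_total y By) hk))).
have -> : pcl (pth_map tcont_fst fst_total (pth_map (@tcont_incl y) (@incl_total y By) hk)) = pone R By.
  by apply: pclE; case: (pth_cst R By) => ? ? _ _; exact: hty_refl.
rewrite pmulp1; apply: pclE; apply: hty_eq; first by cont.
  by move=> s; have [] := Ed s.
by move=> s s01; rewrite dE clE.
Qed.

Lemma proj_clM z z' z'' (a : P R E z z') (b : P R E z' z'') :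
  proj_cl (pmul a b) = pmul (proj_cl a) (proj_cl b).
Proof. exact: pmapM. Qed.
Lemma proj_clV z z' (a : P R E z z') : proj_cl (pinv a) = pinv (proj_cl a).
Proof. exact: pmapV. Qed.

Lemma incl_gen y (By : B y) x (Fx : Fib y x) (hz : E (y, x)) F k :
  loop_gen (R := R) Fx F k -> loop_gen (R := R) hz (@incl_cl y By x x @` F) (incl_cl By k).
Proof.
elim=> [|b Fb|b b' _ h _ h'|b _ h].
- by rewrite /incl_cl (pmap1 _ _ _ hz); exact: gen1.
- by apply: gen_in; exists b.
- by rewrite /incl_cl pmapM; exact: genM.
- by rewrite /incl_cl pmapV; exact: genV.
Qed.

Lemma gen_mono (G : Type) mul inv (one : G) F F' x : F `<=` F' -> gen mul inv one F x -> gen mul inv one F' x.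
Proof.
move=> s; elim=> [|y /s|y z _ h _ h'|y _ h]; [exact: gen1|exact: gen_in|exact: genM|exact: genV].
Qed.

Lemma fib_fg y (By : B y) x (Fx : Fib y x) (hz : E (y, x)) : @pconn R T (Fib y) ->
  loop_fg R By -> loop_fg R Fx -> loop_fg R hz.
Proof.
move=> cF [FB [finB gB]] [FF [finF gF]].
pose s (b : P R B y y) := projT1 (cid (fib_surj By Fx b cF)).
have sE b : proj_cl (s b) = b := projT2 (cid (fib_surj By Fx b cF)).
exists (@incl_cl y By x x @` FF `|` s @` FB); split.
  by rewrite finite_setU; split; exact: finite_image.
move=> l.
have [l' gl' E'] : exists2 l', loop_gen hz (@incl_cl y By x x @` FF `|` s @` FB) l' & proj_cl l' = proj_cl l.
  elim: (gB (proj_cl l)) => [|b Fb|b b' _ [a ga <-] _ [a' ga' <-]|b _ [a ga <-]].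
  - by exists (pone R hz); [exact: gen1|rewrite /proj_cl (pmap1 _ _ hz By)].
  - by exists (s b); [apply: gen_in; right; exists b|rewrite sE].
  - by exists (pmul a a'); [exact: genM|rewrite proj_clM].
  - by exists (pinv a); [exact: genV|rewrite proj_clV].
have [|k kE] := @fib_exact y By x (pmul l (pinv l')).
  by rewrite proj_clM proj_clV E' (pmulpV By).
rewrite -[l](pmulKp _ l') kE; apply: genM => //.
apply: gen_mono (incl_gen By hz (gF k)); exact: subsetUl.
Qed.

Lemma fib_cyc y (By : B y) x (Fx : Fib y x) (hz : E (y, x)) :
  (forall b : P R B y y, b = pone R By) -> cyc R Fx -> cyc R hz.
Proof.
move=> tB [g hg]; exists (incl_cl By g) => l.
have [|k ->] := @fib_exact y By x l; first exact: tB.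
by have := incl_gen By hz (hg k); rewrite image_set1.
Qed.

Lemma fib_trivial y (By : B y) x (Fx : Fib y x) (hz : E (y, x)) :
  (forall b : P R B y y, b = pone R By) -> (forall k : P R (Fib y) x x, k = pone R Fx) ->
  forall l : P R E (y, x) (y, x), l = pone R hz.
Proof.
move=> tB tF l; have [|k ->] := @fib_exact y By x l; first exact: tB.
by rewrite (tF k) /incl_cl (pmap1 _ _ _ hz).
Qed.
End Exactness.

(** * Surfaces and configuration spaces *)

Section NormedRules.
Variables (R : realType) (V : normedModType R) (Z : topologicalType).
Lemma ctDv (f g : Z -> V) : continuous f -> continuous g -> continuous (fun z => f z + g z).
Proof. by move=> cf cg z; apply: cvgD; [exact: cf|exact: cg]. Qed.
Lemma ctZv (k : Z -> R) (f : Z -> V) : continuous k -> continuous f -> continuous (fun z => k z *: f z).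
Proof. by move=> ck cf z; apply: cvgZ; [exact: ck|exact: cf]. Qed.
Lemma ctnormv (f : Z -> V) : continuous f -> continuous (fun z => `|f z|).
Proof. by move=> cf z; apply: cvg_norm; exact: cf. Qed.
Lemma nbhs_normlt (v : V) (r : R) : `|v| < r -> nbhs v [set w | `|w| < r].
Proof. by move=> h; exact: (@norm_continuous _ _ v _ (lt_nbhsl h)). Qed.
End NormedRules.

Lemma near_continuous (Z Y : topologicalType) (F G : Z -> Y) (z : Z) :
  (\forall x \near z, F x = G x) -> {for z, continuous G} -> {for z, continuous F}.
Proof.
move=> n cG; have e := nbhs_singleton n; move=> U; rewrite e => h.
have {}h : nbhs z (G @^-1` U) := cG _ h.
change (nbhs z [set x | U (F x)]).
by apply: filterS2 n h => x /= ->.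
Qed.

(** * Surfaces given by charts, and pushing a point inside a chart *)

Section Charts.
Variables (R : realType) (T : topologicalType).
Hypothesis hT : hausdorff_space T.
Notation plane := (R * R)%type.

(** The parametrisation [e] is defined on the whole plane and fills the part of [M] in [O], while
    the coordinate map [f] is controlled only on [O]. Centring at [q] makes the origin the one
    distinguished point. *)
Definition chart (M : set T) (q : T) (e : plane -> T) (f : T -> plane) (O : set T) :=
  [/\ continuous e, (forall u, M (e u) /\ O (e u)), (forall u, f (e u) = u),
      open O /\ (forall x, O x -> M x -> e (f x) = x) & (forall x, O x -> {for x, continuous f}) /\ e 0 = q].

Definition surface (M : set T) := forall q, M q -> exists e f O, chart M q e f O.

(** A parametrisation of a disc of radius r suffices: u |-> r u / (1 + |u|) stretches the disc to
    the whole plane, with inverse w |-> w / (r - |w|). *)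
Lemma local_chart (M : set T) (c : plane) (r : R) (e : plane -> T) (f : T -> plane) (O : set T) : 0 < r ->
  (forall w, `|w - c| < r -> [/\ {for w, continuous e}, M (e w), O (e w) & f (e w) = w]) ->
  open O -> (forall x, O x -> M x -> e (f x) = x) -> (forall x, O x -> {for x, continuous f}) ->
  exists e' f' O', chart M (e c) e' f' O' /\ O' `<=` O.
Proof.
move=> r0 he oO ef cf.
pose sc (u : plane) : plane := (r / (1 + `|u|)) *: u.
pose iv (w : plane) : plane := (r - `|w|)^-1 *: w.
have p1 (u : plane) : 0 < 1 + `|u| by rewrite ltr_pwDl.
have nsc u : `|sc u| = r * `|u| / (1 + `|u|).
  by rewrite normrZ ger0_norm ?divr_ge0 ?ltW // mulrAC.
have sclt u : `|sc u| < r.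
  by rewrite nsc ltr_pdivrMr // mulrDr mulr1 ltrDr.
have ivsc u : iv (sc u) = u.
  rewrite /iv nsc /sc scalerA -[RHS]scale1r; congr (_ *: _).
  by have := p1 u; set n := `|u| => pn; field; rewrite !gt_eqF //; lra.
have sciv w : `|w| < r -> sc (iv w) = w.
  move=> wr; have h : 0 < r - `|w| by rewrite subr_gt0.
  rewrite /sc scalerA -[RHS]scale1r; congr (_ *: _).
  rewrite normrZ ger0_norm ?invr_ge0 ?ltW //; move: h; set n := `|w| => pn.
  by field; rewrite !gt_eqF //; lra.
have csc : continuous sc.
  apply: ctZv; last exact: ct_id.
  apply: ctM; first exact: ct_cst.
  apply: ct_inv; last by move=> u; rewrite gt_eqF.
  by apply: ctD; [exact: ct_cst|apply: ctnormv; exact: ct_id].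
have hsc u : `|c + sc u - c| < r by rewrite addrAC subrr add0r.
exists (fun u => e (c + sc u)), (fun x => iv (f x - c)), (O `&` [set x | `|f x - c| < r]); split; last first.
  by move=> x [].
split.
- move=> u; have [ce _ _ _] := he _ (hsc u).
  apply: (@continuous_comp _ _ _ (fun u => c + sc u)) ce.
  by apply: cvgD; [exact: cvg_cst|exact: csc].
- move=> u; have [ce Mu Ou fe] := he _ (hsc u); split=> //; split=> //=.
  by rewrite fe.
- by move=> u; have [_ _ _ ->] := he _ (hsc u); rewrite addrAC subrr add0r.
- split; last by move=> x [Ox fx] Mx /=; rewrite sciv // addrC subrK ef.
  rewrite openE => x [Ox fx]; apply: filterI; first exact: open_nbhs_nbhs.
  have cx : {for x, continuous (fun x => f x - c)} by apply: cvgB; [exact: cf|exact: cvg_cst].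
  exact: (cx _ (nbhs_normlt fx)).
- split; last by rewrite /sc scaler0 addr0.
  move=> x [Ox fx].
  have cx : {for x, continuous (fun x => f x - c)} by apply: cvgB; [exact: cf|exact: cvg_cst].
  have civ : {for f x - c, continuous iv}.
    apply: cvgZ; last exact: cvg_id.
    apply: cvgV; first by rewrite gt_eqF // subr_gt0.
    by apply: cvgB; [exact: cvg_cst|exact: norm_continuous].
  exact: (continuous_comp cx civ).
Qed.

Lemma chart_shrink M q e f O U : chart M q e f O -> open U -> U q ->
  exists e' f' O', chart M q e' f' O' /\ O' `<=` U.
Proof.
move=> [ce Me fe [oO ef] [cf e0]] oU Uq.
have : nbhs (0 : plane) (e @^-1` U) by apply: ce; rewrite e0; exact: open_nbhs_nbhs.
move=> /nbhs_ballP[r /= r0 hr].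
have hr' w : `|w - 0| < r -> [/\ {for w, continuous e}, M (e w), (U `&` O) (e w) & f (e w) = w].
  move=> h; have [Mw Ow] := Me w; split=> //; first exact: ce.
  by split=> //; apply: hr; rewrite -ball_normE /= sub0r normrN -[w]subr0.
have ef' x : (U `&` O) x -> M x -> e (f x) = x by move=> [_]; exact: ef.
have cf' x : (U `&` O) x -> {for x, continuous f} by move=> [_]; exact: cf.
have [e' [f' [O' [ch O'U]]]] := local_chart r0 hr' (openI oU oO) ef' cf'.
by rewrite e0 in ch; exists e', f', O'; split=> // x /O'U [].
Qed.

Lemma open_surface M U : surface M -> open U -> surface (M `&` U).
Proof.
move=> sM oU q [Mq Uq]; have [e [f [O cO]]] := sM q Mq.
have [e' [f' [O' [[ce Me fe [oO ef] [cf e0]] O'U]]]] := chart_shrink cO oU Uq.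
exists e', f', O'; split=> //; last by split=> // x Ox [Mx _]; exact: ef.
by move=> u; have [Mu Ou] := Me u; split=> //; split=> //; exact: O'U.
Qed.

Lemma finite_closed (F : set T) : finite_set F -> closed F.
Proof. exact: (accessible_finite_set_closed.1 (hausdorff_accessible hT)). Qed.

Lemma surface_minus M F : surface M -> finite_set F -> surface (M `\` F).
Proof. by move=> sM /finite_closed/closed_openC oF; exact: open_surface. Qed.

Lemma compact_disc : compact [set u : plane | `|u| <= 1].
Proof.
have -> : [set u : plane | `|u| <= 1] = `[-1, 1]%classic `*` `[-1, 1]%classic.
  apply/seteqP; split=> [[a b]|[a b]]; rewrite /= !in_itv /= prod_normE /= ge_max !ler_norml.
    by case/andP.
  by case=> -> ->.
apply: compact_setX; exact: segment_compact.
Qed.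

Lemma chart_disc_closed M q e f O : chart M q e f O -> closed (e @` [set u : plane | `|u| <= 1]).
Proof.
move=> [ce _ _ _ _]; apply: compact_closed => //; apply: continuous_compact; last exact: compact_disc.
exact: continuous_subspaceT.
Qed.

(** The translation taking [p1] to [p2] in the chart, damped by a cutoff of slope 2 around [p1].
    With both points within 1/8 of the centre, the displacement is below 1/4 and everything happens
    inside the unit disc. *)
Definition moveto (e : plane -> T) (f : T -> plane) (O : set T) (p1 p2 x : T) : T :=
  if pselect (O x) then e (f x + Num.max 0 (1 - 2 * `|f x - f p1|) *: (f p2 - f p1)) else x.

Section Move.
Variables (M : set T) (q : T) (e : plane -> T) (f : T -> plane) (O : set T).
Hypothesis ch : chart M q e f O.
Let D := e @` [set u : plane | `|u| <= 1].
Definition nearc (p : T) := O p /\ `|f p| < 8^-1.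

Lemma nearc_nbhs : nbhs q nearc.
Proof.
have [ce Me fe [oO ef] [cf e0]] := ch.
have Oq : O q by rewrite -e0; have [] := Me 0.
apply: filterI; first exact: open_nbhs_nbhs.
have : nbhs (f q) [set w : plane | `|w| < 8^-1].
  by apply: nbhs_normlt; rewrite -e0 fe normr0 invr_gt0.
by move/(cf q Oq).
Qed.

Lemma nearc_disc p : M p -> nearc p -> D p.
Proof.
have [ce Me fe [oO ef] [cf e0]] := ch.
by move=> Mp [Op fp]; exists (f p); [rewrite /= ; lra|exact: ef].
Qed.

Lemma moveto_M p1 p2 x : M x -> M (moveto e f O p1 p2 x).
Proof.
have [ce Me fe [oO ef] [cf e0]] := ch.
by move=> Mx; rewrite /moveto; case: pselect => [?|?] //; apply: (Me _).1.
Qed.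

Lemma moveto_out p1 p2 x : nearc p1 -> M x -> ~ D x -> moveto e f O p1 p2 x = x.
Proof.
have [ce Me fe [oO ef] [cf e0]] := ch.
move=> [O1 f1] Mx nD; rewrite /moveto; case: pselect => // Ox.
have fx : 1 < `|f x| by rewrite ltNge; apply/negP => h; apply: nD; exists (f x) => //; exact: ef.
have h : `|f x| <= `|f x - f p1| + `|f p1| by rewrite -{1}(subrK (f p1) (f x)); exact: ler_normD.
have -> : Num.max 0 (1 - 2 * `|f x - f p1|) = 0 by apply/max_idPl; lra.
by rewrite scale0r addr0 ef.
Qed.

Lemma moveto_in p1 p2 x : nearc p1 -> nearc p2 -> M x -> D x -> D (moveto e f O p1 p2 x).
Proof.
have [ce Me fe [oO ef] [cf e0]] := ch.
move=> [O1 f1] [O2 f2] Mx [u u1 ux]; rewrite /moveto; case: pselect => Ox; last by exists u.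
exists (f x + Num.max 0 (1 - 2 * `|f x - f p1|) *: (f p2 - f p1)) => //=.
have fxu : f x = u by rewrite -ux fe.
case: (leP (1 - 2 * `|f x - f p1|) 0) => h; first by rewrite scale0r addr0 fxu.
have h1 : `|f x| <= `|f x - f p1| + `|f p1| by rewrite -{1}(subrK (f p1) (f x)); exact: ler_normD.
have h2 := ler_normB (f p2) (f p1).
have h3 := ler_normD (f x) ((1 - 2 * `|f x - f p1|) *: (f p2 - f p1)).
have h4 : `|(1 - 2 * `|f x - f p1|) *: (f p2 - f p1)| <= `|f p2 - f p1|.
  by rewrite normrZ gtr0_norm // ler_piMl //; have := normr_ge0 (f x - f p1); lra.
lra.
Qed.

(** Displacement below 1/4 times slope 2 gives a factor below 1/2: a point landing on [p2] would
    have a distance to [p1] smaller than half of itself. Where the cutoff vanishes, the point is too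
    far away to equal [p2]. *)
Lemma moveto_avoid p1 p2 x : nearc p1 -> nearc p2 -> M p1 -> M p2 -> M x -> x <> p1 ->
  moveto e f O p1 p2 x <> p2.
Proof.
have [ce Me fe [oO ef] [cf e0]] := ch.
move=> [O1 f1] [O2 f2] M1 M2 Mx xp; rewrite /moveto; case: pselect => Ox; last first.
  by move=> /= xp2; apply: Ox; rewrite xp2.
move=> /(congr1 f); rewrite fe => E.
have hb : `|f p2 - f p1| < 4^-1 by have := ler_normB (f p2) (f p1); lra.
set b := Num.max _ _ in E.
have w : f x - f p1 = (1 - b) *: (f p2 - f p1).
  by rewrite scalerBl scale1r (canRL (addrK _) E) addrAC.
have := congr1 (fun v : plane => `|v|) w; rewrite normrZ.
rewrite {}/b in E w *; case: (leP (1 - 2 * `|f x - f p1|) 0) => h.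
  by rewrite subr0 normr1 mul1r; lra.
have -> : 1 - (1 - 2 * `|f x - f p1|) = 2 * `|f x - f p1| by ring.
rewrite ger0_norm ?mulr_ge0 // => w2.
have n0 := normr_ge0 (f x - f p1).
have : `|f x - f p1| = 0 by nra.
by move/eqP; rewrite normr_eq0 subr_eq0 => /eqP fxp; apply: xp; rewrite -(ef x) // fxp ef.
Qed.

Lemma moveto_id p x : M x -> moveto e f O p p x = x.
Proof.
have [ce Me fe [oO ef] [cf e0]] := ch.
by move=> Mx; rewrite /moveto; case: pselect => // Ox; rewrite subrr scaler0 addr0 ef.
Qed.

Lemma moveto_continuous (p1 p2 x : R * R -> T) : continuous p1 -> continuous p2 -> continuous x ->
  (forall z, nearc (p1 z)) -> (forall z, nearc (p2 z)) -> (forall z, M (x z)) ->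
  continuous (fun z => moveto e f O (p1 z) (p2 z) (x z)).
Proof.
have [ce Me fe [oO ef] [cf e0]] := ch.
move=> c1 c2 cx n1 n2 Mx z.
have [Ox|nO] := pselect (O (x z)).
  have n : \forall y \near z, moveto e f O (p1 y) (p2 y) (x y) = 
      e (f (x y) + Num.max 0 (1 - 2 * `|f (x y) - f (p1 y)|) *: (f (p2 y) - f (p1 y))).
    have : nbhs z (x @^-1` O) by apply: cx; exact: open_nbhs_nbhs.
    by apply: filterS => y /= Oy; rewrite /moveto; case: pselect.
  apply: near_continuous n _.
  have k1 : {for z, continuous (fun z => f (p1 z))} by apply: continuous_comp; [exact: c1|exact: cf (n1 z).1].
  have k2 : {for z, continuous (fun z => f (p2 z))} by apply: continuous_comp; [exact: c2|exact: cf (n2 z).1].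
  have kx : {for z, continuous (fun z => f (x z))} by apply: continuous_comp; [exact: cx|exact: cf].
  apply: (@continuous_comp _ _ _ (fun y => f (x y) + Num.max 0 (1 - 2 * `|f (x y) - f (p1 y)|) *: (f (p2 y) - f (p1 y))) e); last exact: ce.
  apply: cvgD; first exact: kx.
  apply: cvgZ; last by apply: cvgB; [exact: k2|exact: k1].
  pose g (r : R) : R := Num.max 0 (1 - 2 * r).
  have cg : continuous g by rewrite /g; cont.
  apply: (@continuous_comp _ _ _ (fun y => `|f (x y) - f (p1 y)|) g); last exact: cg.
  apply: cvg_norm; apply: cvgB; [exact: kx|exact: k1].
have nD : ~ D (x z) by move=> [u _ ux]; apply: nO; rewrite -ux; have [] := Me u.
have : nbhs z (x @^-1` (~` D)).
  apply: cx; apply: open_nbhs_nbhs; split => //; apply: closed_openC; exact: chart_disc_closed ch.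
move=> nn; apply: (@near_continuous _ _ _ x); last exact: cx.
by apply: filterS nn => y /= nDy; exact: moveto_out.
Qed.
End Move.
End Charts.

(** * Transport between nearby configurations *)

Section Configurations.
Variables (R : realType) (T : topologicalType).
Hypothesis hT : hausdorff_space T.

(* Nested pairs instead of functions ['I_n -> T]: [confT n.+1] projects to
   [confT n] by forgetting the last point; [bool] is only a one-point base. *)
Fixpoint confT (n : nat) : topologicalType :=
  if n is n'.+1 then (confT n' * T)%type else bool.

Fixpoint pts (n : nat) : confT n -> set T :=
  match n return confT n -> set T with
  | 0 => fun _ => set0
  | n'.+1 => fun z => pts z.1 `|` [set z.2]
  end.

Fixpoint conf (X : set T) (n : nat) : set (confT n) :=
  match n return set (confT n) with
  | 0 => [set true]
  | n'.+1 => total (@conf X n') (fun y => X `\` pts y)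
  end.
Arguments conf X n : clear implicits.

Lemma finite_pts n (y : confT n) : finite_set (pts y).
Proof.
elim: n y => [|n IH] y /=; first exact: finite_set0.
by rewrite finite_setU; split; [exact: IH|exact: finite_set1].
Qed.

Variable X : set T.
Hypothesis sX : @surface R T X.

(** The induction carries a region [S] inside a prescribed open set outside of which nothing moves;
    disjointness of these regions for different points lets the individual pushes be composed
    without interference. *)
Lemma conf_transport n (y : confT n) (O : set T) : conf X n y -> open O -> pts y `<=` O ->
  exists (N : set (confT n)) (tau : confT n -> confT n -> T -> T) (S : set T),
  [/\ nbhs y N, S `<=` O, (forall y1, N y1 -> conf X n y1 -> pts y1 `<=` S),
    (forall y1 y2 x, N y1 -> conf X n y1 -> N y2 -> conf X n y2 -> X x ->
      [/\ X (tau y1 y2 x), (~ pts y1 x -> ~ pts y2 (tau y1 y2 x)),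
          (~ S x -> tau y1 y2 x = x), (S x -> S (tau y1 y2 x)) & tau y1 y1 x = x]) &
   (forall (a b : R * R -> confT n) (c : R * R -> T), continuous a -> continuous b -> continuous c ->
     (forall z, N (a z)) -> (forall z, conf X n (a z)) -> (forall z, N (b z)) ->
     (forall z, conf X n (b z)) ->
     (forall z, X (c z)) -> continuous (fun z => tau (a z) (b z) (c z)))].
Proof.
elim: n y O => [|n IH] y O.
  move=> _ _ _; exists setT, (fun _ _ x => x), set0; split=> //; by move=> y1 _ _ x.
case: y => y p [/= Fy [Xp yp]] oO yO.
have oU : open (O `&` ~` pts y).
  by apply: openI => //; apply: closed_openC; apply: finite_closed => //; exact: finite_pts.
have Up : (O `&` ~` pts y) p by split=> //; apply: yO; right.
have [e0 [f0 [O0 ch0]]] := sX Xp.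
(* The chart of the last point avoids the other points, and its closed disc is then removed from the
   room left to them. *)
have [e [f [Op [ch OpU]]]] := chart_shrink ch0 oU Up.
set D := e @` [set u : R * R | `|u| <= 1].
have DO : D `<=` Op by have [_ Me _ _ _] := ch; move=> _ [u _ <-]; have [] := Me u.
have cD : closed D := chart_disc_closed hT ch.
have oO' : open (O `&` ~` D) by apply: openI => //; exact: closed_openC.
have yO' : pts y `<=` O `&` ~` D.
  move=> x yx; split; first by apply: yO; left.
  by move=> /DO /OpU [_]; apply.
have [N' [t' [S' [nN' SO' NS' hA hC]]]] := IH y _ Fy oO' yO'.
have SD x : S' x -> D x -> False by move=> /SO' [].
pose N : set (confT n.+1) := [set z | N' z.1 /\ nearc f Op z.2].
pose t (z1 z2 : confT n.+1) x := t' z1.1 z2.1 (moveto e f Op z1.2 z2.2 x).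
have avoid y1 p1 p2 x : N' y1 -> conf X n y1 -> nearc f Op p1 -> nearc f Op p2 -> X x -> ~ pts y1 x ->
    ~ pts y1 (moveto e f Op p1 p2 x).
  move=> N1 F1 n1 n2 Xx nx; have [Dx|nD] := pselect (D x).
    by move=> /(NS' _ N1 F1) s; apply: (SD _ s); exact: (moveto_in ch).
  by rewrite (moveto_out ch).
exists N, t, (S' `|` D); split.
- have nc := nearc_nbhs ch; exists (N', nearc f Op) => //=.
- move=> x [/SO' []//|/DO/OpU []//].
- move=> [y1 p1] /= [N1 n1] [F1 [X1 _]] x [/(NS' _ N1 F1)|->]; first by left.
  by right; exact: (nearc_disc ch).
- move=> [y1 p1] [y2 p2] x [/= N1 n1] [/= F1 [X1 yp1]] [/= N2 n2] [/= F2 [X2 yp2]] Xx.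
  have Xm := moveto_M ch p1 p2 Xx.
  have [h1 h2 h3 h4 _] := hA y1 y2 _ N1 F1 N2 F2 Xm.
  rewrite /t /=; split=> //.
  + move=> nx [h|E].
      apply: (h2 _ h); apply: avoid => // hx; apply: nx; by left.
    have m2 : moveto e f Op p1 p2 x <> p2.
      by apply: (moveto_avoid ch) => // xp1; apply: nx; right.
    have {}E : t' y1 y2 (moveto e f Op p1 p2 x) = p2 := E.
    have D2 : D p2 by exact: (nearc_disc ch).
    have [s|ns] := pselect (S' (moveto e f Op p1 p2 x)).
      by apply: (SD p2) D2; have := h4 s; rewrite E.
    by apply: m2; exact: etrans (esym (h3 ns)) E.
  + move=> ns.
    have nD : ~ D x by move=> d; apply: ns; right.
    have mx : moveto e f Op p1 p2 x = x by exact: (moveto_out ch).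
    by rewrite mx in h3 *; apply: h3 => s; apply: ns; left.
  + move=> [s|d].
      have nD : ~ D x by exact: SD.
      have mx : moveto e f Op p1 p2 x = x by exact: (moveto_out ch).
      by rewrite mx in h4 *; left; exact: h4.
    have dm : D (moveto e f Op p1 p2 x) by exact: (moveto_in ch).
    by right; rewrite h3 // => s; exact: (SD _ s).
  + by rewrite (moveto_id ch) //; have [_ _ _ _ ->] := hA y1 y1 x N1 F1 N1 F1 Xx.
- move=> a b c ca cb cc Na Fa Nb Fb Xc; rewrite /t.
  apply: hC => //.
  + by cont.
  + by cont.
  + apply: (moveto_continuous hT ch) => //; try by cont.
      by move=> z; have [] := Na z.
    by move=> z; have [] := Nb z.
  + by move=> z; have [] := Na z.
  + by move=> z; have [] := Fa z.
  + by move=> z; have [] := Nb z.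
  + by move=> z; have [] := Fb z.
  + by move=> z; exact: (moveto_M ch).
Qed.

Lemma conf_local_transport n : @local_transport R (confT n) T (conf X n) (fun y => X `\` pts y).
Proof.
move=> y Fy; have [N [t [S [nN _ _ hA hC]]]] := conf_transport Fy openT (@subsetT _ _).
exists N, t; split=> //.
- move=> y1 y2 x N1 F1 N2 F2 [Xx nx]; have [h1 h2 _ _ _] := hA _ _ x N1 F1 N2 F2 Xx.
  by split=> //; exact: h2.
- by move=> y1 x N1 F1 [Xx _]; have [] := hA _ _ x N1 F1 N1 F1 Xx.
- move=> a b c ca cb cc Na Fa Nb Fb Fc; apply: hC => // z; by have [] := Fc z.
Qed.
End Configurations.

(** * Convex sets and the cyclic fundamental group of the punctured plane *)

Section ConvexPlane.
Variable R : realType.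
Notation plane := (R * R)%type.
Implicit Types (C : set plane) (a b u : plane).

Definition convexp C := forall a b (t : R), C a -> C b -> 0 <= t <= 1 -> C ((1 - t) *: a + t *: b).
Definition line a b : R -> plane := fun s => (1 - cl s) *: a + cl s *: b.

Lemma pth_line C a b : convexp C -> C a -> C b -> pth C a b (line a b).
Proof.
move=> cC Ca Cb; have ccl := @ct_cl R; split.
- apply: ctDv; apply: ctZv; try exact: ct_cst; by cont.
- by move=> s; apply: cC => //; exact: cl01.
- by rewrite /line cl0 subr0 scale1r scale0r addr0.
- by rewrite /line cl1 subrr scale1r scale0r add0r.
Qed.

Lemma hty_convex C x y (c d : R -> plane) : convexp C -> pth C x y c -> pth C x y d -> hty C c d.
Proof.
move=> cC [cc Cc c0 c1] [cd Cd d0 d1].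
apply: (@hty_intro _ _ _ _ _ (fun p => (1 - p.2) *: c p.1 + p.2 *: d p.1)).
- apply: ctDv; apply: ctZv; by cont.
- by move=> s t _ t01; apply: cC.
- by move=> s _ /=; rewrite subr0 subrr !scale0r !scale1r addr0 add0r.
- by move=> t _ /=; rewrite c0 d0 c1 d1 -!scalerDl subrK !scale1r.
Qed.

Lemma convexT : convexp setT. Proof. by []. Qed.

Lemma convex_ball (r : R) : convexp [set u : plane | `|u| < r].
Proof.
move=> a b t /= ha hb /andP[t0 t1]; apply: le_lt_trans (ler_normD _ _) _.
rewrite !normrZ (ger0_norm t0) ger0_norm ?subr_ge0 //.
have [->|tn] := eqVneq t 0; first by rewrite subr0 mul1r mul0r addr0.
have tp : 0 < t by rewrite lt_def tn.
have := ler_wpM2l (ltac:(by rewrite subr_ge0) : 0 <= 1 - t) (ltW ha).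
have : t * `|b| < t * r by rewrite ltr_pM2l.
lra.
Qed.

Definition punctured : set plane := [set u | u <> 0].

(* The segment from [a] to [b] avoids the origin unless [b] is a nonpositive
   multiple of [a]; then one detours through [a] rotated by a right angle. *)
Lemma punctured_ball_pconn (r : R) a b : `|a| < r -> `|b| < r -> a <> 0 -> b <> 0 ->
  exists c : R -> plane, pth ([set u | `|u| < r] `&` punctured) a b c.
Proof.
have direct a' b' : `|a'| < r -> `|b'| < r -> (forall t : R, 0 <= t <= 1 -> (1 - t) *: a' + t *: b' <> 0) ->
    exists c : R -> plane, pth ([set u | `|u| < r] `&` punctured) a' b' c.
  move=> ha hb h; exists (line a' b'); have [cl_ Cl l0 l1] := pth_line (@convex_ball r) ha hb.
  by split=> // s; split; [exact: Cl|apply: h; exact: cl01].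
have det (x y : plane) t : (1 - t) *: x + t *: y = 0 -> (1 - t) * (x.1 * y.2 - x.2 * y.1) = 0 /\ t * (x.1 * y.2 - x.2 * y.1) = 0.
  move=> e; have e1 := congr1 fst e; have e2 := congr1 snd e.
  change ((1 - t) * x.1 + t * y.1 = 0) in e1; change ((1 - t) * x.2 + t * y.2 = 0) in e2.
  split.
    have -> : (1 - t) * (x.1 * y.2 - x.2 * y.1) = ((1 - t) * x.1 + t * y.1) * y.2 - ((1 - t) * x.2 + t * y.2) * y.1 by ring.
    by rewrite e1 e2; ring.
  have -> : t * (x.1 * y.2 - x.2 * y.1) = ((1 - t) * x.2 + t * y.2) * x.1 * (1) - ((1 - t) * x.1 + t * y.1) * x.2 by ring.
  by rewrite e1 e2; ring.
move=> ha hb a0 b0.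
have nz (x y : plane) : x.1 * y.2 - x.2 * y.1 <> 0 -> forall t : R, 0 <= t <= 1 -> (1 - t) *: x + t *: y <> 0.
  move=> dn t _ /det[/eqP]; rewrite mulf_eq0 => /orP[/eqP t1|/eqP //] /eqP.
  rewrite mulf_eq0 => /orP[/eqP t0|/eqP //]; move: t1; rewrite t0 subr0 => /eqP; by rewrite oner_eq0.
have [d0|dn] := pselect (a.1 * b.2 - a.2 * b.1 = 0); last by apply: direct => //; exact: nz.
pose c : plane := (- a.2, a.1).
have hc : `|c| < r by move: ha; rewrite !prod_normE /= normrN maxC.
have sq : a.1 * a.1 + a.2 * a.2 <> 0.
  move=> e; apply: a0; case: (a) e => x y /= e.
  by have x0 : x = 0 by [nra]; have y0 : y = 0 by [nra]; rewrite x0 y0.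
have dac : a.1 * c.2 - a.2 * c.1 <> 0 by rewrite /c /= mulrN opprK.
have dcb : c.1 * b.2 - c.2 * b.1 <> 0.
  rewrite /c /= => e.
  have e1 : (a.1 * a.1 + a.2 * a.2) * b.1 = 0.
    have -> : (a.1 * a.1 + a.2 * a.2) * b.1 = - a.1 * (- a.2 * b.2 - a.1 * b.1) - a.2 * (a.1 * b.2 - a.2 * b.1) by ring.
    by rewrite e d0; ring.
  have e2 : (a.1 * a.1 + a.2 * a.2) * b.2 = 0.
    have -> : (a.1 * a.1 + a.2 * a.2) * b.2 = - a.2 * (- a.2 * b.2 - a.1 * b.1) + a.1 * (a.1 * b.2 - a.2 * b.1) by ring.
    by rewrite e d0; ring.
  apply: b0; move/eqP: e1; move/eqP: e2; rewrite !mulf_eq0.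
  by move=> /orP[/eqP //|/eqP e2] /orP[/eqP //|/eqP e1]; case: (b) e1 e2 => x y /= -> ->.
have [k hk] := direct _ _ ha hc (nz _ _ dac).
have [l hl] := direct _ _ hc hb (nz _ _ dcb).
by exists (concat k l); exact: pth_concat hk hl.
Qed.

Lemma punctured_pconn : @pconn R plane punctured.
Proof.
move=> a b a0 b0; have na := normr_ge0 a; have nb := normr_ge0 b.
have ha : `|a| < 1 + `|a| + `|b| by lra.
have hb : `|b| < 1 + `|a| + `|b| by lra.
have [c hc] := punctured_ball_pconn ha hb a0 b0.
by exists c; apply: pth_sub hc => u [].
Qed.

(** Three linear forms with 2 [lf] 0 + [lf] 1 + [lf] 2 = 0. The half-planes where they are positive
    cover the punctured plane and have no common point, so their nerve is a triangle without its
    interior. *)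
Let lf (i : 'I_3) (u : plane) : R :=
  if i == 0%N :> nat then u.1 else if i == 1%N :> nat then u.2 - u.1 else - u.1 - u.2.
Let V (i : 'I_3) : set plane := [set u | 0 < lf i u].
Let lf_lin i a b (t : R) : lf i ((1 - t) *: a + t *: b) = (1 - t) * lf i a + t * lf i b.
Proof.
have e1 : ((1 - t) *: a + t *: b).1 = (1 - t) * a.1 + t * b.1 by [].
have e2 : ((1 - t) *: a + t *: b).2 = (1 - t) * a.2 + t * b.2 by [].
by rewrite /lf e1 e2; case: ifP => _; [|case: ifP => _]; ring.
Qed.
Let convexV i : convexp (V i).
Proof.
move=> a b t; rewrite /V /= => ha hb /andP[t0 t1]; rewrite lf_lin.
have [->|tn] := eqVneq t 0; first by rewrite subr0 mul1r mul0r addr0.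
have tp : 0 < t by rewrite lt_def tn.
have h1 := mulr_gt0 tp hb; have h2 : 0 <= (1 - t) * lf i a by rewrite mulr_ge0 ?subr_ge0 // ltW.
lra.
Qed.
Let VX i : V i `<=` punctured.
Proof.
move=> u; rewrite /V /= => h u0; move: h; rewrite u0 /lf /=.
by case: ifP => _; [|case: ifP => _]; rewrite ?subr0 ?oppr0 ltxx.
Qed.
Let pL i a b : V i a -> V i b -> pth punctured a b (line a b).
Proof. by move=> ha hb; apply: (pth_sub (@VX i)); exact: pth_line. Qed.
Let L i a b (ha : V i a) (hb : V i b) : P R punctured a b := pcl (pL ha hb).
Let L_eq i j a b (ha : V i a) (hb : V i b) (ha' : V j a) (hb' : V j b) : L ha hb = L ha' hb'.
Proof. exact: pcl_irr. Qed.
Let L_uniq i a b (ha : V i a) (hb : V i b) (c : R -> plane) (h : pth (V i) a b c) : pcl (pth_sub (@VX i) h) = L ha hb.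
Proof. by apply: pclE; apply: (hty_sub (@VX i)); apply: hty_convex h _ => //; exact: pth_line. Qed.
Let L_mul i a b c (ha : V i a) (hb : V i b) (hc : V i c) : pmul (L ha hb) (L hb hc) = L ha hc.
Proof.
have h := pth_concat (pth_line (@convexV i) ha hb) (pth_line (@convexV i) hb hc).
rewrite -(L_uniq ha hc h) -(L_uniq ha hb (pth_line (@convexV i) ha hb)).
by rewrite -(L_uniq hb hc (pth_line (@convexV i) hb hc)) pmulE; exact: pcl_irr.
Qed.

Let i0 : 'I_3 := inord 0. Let i1 : 'I_3 := inord 1. Let i2 : 'I_3 := inord 2.
Let base : plane := (1, 0).
Let p1 : plane := (0, 1).
Let p2 : plane := (0, -1).
Let m01 : plane := (1, 2).
Let m02 : plane := (1, -2).
Let m12 : plane := (-1, 0).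
Ltac vtac := rewrite /V /= /lf !inordK //=; lra.
Let h00 : V i0 base. Proof. by vtac. Qed.
Let h11 : V i1 p1. Proof. by vtac. Qed.
Let h22 : V i2 p2. Proof. by vtac. Qed.
Let h0m : V i0 m01. Proof. by vtac. Qed.
Let h1m : V i1 m01. Proof. by vtac. Qed.
Let h0n : V i0 m02. Proof. by vtac. Qed.
Let h2n : V i2 m02. Proof. by vtac. Qed.
Let h1k : V i1 m12. Proof. by vtac. Qed.
Let h2k : V i2 m12. Proof. by vtac. Qed.

Lemma punctured_cyc (hb : punctured (1, 0)) : cyc R hb.
Proof.
pose pt (i : 'I_3) : plane := if i == 0%N :> nat then base else if i == 1%N :> nat then p1 else p2.
pose E1 : P R punctured base p1 := pmul (L h00 h0m) (L h1m h11).
pose E2 : P R punctured base p2 := pmul (L h00 h0n) (L h2n h22).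
(* The loop around the triangle. The paths to p1 and p2 are chosen so that the overlaps with the
   first half-plane contribute nothing, and only the third overlap produces [g]. *)
pose g : P R punctured base base := pmul (pmul (pmul E1 (L h11 h1k)) (L h2k h22)) (pinv E2).
exists g.
have c3 (i : 'I_3) : [\/ i = i0, i = i1 | i = i2].
  case: i => [[|[|[|//]]] h]; [apply: Or31|apply: Or32|apply: Or33]; by apply/val_inj; rewrite /= inordK.
have e0 : pt i0 = base by rewrite /pt inordK.
have e1 : pt i1 = p1 by rewrite /pt inordK.
have e2 : pt i2 = p2 by rewrite /pt inordK.
(* The end point [pt i] depends on i, so the three choices are described by equations for i and the
   family is then obtained by choice. *)
have ex i : exists Ei : P R punctured base (pt i), 
  [/\ (i = i0 -> forall u (hu : V i0 u) (c : R -> plane) (h : pth punctured (pt i) u c), pth (V i) (pt i) u c -> pmul Ei (pcl h) = L h00 hu),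
      (i = i1 -> forall u (hu : V i1 u) (c : R -> plane) (h : pth punctured (pt i) u c), pth (V i) (pt i) u c -> pmul Ei (pcl h) = pmul E1 (L h11 hu)) &
      (i = i2 -> forall u (hu : V i2 u) (c : R -> plane) (h : pth punctured (pt i) u c), pth (V i) (pt i) u c -> pmul Ei (pcl h) = pmul E2 (L h22 hu))].
  have n01 : i0 <> i1 by move/(congr1 val); rewrite /= !inordK.
  have n02 : i0 <> i2 by move/(congr1 val); rewrite /= !inordK.
  have n12 : i1 <> i2 by move/(congr1 val); rewrite /= !inordK.
  case: (c3 i) => ->.
  - rewrite e0; exists (pone R hb); split=> // _ u hu c h h'.
    by rewrite pmul1p -(L_uniq h00 hu h'); exact: pcl_irr.
  - rewrite e1; exists E1; split=> [|_ u hu c h h'|] //; first by move/esym.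
    by congr pmul; rewrite -(L_uniq h11 hu h'); exact: pcl_irr.
  - rewrite e2; exists E2; split=> [||_ u hu c h h'] //; [by move/esym|by move/esym|].
    by congr pmul; rewrite -(L_uniq h22 hu h'); exact: pcl_irr.
pose E i := projT1 (cid (ex i)).
have hE i := projT2 (cid (ex i)).
have F0 u (hu : V i0 u) (c : R -> plane) (h : pth (V i0) (pt i0) u c) : pmul (E i0) (pcl (pth_sub (@VX i0) h)) = L h00 hu.
  by have [+ _ _] := hE i0; apply.
have F1 u (hu : V i1 u) (c : R -> plane) (h : pth (V i1) (pt i1) u c) : pmul (E i1) (pcl (pth_sub (@VX i1) h)) = pmul E1 (L h11 hu).
  by have [_ + _] := hE i1; apply.
have F2 u (hu : V i2 u) (c : R -> plane) (h : pth (V i2) (pt i2) u c) : pmul (E i2) (pcl (pth_sub (@VX i2) h)) = pmul E2 (L h22 hu).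
  by have [_ _] := hE i2; apply.
have G01 u (u0 : V i0 u) (u1 : V i1 u) : pmul E1 (L h11 u1) = L h00 u0.
  by rewrite /E1 -pmulA L_mul (L_eq h1m u1 h0m u0) L_mul.
have G02 u (u0 : V i0 u) (u2 : V i2 u) : pmul E2 (L h22 u2) = L h00 u0.
  by rewrite /E2 -pmulA L_mul (L_eq h2n u2 h0n u0) L_mul.
have G12 u (u1 : V i1 u) (u2 : V i2 u) : pmul E1 (L h11 u1) = pmul g (pmul E2 (L h22 u2)).
  rewrite /g -[RHS]pmulA pmulVK -[RHS]pmulA (L_mul h2k h22 u2).
  by rewrite (L_eq h2k u2 h1k u1) -[RHS]pmulA (L_mul h11 h1k u1).
have Vt i x (c : R -> plane) (h : pth (V i) (pt i) x c) : V i x by case: h => _ Vc _ <-.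
have gg : loop_gen hb [set g] g by exact: gen_in.
have key u (i : 'I_3) (c : R -> plane) (h : pth (V i) (pt i) u c) (w : P R punctured base u) :
   w = pmul (E i) (pcl (pth_sub (@VX i) h)) -> 
   [\/ exists u0 : V i0 u, w = L h00 u0, exists u1 : V i1 u, w = pmul E1 (L h11 u1) |
       exists u2 : V i2 u, w = pmul E2 (L h22 u2)].
  case: (c3 i) => ei; subst i => ->; have Vu := Vt _ _ _ h.
  - by apply: Or31; exists Vu; exact: F0.
  - by apply: Or32; exists Vu; exact: F1.
  - by apply: Or33; exists Vu; exact: F2.
apply: (nerve_generation (E := E) (VX := VX)).
- by move=> a b; exact: genM.
- by move=> a; exact: genV.
- move=> u u0.
  have [i hi] : exists i, 0 < lf i u.
    have [h|h] := ltP 0 u.1; first by exists i0; rewrite /lf inordK.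
    have [h'|h'] := ltP 0 (u.2 - u.1); first by exists i1; rewrite /lf inordK.
    exists i2; rewrite /lf inordK //=; rewrite ltNge; apply/negP => h2; apply: u0.
    have a0 : u.1 = 0 by lra.
    have b0 : u.2 = 0 by lra.
    by case: (u) a0 b0 => ? ? /= -> ->.
  exists i.
  have : continuous (lf i) by rewrite /lf; case: (nat_of_ord i == 0%N); [|case: (nat_of_ord i == 1%N)]; cont.
  move=> cl_; have : nbhs u (lf i @^-1` [set y | 0 < y]) := cl_ u _ (lt_nbhsr hi).
  by apply: filterS => y /= hy _.
- move=> i x Vx; exists (line (pt i) x); apply: pth_line => //.
  by case: (c3 i) => ->; rewrite ?e0 ?e1 ?e2.
- have L00 : L h00 h00 = pone R hb.
    apply: (@pmulI _ _ _ _ _ _ (L h00 h00)); by rewrite L_mul pmulp1.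
  move=> i c h; have [] := key _ _ _ h _ erefl; case=> hu ->.
  + by rewrite (L_eq h00 hu h00 h00) L00; exact: gen1.
  + by rewrite (G01 _ h00 hu) L00; exact: gen1.
  + by rewrite (G02 _ h00 hu) L00; exact: gen1.
- move=> i j u a b ha hb'; have g1 := gen1 (@pmul R _ punctured base base base) (@pinv R _ _ base base) (pone R hb) [set g].
  set w := pmul (E i) _; set w' := pmul (E j) _.
  have [] := key _ _ _ ha w erefl => -[hu ->]; have [] := key _ _ _ hb' w' erefl => -[hu' ->].
  + by rewrite (L_eq h00 hu h00 hu') (pmulpV hb).
  + by rewrite (G01 _ hu hu') (pmulpV hb).
  + by rewrite (G02 _ hu hu') (pmulpV hb).
  + by rewrite (G01 _ hu' hu) (pmulpV hb).
  + by rewrite (L_eq h11 hu h11 hu') (pmulpV hb).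
  + by rewrite (G12 _ hu hu') pmulK.
  + by rewrite (G02 _ hu' hu) (pmulpV hb).
  + by rewrite (G12 _ hu' hu) pinvM pmulA (pmulpV hb) pmul1p; exact: genV.
  + by rewrite (L_eq h22 hu h22 hu') (pmulpV hb).
Qed.

Lemma punctured_cycP a (ha : punctured a) : cyc R ha.
Proof.
have hb : punctured (1, 0) by move=> /(congr1 fst) /= /eqP; rewrite oner_eq0.
have [c hc] := punctured_pconn hb ha.
exact: cyc_conj (pcl hc) (punctured_cyc hb).
Qed.
End ConvexPlane.

(** * Paths and local loops on a surface minus finitely many points *)

Section SurfaceLoops.
Variables (R : realType) (T : topologicalType).
Hypothesis hT : hausdorff_space T.
Notation plane := (R * R)%type.

Lemma chart_line_pth (M : set T) q (e : plane -> T) f O (u v : plane) : chart M q e f O ->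
  pth (M `&` O) (e u) (e v) (fun s => e (line u v s)).
Proof.
move=> [ce Me fe _ _]; have [cl_ _ l0 l1] := @pth_line R _ u v (@convexT R) I I.
split; [exact: ct_comp|by move=> s; exact: Me|by rewrite l0|by rewrite l1].
Qed.

Lemma locally_pconn (M : set T) q O : @surface R T M -> M q -> open O -> O q ->
  exists W : set T, [/\ open W, W q & forall u, W u -> M u -> exists c : R -> T, pth (M `&` O) q u c].
Proof.
move=> sM Mq oO Oq; have [e0 [f0 [O0 c0]]] := sM q Mq.
have [e [f [W [ch WO]]]] := chart_shrink c0 oO Oq.
have [ce Me fe [oW ef] [cf eq]] := ch; exists W; split=> //.
  by rewrite -eq; exact: (Me 0).2.
move=> u Wu Mu; exists (fun s => e (line 0 (f u) s)).
have := chart_line_pth 0 (f u) ch; rewrite eq ef //.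
by apply: pth_sub => x [? /WO].
Qed.

Lemma chart_avoiding (M F : set T) q : @surface R T M -> finite_set F -> M q ->
  exists (e : plane -> T) f O, chart M q e f O /\ forall x, O x -> F x -> x = q.
Proof.
move=> sM fF Mq; have [e0 [f0 [O0 c0]]] := sM q Mq.
have oU : open (~` (F `\ q)).
  by apply: closed_openC; apply: finite_closed => //; exact: finite_setD.
have [|e [f [O [ch OU]]]] := chart_shrink c0 oU; first by move=> [_]; exact.
exists e, f, O; split=> // x /OU h Fx; apply: contrapT => xq; exact: h.
Qed.

Lemma punctured_chart_pth (M F : set T) q (e : plane -> T) f O u v : chart M q e f O ->
  (forall x, O x -> F x -> x = q) -> ~ F (e u) -> ~ F (e v) -> forall r : R, `|u| < r -> `|v| < r ->
  exists c : R -> T, pth (M `&` O `&` ~` F `&` (fun x => `|f x| < r)) (e u) (e v) c.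
Proof.
move=> ch OF Fu Fv r ur vr; have [ce Me fe [oO ef] [cf eq]] := ch.
have [Fq|nF] := pselect (F q).
  have u0 : u <> 0 by move=> u0; apply: Fu; rewrite u0 eq.
  have v0 : v <> 0 by move=> v0; apply: Fv; rewrite v0 eq.
  have [c [cc Xc c0 c1]] := punctured_ball_pconn ur vr u0 v0.
  exists (fun s => e (c s)); split; [exact: ct_comp| |by rewrite c0|by rewrite c1].
  move=> s; have [rs ps] := Xc s; have [Ms Os] := Me (c s).
  split; last by rewrite fe.
  split=> //; move=> /(OF _ Os) h; apply: ps; by rewrite -[LHS]fe h -eq fe.
have [cl_ Cl l0 l1] := pth_line (@convex_ball R r) ur vr.
exists (fun s => e (line u v s)); split; [exact: ct_comp| |by rewrite l0|by rewrite l1].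
move=> s; have [Ms Os] := Me (line u v s); split; last by rewrite fe; exact: Cl.
by split=> // h; apply: nF; rewrite -(OF _ Os h).
Qed.

(** The path in [M] may run through [F]; one follows it only approximately, moving inside charts
    from which at most the centre has been removed. *)
Lemma surface_minus_pconn (M F : set T) : @surface R T M -> @pconn R T M -> finite_set F ->
  @pconn R T (M `\` F).
Proof.
move=> sM pM fF a b [Ma Fa] [Mb Fb].
have [c [cc Mc c0 c1]] := pM a b Ma Mb.
(* The invariant along the path is that all points off [F] near [c s] can be reached, whether or not
   [c s] itself lies in [F]. *)
pose conn x := exists d : R -> T, pth (M `\` F) a x d.
pose Q (s : R) := exists W, nbhs (c s) W /\ forall x, W x -> M x -> ~ F x -> conn x.
suff [W [nW hW]] : Q 1 by apply: hW => //; apply: nbhs_singleton; rewrite -c1.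
apply: real_induction.
  have [W [oW Wa hW]] := locally_pconn sM Ma (closed_openC (finite_closed hT fF)) Fa.
  exists W; rewrite c0; split; first exact: open_nbhs_nbhs.
  by move=> x Wx Mx Fx; exact: hW.
move=> s _; have [e [f [O [ch OF]]]] := chart_avoiding sM fF (Mc s).
have [ce Me fe [oO ef] [cf eq]] := ch.
have Ocs : O (c s) by rewrite -eq; exact: (Me 0).2.
have [eps e0 he] := continuous_near01 cc (open_nbhs_nbhs (conj oO Ocs)).
exists eps => // u v u0 uv v1 us vs [W [nW hW]].
have Ou : O (c u) by exact: he.
have Ov : O (c v) by exact: he.
(* An intermediate point, close to [c u] and off the centre of the new chart. *)
have [w [w0 Ww]] : exists w : plane, w <> 0 /\ W (e w).
  have : nbhs (f (c u)) (e @^-1` W) by apply: ce; rewrite ef.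
  move=> /nbhs_ballP[r /= r0 hr].
  have in_ball d : `|d| < r -> W (e (f (c u) + d)).
    by move=> h; apply: hr; rewrite -ball_normE /= opprD addNKr normrN.
  have [z|nz] := eqVneq (f (c u)) 0; last first.
    by exists (f (c u)); split; [exact/eqP|have := in_ball 0; rewrite addr0 normr0; apply].
  have rr : `|(r / 2, 0) : plane| < r by rewrite prod_normE /= normr0 (gtr0_norm (divr_gt0 r0 _)) // gt_max r0 andbT ltr_pdivrMr // mulr_natr mulr2n ltrDr.
  exists (f (c u) + (r / 2, 0)); split; last exact: in_ball.
  by rewrite z add0r => /(congr1 fst) /= /eqP; rewrite gt_eqF // divr_gt0.
have Few : ~ F (e w).
  by move=> /(OF _ (Me w).2) h; apply: w0; rewrite -[LHS]fe h -eq fe.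
have [d hd] := hW _ Ww (Me w).1 Few.
exists O; split; first exact: open_nbhs_nbhs.
move=> x Ox Mx Fx; have Fx' : ~ F (e (f x)) by rewrite ef.
have [||k hk] := punctured_chart_pth ch OF Few Fx' (r := 1 + `|w| + `|f x|).
- by rewrite -addrA addrCA ltrDl ltr_pwDl.
- by rewrite ltrDr ltr_pwDl.
rewrite ef // in hk; exists (concat d k); apply: pth_concat hd _.
by apply: pth_sub hk => y [[[]]].
Qed.

(** If [Q K] failed, the sets whose complement in K satisfies [Q] would form a proper filter
    containing K; the local hypothesis forbids it to cluster in K. *)
Lemma compact_induction (K : set T) (Q : set T -> Prop) : compact K -> Q set0 ->
  (forall A B, Q A -> Q B -> Q (A `|` B)) -> (forall A B, A `<=` B -> Q B -> Q A) ->
  (forall x, K x -> exists2 U, nbhs x U & Q (U `&` K)) -> Q K.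
Proof.
move=> cK Q0 QU Qs loc; apply: contrapT => nQ.
pose F : set_system T := [set B | Q (K `\` B)].
have FF : ProperFilter F.
  split; first by rewrite /F /= setD0.
  split.
  - by rewrite /F /= setDT.
  - by move=> A B hA hB; rewrite /F /= setDIr; exact: QU.
  - by move=> A B AB; apply: Qs; exact: setDS.
have FK : F K by rewrite /F /= setDv.
have [x [Kx clx]] := cK F FF FK.
have [U nU QUK] := loc x Kx.
have FKU : F (K `\` U) by rewrite /F /= setDD setIC.
by have [y [[_ nUy] Uy]] := clx _ _ FKU nU.
Qed.

(** Read in the chart, such a loop lives in the punctured plane if the centre lies in [F], and in
    the whole plane otherwise. *)
Lemma chart_loop_cyc (M F : set T) q (e : plane -> T) f O (u : plane) (hu : (M `\` F) (e u)) : chart M q e f O ->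
  (forall x, O x -> F x -> x = q) ->
  exists g : P R (M `\` F) (e u) (e u), forall c (h : pth (M `\` F) (e u) (e u) c),
    (forall s, O (c s)) -> loop_gen hu [set g] (pcl h).
Proof.
move=> ch OF; have [ce Me fe [oO ef] [cf eq]] := ch.
have [Fq|nF] := pselect (F q).
  have ge w : punctured w -> (M `\` F) (e w).
    move=> w0; split; first exact: (Me w).1.
    by move=> /(OF _ (Me w).2) h; apply: w0; rewrite -[LHS]fe h -eq fe.
  have u0 : punctured u by move=> u0; apply: hu.2; rewrite u0 eq.
  have [g hg] := punctured_cycP u0.
  have te : @tcont R _ _ (@punctured R) e by exact: tcont_continuous.
  exists (pmap te ge g) => c h Oc; have [cc Xc c0 c1] := h.
  have hfc : pth (@punctured R) u u (fun s => f (c s)).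
    split; [|move=> s z|by rewrite c0 fe|by rewrite c1 fe].
      by move=> s; apply: continuous_comp; [exact: cc|exact: cf].
    by have [Ms Fs] := Xc s; apply: Fs; rewrite -[c s]ef // z eq.
  have -> : pcl h = pmap te ge (pcl hfc).
    rewrite (pmapE _ _ hfc (pth_map te ge hfc)); apply: pclE; apply: hty_eq => // s _.
    by rewrite ef //; have [] := Xc s.
  elim: (hg (pcl hfc)) => [|b ->|b b' _ h1 _ h2|b _ h1].
  - by rewrite (pmap1 _ _ _ hu); exact: gen1.
  - exact: gen_in.
  - by rewrite pmapM; exact: genM.
  - by rewrite pmapV; exact: genV.
exists (pone R hu) => c h Oc; have [cc Xc c0 c1] := h.
suff -> : pcl h = pone R hu by exact: gen1.
have ge w : [set: plane] w -> (M `\` F) (e w).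
  move=> _; split; first exact: (Me w).1.
  by move=> Fw; apply: nF; rewrite -(OF _ (Me w).2 Fw).
have te : @tcont R _ _ [set: plane] e by exact: tcont_continuous.
have hfc : pth [set: plane] u u (fun s => f (c s)).
  split=> [s|//||]; [|by rewrite c0 fe|by rewrite c1 fe].
  by apply: continuous_comp; [exact: cc|exact: cf].
have hcst : pth [set: plane] u u (fun _ : R => u) by exact: pth_cst.
have -> : pcl h = pmap te ge (pcl hfc).
  rewrite (pmapE _ _ hfc (pth_map te ge hfc)); apply: pclE; apply: hty_eq => // s _.
  by rewrite ef //; have [] := Xc s.
rewrite (pclE hfc hcst (hty_convex (@convexT R) hfc hcst)).
rewrite (pmapE _ _ hcst (pth_map te ge hcst)); exact: pcl_irr.
Qed.
End SurfaceLoops.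

Lemma pmul_insert (R : realType) (Y : topologicalType) (X : set Y) (x0 u v : Y)
    (x y : P R X x0 v) (a b : P R X x0 u) (t : P R X u v) :
  pmul x (pinv y) = pmul (pmul (pmul x (pinv (pmul a t))) (pmul a (pinv b))) (pmul (pmul b t) (pinv y)).
Proof.
rewrite pinvM [pmul x (pmul (pinv t) _)]pmulA -(pmulA (pmul x (pinv t))) pmulVK.
by rewrite -[RHS]pmulA -(pmulA b) pmulVK -pmulA pmulVK.
Qed.

(** * Finite generation for a compact surface minus finitely many points *)

Section SurfaceFinGen.
Variables (R : realType) (T : topologicalType).
Hypothesis hT : hausdorff_space T.
Notation plane := (R * R)%type.
Variables (M F : set T).
Hypotheses (sM : @surface R T M) (cM : compact M) (pM : @pconn R T M) (fF : finite_set F).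
Let X := M `\` F.
Let I := {q : T | M q}.
Let exch (i : I) : exists (e : plane -> T) f O, chart M (sval i) e f O /\ forall x, O x -> F x -> x = sval i :=
  chart_avoiding hT sM fF (svalP i).
Let e (i : I) := projT1 (cid (exch i)).
Let f (i : I) := projT1 (cid (projT2 (cid (exch i)))).
Let O (i : I) := projT1 (cid (projT2 (cid (projT2 (cid (exch i)))))).
Let ch i : chart M (sval i) (e i) (f i) (O i).
Proof. exact: (projT2 (cid (projT2 (cid (projT2 (cid (exch i))))))).1. Qed.
Let OF i x : O i x -> F x -> x = sval i.
Proof. exact: (projT2 (cid (projT2 (cid (projT2 (cid (exch i))))))).2. Qed.
Let hat i := X `&` O i.
Let hatX i : hat i `<=` X. Proof. by move=> x []. Qed.
(** Two sizes of chart domain are kept. The small ones form the cover, and their overlaps lie in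
    compact intersections of closed discs; paths are compared in the large ones. This gives
    finiteness even if an overlap has infinitely many components. *)
Let V i := hat i `&` [set x | `|f i x| < 1].
(** Inside the unit disc and away from the centre, the only place where a chart can meet [F]. *)
Let b0 : plane := (2^-1, 0).
Let p i := e i b0.
Let b0n : `|b0| < 1 :> R.
Proof. by rewrite prod_normE /= normr0 gtr0_norm ?invr_gt0 // gt_max ltr01 andbT invf_lt1 // ltr1n. Qed.
Let nF i u : u <> 0 -> ~ F (e i u).
Proof.
have [ce Me fe _ [_ eq]] := ch i.
by move=> u0 /(OF (Me u).2) h; apply: u0; rewrite -[LHS]fe h -eq fe.
Qed.
Let b0nz : b0 <> 0.
Proof. by move/(congr1 fst) => /= /eqP; rewrite invr_eq0 pnatr_eq0. Qed.
Let Xp i : X (p i).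
Proof. by have [_ Me _ _ _] := ch i; split; [exact: (Me b0).1|exact: nF]. Qed.
Let path_hat i x : hat i x -> exists c, @pth R _ (hat i) (p i) x c.
Proof.
move=> [[Mx Fx] Ox]; have [ce Me fe [oO ef] _] := ch i.
have Fx' : ~ F (e i (f i x)) by rewrite ef.
have [||c hc] := punctured_chart_pth (ch i) (@OF i) (@nF i _ b0nz) Fx' (r := 1 + `|f i x|).
- by rewrite (lt_le_trans b0n) // lerDl.
- by rewrite ltrDr.
by rewrite ef // in hc; exists c; apply: pth_sub hc => y [[[? ?] ?] _].
Qed.
Let path_V i x : V i x -> exists c, @pth R _ (V i) (p i) x c.
Proof.
move=> [[[Mx Fx] Ox] fx]; have [ce Me fe [oO ef] _] := ch i.
have Fx' : ~ F (e i (f i x)) by rewrite ef.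
have [|//|c hc] := punctured_chart_pth (ch i) (@OF i) (@nF i _ b0nz) Fx' (r := 1); first exact: b0n.
by rewrite ef // in hc; exists c; apply: pth_sub hc => y [[[? ?] ?] ?].
Qed.

Variables (x0 : T) (hx : X x0).
Let pX : @pconn R T X. Proof. exact: surface_minus_pconn. Qed.
Let E i : P R X x0 (p i) := pcl (projT2 (cid (pX hx (Xp i)))).
Let br i u (c : R -> T) (h : pth (hat i) (p i) u c) : P R X x0 u := pmul (E i) (pcl (pth_sub (@hatX i) h)).
Let gex i := chart_loop_cyc (Xp i) (ch i) (@OF i).
Let A i : P R X x0 x0 := pmul (pmul (E i) (projT1 (cid (gex i)))) (pinv (E i)).
Notation G := (gen (@pmul R T X x0 x0 x0) (@pinv R T X x0 x0) (pone R hx)).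

Let br_loop i u (c d : R -> T) (hc : pth (hat i) (p i) u c) (hd : pth (hat i) (p i) u d) :
  G [set A i] (pmul (br hc) (pinv (br hd))).
Proof.
have hl := pth_concat hc (pth_rev hd).
have Oc s : O i (concat c (revp d) s) by have [_ h _ _] := hl; have [] := h s.
have := projT2 (cid (gex i)) _ (pth_sub (@hatX i) hl) Oc => /= hg.
have := conj_gen hx (pinv (E i)) hg; rewrite /pconj image_set1 !pinvK.
suff -> : pmul (pmul (E i) (pcl (pth_sub (@hatX i) hl))) (pinv (E i)) = pmul (br hc) (pinv (br hd)) by [].
rewrite /br pinvM !pmulA -[in RHS](pmulA (E i)); congr (pmul (pmul _ _) _).
by rewrite pinvE pmulE; exact: pcl_irr.
Qed.

Let br_seg i u v (c s : R -> T) (hc : pth (hat i) (p i) u c) (hs : pth (hat i) u v s) :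
  br (pth_concat hc hs) = pmul (br hc) (pcl (pth_sub (@hatX i) hs)).
Proof. by rewrite /br -pmulA; congr pmul; rewrite pmulE; exact: pcl_irr. Qed.

(** Near a given point of the compact overlap all passages from one chart to the other differ only
    by loops inside the two charts, which [chart_loop_cyc] controls; compactness leaves finitely
    many such points. *)
Let pairs i j : exists2 Fs : set (P R X x0 x0), finite_set Fs &
  forall u (c d : R -> T) (hc : pth (hat i) (p i) u c) (hd : pth (hat j) (p j) u d),
    V i u -> V j u -> G Fs (pmul (br hc) (pinv (br hd))).
Proof.
have [ij|nij] := pselect (i = j).
  subst j; exists [set A i]; first exact: finite_set1.
  by move=> u c d hc hd _ _; exact: br_loop.
pose D k := e k @` [set u : plane | `|u| <= 1].
pose K := D i `&` D j.
have VD k u : V k u -> D k u.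
  move=> [[[Mu _] Ou] fu]; have [_ _ _ [_ ef] _] := ch k.
  by exists (f k u); [exact: ltW|exact: ef].
have cK : compact K.
  apply: (subclosed_compact _ (B := D i)) => //; last by move=> u [].
    by apply: closedI; [exact: chart_disc_closed (ch i)|exact: chart_disc_closed (ch j)].
  apply: continuous_compact; last exact: compact_disc.
  by apply: continuous_subspaceT; have [] := ch i.
pose Q (B : set T) := exists2 Fs : set (P R X x0 x0), finite_set Fs &
  forall u (c d : R -> T) (hc : pth (hat i) (p i) u c) (hd : pth (hat j) (p j) u d),
    B u -> G Fs (pmul (br hc) (pinv (br hd))).
suff [Fs fin h] : Q K by exists Fs => // u c d hc hd Vi Vj; apply: h; split; exact: VD.
apply: compact_induction => //.
- by exists set0; [exact: finite_set0|].
- move=> B1 B2 [F1 f1 h1] [F2 f2 h2]; exists (F1 `|` F2); first by rewrite finite_setU.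
  by move=> u c d hc hd [Bu|Bu]; [apply: gen_mono (h1 _ _ _ hc hd Bu) => y ?; left|apply: gen_mono (h2 _ _ _ hc hd Bu) => y ?; right].
- by move=> B1 B2 s [F2 f2 h2]; exists F2 => // u c d hc hd /s; exact: h2.
move=> u0 [Du0 Du0'].
have Ok k u : D k u -> M u /\ O k u.
  by have [_ Me _ _ _] := ch k; move=> [w _ <-].
have Mu0 := (Ok _ _ Du0).1; have O1 := (Ok _ _ Du0).2; have O2 := (Ok _ _ Du0').2.
(* A point of [F] in both charts would be the centre of both. *)
have nFu0 : ~ F u0.
  move=> Fu; apply: nij; have := OF O2 Fu; rewrite (OF O1 Fu).
  by clear; case: i j => [a ha] [b hb] /= h; apply: eq_exist.
have oij : open (O i `&` O j) by apply: openI; [have [_ _ _ []] := ch i|have [_ _ _ []] := ch j].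
have [W [oW Wu0 hW]] := locally_pconn (surface_minus hT sM fF) (conj Mu0 nFu0) oij (conj O1 O2).
have [c0 hc0] := path_hat (i := i) (conj (conj Mu0 nFu0) O1).
have [d0 hd0] := path_hat (i := j) (conj (conj Mu0 nFu0) O2).
exists W; first exact: open_nbhs_nbhs.
exists ([set A i] `|` [set A j] `|` [set pmul (br hc0) (pinv (br hd0))]).
  by rewrite !finite_setU; split; [split|]; exact: finite_set1.
move=> u c d hc hd [Wu _].
have Xu : X u by have [_ Xc _ <-] := hc; exact: (Xc 1).1.
have [s hs] := hW u Wu Xu.
have hsi : pth (hat i) u0 u s by apply: pth_sub hs => y [? []].
have hsj : pth (hat j) u0 u s by apply: pth_sub hs => y [? []].
have g1 := br_loop hc (pth_concat hc0 hsi).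
have g2 := br_loop (pth_concat hd0 hsj) hd.
have -> : pmul (br hc) (pinv (br hd)) = pmul (pmul (pmul (br hc) (pinv (br (pth_concat hc0 hsi))))
     (pmul (br hc0) (pinv (br hd0)))) (pmul (br (pth_concat hd0 hsj)) (pinv (br hd))).
  rewrite !br_seg (pcl_irr (pth_sub (@hatX j) hsj) (pth_sub (@hatX i) hsi)).
  exact: pmul_insert.
apply: genM; last by apply: gen_mono g2 => z ->; left; right.
apply: genM; first by apply: gen_mono g1 => z ->; left; left.
by apply: gen_in; right.
Qed.

Let bases i : exists2 Fs : set (P R X x0 x0), finite_set Fs &
  forall (c : R -> T) (hc : pth (hat i) (p i) x0 c), G Fs (br hc).
Proof.
have [h0|nh] := pselect (hat i x0); last first.
  exists set0; [exact: finite_set0|move=> c hc; exfalso; apply: nh].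
  by have [_ Hc _ <-] := hc.
have [c0 hc0] := path_hat h0.
exists ([set A i] `|` [set br hc0]).
  by rewrite finite_setU; split; exact: finite_set1.
move=> c hc; rewrite -[br hc](pmulKp _ (br hc0)); apply: genM.
  by apply: gen_mono (br_loop hc hc0) => z ->; left.
by apply: gen_in; right.
Qed.

Lemma surface_fg : loop_fg R hx.
Proof.
have [S [finS covS]] : exists S : set I, finite_set S /\ forall x, M x -> exists2 i, S i & O i x /\ `|f i x| < 1.
  pose Q (B : set T) := exists S : set I, finite_set S /\ forall x, B x -> M x -> exists2 i, S i & O i x /\ `|f i x| < 1.
  suff [S [fS hS]] : Q M by exists S; split=> // x Mx; exact: hS.
  apply: compact_induction => //.
  - by exists set0; split; [exact: finite_set0|].
  - move=> B1 B2 [S1 [f1 h1]] [S2 [f2 h2]]; exists (S1 `|` S2); split; first by rewrite finite_setU.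
    move=> x [/h1 h|/h2 h] Mx; have [i Si ?] := h Mx; exists i => //; by [left|right].
  - by move=> B1 B2 s [S [fS hS]]; exists S; split=> // x /s; exact: hS.
  move=> x Mx; pose i : I := exist _ x Mx.
  have [ce Me fe [oO ef] [cf eq]] := ch i.
  have Oi : O i x by have := (Me 0).2; rewrite eq.
  exists (O i `&` [set y | `|f i y| < 1]).
    apply: filterI; first exact: open_nbhs_nbhs.
    have ex : x = e i 0 by rewrite eq.
    have h : `|f i x| < 1 by rewrite ex fe normr0.
    by have := cf x Oi _ (nbhs_normlt h).
  exists [set i]; split; first exact: finite_set1.
  by move=> y [[? ?] _] _; exists i.
pose Fs i j := s2val (cid2 (pairs i j)).
pose Fb i := s2val (cid2 (bases i)).
pose Ft : set (P R X x0 x0) := (\bigcup_(i in S) \bigcup_(j in S) Fs i j) `|` \bigcup_(i in S) Fb i.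
exists Ft; split.
  rewrite /Ft finite_setU; split; apply: bigcup_finite => // i _; last exact: (s2valP (cid2 (bases i))).
  by apply: bigcup_finite => // j _; exact: (s2valP (cid2 (pairs i j))).
pose J := {i : I | S i}.
pose VJ (j : J) := V (sval j).
have VX j : VJ j `<=` X by move=> x [[]].
have Vhat (j : J) : VJ j `<=` hat (sval j) by move=> x [].
have brE (j : J) u (c : R -> T) (h : pth (VJ j) (p (sval j)) u c) :
  pmul (E (sval j)) (pcl (pth_sub (VX j) h)) = br (pth_sub (Vhat j) h).
  by congr pmul; exact: pcl_irr.
apply: (@nerve_generation _ _ X x0 J VJ (fun j => p (sval j)) (fun j => E (sval j)) _ VX).
- by move=> a b; exact: genM.
- by move=> a; exact: genV.
- move=> x [Mx Fx]; have [i Si [Oi fi]] := covS x Mx.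
  exists (exist _ i Si); have [ce Me fe [oO ef] [cf eq]] := ch i.
  have h1 := open_nbhs_nbhs (conj oO Oi).
  have h2 : nbhs x (f i @^-1` [set w | `|w| < 1]) := cf x Oi _ (nbhs_normlt fi).
  by apply: filterS2 h1 h2 => y /= Oy fy Xy; split.
- by move=> j x; exact: path_V.
- move=> j c h; rewrite brE; apply: gen_mono (s2valP' (cid2 (bases (sval j))) c _).
  by move=> z hz; right; exists (sval j) => //; exact: (svalP j).
- move=> i j u a b ha hb; rewrite !brE.
  apply: gen_mono (s2valP' (cid2 (pairs (sval i) (sval j))) u a b _ _ _ _).
  + move=> z hz; left; exists (sval i); first exact: (svalP i).
    by exists (sval j) => //; exact: (svalP j).
  + by have [_ h _ <-] := ha; exact: h.
  + by have [_ h _ <-] := hb; exact: h.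
Qed.
End SurfaceFinGen.

(** * Pure braid groups as loop groups of nested configurations *)

Section Encode.
Variables (R : realType) (T : topologicalType).

Fixpoint enc (n : nat) : ('I_n -> T) -> confT T n :=
  match n return ('I_n -> T) -> confT T n with
  | 0 => fun _ => true
  | n'.+1 => fun x => (enc (fun i => x (lift ord_max i)), x ord_max)
  end.

Fixpoint dec (n : nat) : confT T n -> 'I_n -> T :=
  match n return confT T n -> 'I_n -> T with
  | 0 => fun _ i => match notF (ltn_ord i) with end
  | n'.+1 => fun z i => if unlift ord_max i is Some j then dec z.1 j else z.2
  end.

Lemma encK n (x : 'I_n -> T) : dec (enc x) = x.
Proof.
elim: n x => [|n IH] x; apply/funext => i; first by case: i.
by rewrite /=; case: unliftP => [j|] -> //; rewrite IH.
Qed.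

Lemma ct_enc n (Z : topologicalType) (x : Z -> 'I_n -> T) :
  (forall i, continuous (fun z => x z i)) -> continuous (fun z => enc (x z)).
Proof.
elim: n x => [|n IH] x cx /=; first exact: ct_cst.
by apply: ct_pair; [apply: IH => i; exact: cx|exact: cx].
Qed.

Lemma ct_dec n (Z : topologicalType) (c : Z -> confT T n) i :
  continuous c -> continuous (fun z => dec (c z) i).
Proof.
elim: n c i => [|n IH] c i cc; first by case: i.
rewrite /=; case: (unlift ord_max i) => [j|]; last exact: ct_snd.
by apply: (IH (fun z => (c z).1)); exact: ct_fst.
Qed.

Lemma pts_enc n (x : 'I_n -> T) : pts (enc x) = range x.
Proof.
elim: n x => [|n IH] x /=.
  by apply/seteqP; split=> y // [[]].
rewrite IH; apply/seteqP; split=> y.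
  by move=> [[i _ <-]|->]; [exists (lift ord_max i)|exists ord_max].
move=> [i _ <-]; case: (unliftP ord_max i) => [j ->|->]; last by right.
by left; exists j.
Qed.

Lemma conf_enc (M : set T) n (x : 'I_n -> T) : conf M (enc x) <-> conf_space T M n x.
Proof.
elim: n x => [|n IH] x.
  by split=> // _; split; [case|move=> []].
rewrite /= /total /=; split.
- move=> [/IH [Mx ix] [Mo no]]; split.
    by move=> i; case: (unliftP ord_max i) => [j ->|->] //; exact: Mx.
  move=> i j; case: (unliftP ord_max i) => [i' ->|->]; case: (unliftP ord_max j) => [j' ->|->] // E.
  + by congr lift; apply: ix.
  + by exfalso; apply: no; rewrite pts_enc; exists i'.
  + by exfalso; apply: no; rewrite pts_enc; exists j'.
- move=> [Mx ix]; split.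
    apply/IH; split=> [i|i j /ix]; [exact: Mx|exact: lift_inj].
  split; first exact: Mx.
  rewrite pts_enc => -[i _ /ix h].
  by have := neq_lift ord_max i; rewrite h eqxx.
Qed.

Lemma decK (M : set T) n (z : confT T n) : conf M z -> enc (dec z) = z.
Proof.
elim: n z => [|n IH] z /=; first by move=> ->.
case: z => z t [/= hz _]; rewrite unlift_none; congr pair.
by under eq_fun do rewrite liftK; exact: IH.
Qed.
End Encode.

Section Link.
Variables (R : realType) (T : topologicalType) (M : set T) (n : nat) (x0 : 'I_n -> T).
Hypothesis hx0 : conf_space T M n x0.

Lemma I01E (s : R) : @I01 R s <-> 0 <= s <= 1.
Proof. by rewrite /I01 /= in_itv. Qed.

Lemma within_clamp (f : R -> T) : {within @I01 R, continuous f} -> continuous (fun s => f (cl s)).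
Proof.
move=> cf s U nU.
have Is : @I01 R (cl s) by apply/I01E; exact: cl01.
have h : within (@I01 R) (nbhs (cl s)) (f @^-1` U).
  by rewrite nbhs_subspace_in //; exact: (cf (cl s) U nU).
have : nbhs s (@cl R @^-1` [set x | @I01 R x -> U (f x)]) by exact: ct_cl.
by apply: filterS => y /=; apply; apply/I01E; exact: cl01.
Qed.

Lemma within_clamp2 (f : R * R -> T) : {within @square01 R, continuous f} ->
  continuous (fun p => f (cl p.1, cl p.2)).
Proof.
move=> cf s U nU.
have Sq (p : R * R) : @square01 R (cl p.1, cl p.2) by split; apply/I01E; exact: cl01.
have h : within (@square01 R) (nbhs (cl s.1, cl s.2)) (f @^-1` U).
  by rewrite nbhs_subspace_in; [exact: (cf (cl s.1, cl s.2) U nU)|exact: Sq].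
have cc : continuous (fun p : R * R => (cl p.1, cl p.2)) by have := @ct_cl R => ?; cont.
have : nbhs s ((fun p : R * R => (cl p.1, cl p.2)) @^-1` [set x | @square01 R x -> U (f x)]) by exact: cc.
by apply: filterS => y /=; apply; exact: Sq.
Qed.

Lemma continuous_within (A : set R) (f g : R -> T) : continuous g -> (forall s, A s -> f s = g s) ->
  {within A, continuous f}.
Proof.
move=> cg E; refine (@subspace_eq_continuous _ A _ g f _ _).
  by move=> s; rewrite inE => /E ->.
exact: continuous_subspaceT.
Qed.

Definition encl (c : 'I_n -> R -> T) : R -> confT T n := fun s => enc (fun i => c i (cl s)).

Lemma is_loop_pth c : is_loop M x0 c -> pth (conf M (n := n)) (enc x0) (enc x0) (encl c).
Proof.
move=> [cc Mc c01]; rewrite /encl; split.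
- by apply: ct_enc => i; exact: within_clamp.
- by move=> s; apply/conf_enc; apply: Mc; apply/I01E; exact: cl01.
- by congr enc; apply/funext => i; rewrite cl0; have [] := c01 i.
- by congr enc; apply/funext => i; rewrite cl1; have [] := c01 i.
Qed.

Lemma pth_is_loop (c : R -> confT T n) : pth (conf M (n := n)) (enc x0) (enc x0) c -> is_loop M x0 (fun i s => dec (c s) i).
Proof.
move=> [cc Mc c0 c1]; split.
- by move=> i; apply: continuous_subspaceT; exact: ct_dec.
- by move=> s _; apply/conf_enc; have := Mc s; rewrite -{1}(decK (Mc s)).
- by move=> i; rewrite c0 c1 encK.
Qed.

Lemma loop_hty c d : is_loop M x0 c -> is_loop M x0 d ->
  loop_homotopic M x0 c d <-> hty (conf M (n := n)) (encl c) (encl d).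
Proof.
move=> [cc Mc c01] [cd Md d01]; split.
- move=> [H [cH MH Hcd Hx]].
  apply: (@hty_intro _ _ _ _ _ (fun p => enc (fun i => H i (cl p.1, cl p.2)))).
  + by apply: ct_enc => i; exact: within_clamp2.
  + by move=> s t _ _; apply/conf_enc; apply: MH; apply/I01E; exact: cl01.
  + move=> s s01; rewrite /encl /= cl0 cl1; split; congr enc; apply/funext => i.
      by have [-> _] := Hcd i (cl s) ((I01E _).2 (cl01 s)).
    by have [_ ->] := Hcd i (cl s) ((I01E _).2 (cl01 s)).
  + move=> t _; rewrite /encl /= cl0 cl1; split; congr enc; apply/funext => i.
      by have [-> _] := Hx i (cl t) ((I01E _).2 (cl01 t)); have [-> _] := c01 i.
    by have [_ ->] := Hx i (cl t) ((I01E _).2 (cl01 t)); have [_ ->] := c01 i.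
- move=> [K [cK MK Kcd Ke]]; exists (fun i p => dec (K p) i); split.
  + by move=> i; apply: continuous_subspaceT; exact: ct_dec.
  + by move=> s t _ _; apply/conf_enc; have := MK (s, t); rewrite -{1}(decK (MK (s, t))).
  + move=> i s /I01E s01; have [-> ->] := Kcd s.
    by rewrite /encl !encK !clE // clE.
  + move=> i t _; have [-> ->] := Ke t; rewrite /encl !encK cl0 cl1.
    by have [-> ->] := c01 i.
Qed.

Notation PB := (@pure_braid_group R T M n x0).

Lemma pb_rep_loop (C : PB) : is_loop M x0 (pb_rep C).
Proof. by rewrite /pb_rep; case: cid => c []. Qed.

Lemma pb_repE (C : PB) : proj1_sig C = loop_class M x0 (pb_rep C).
Proof. by rewrite /pb_rep; case: cid => c []. Qed.

Lemma loop_classE c d : is_loop M x0 c -> is_loop M x0 d ->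
  loop_class M x0 c = loop_class M x0 d <-> hty (conf M (n := n)) (encl c) (encl d).
Proof.
move=> lc ld; split.
  move=> E; apply/(loop_hty lc ld).
  have : loop_class M x0 d d.
    by split=> //; apply/(loop_hty ld ld); have [? ? _ _] := is_loop_pth ld; exact: hty_refl.
  by rewrite -E => -[].
move=> h; apply/seteqP; split=> e [le he]; split=> //; apply/(loop_hty _ le) => //.
  by move/(loop_hty lc le): he; apply: hty_trans; exact: hty_sym.
by move/(loop_hty ld le): he; exact: hty_trans.
Qed.

(** With [toP_inj], [toP_surj], [toP_mul] and [toP_inv] this is an isomorphism onto the loop group
    of the nested configuration space, where the fibrations live. *)
Definition toP (C : PB) : P R (conf M (n := n)) (enc x0) (enc x0) := pcl (is_loop_pth (pb_rep_loop C)).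

Lemma toP_inj : injective toP.
Proof.
move=> C D /pcl_hty h.
have : proj1_sig C = proj1_sig D.
  by rewrite !pb_repE; apply/loop_classE => //; exact: pb_rep_loop.
by case: C D {h} => S hS [S' hS'] /= E; exact: eq_exist.
Qed.

Lemma pb_of_setE (dflt : PB) c (lc : is_loop M x0 c) :
  hty (conf M (n := n)) (encl (pb_rep (pb_of_set dflt (loop_class M x0 c)))) (encl c).
Proof.
apply/loop_classE => //; first exact: pb_rep_loop.
rewrite -pb_repE /pb_of_set; case: pselect => // h; exfalso; apply: h.
by exists c.
Qed.

Lemma toP_class (dflt : PB) c (lc : is_loop M x0 c) : toP (pb_of_set dflt (loop_class M x0 c)) = pcl (is_loop_pth lc).
Proof. by apply: pclE; exact: pb_of_setE. Qed.

Lemma toP_surj (a : P R (conf M (n := n)) (enc x0) (enc x0)) : exists C, toP C = a.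
Proof.
have [c [hc ->]] := pclP a; have lc := pth_is_loop hc.
have h : exists c' : 'I_n -> R -> T, is_loop M x0 c' /\ loop_class M x0 (fun i s => dec (c s) i) = loop_class M x0 c' by exists (fun i s => dec (c s) i).
pose C : PB := exist _ (loop_class M x0 (fun i s => dec (c s) i)) h.
exists (pb_of_set C (loop_class M x0 (fun i s => dec (c s) i))); rewrite toP_class.
have [cc Mc _ _] := hc; apply/esym/pclE; apply: hty_eq => // s s01.
by rewrite /encl clE // (decK (Mc s)).
Qed.

Lemma loop_concat_loop (c d : 'I_n -> R -> T) : is_loop M x0 c -> is_loop M x0 d -> is_loop M x0 (loop_concat c d).
Proof.
move=> [cc Mc c01] [cd Md d01]; split.
- move=> i; apply: (@continuous_within _ _ (concat (fun s => c i (cl s)) (fun s => d i (cl s)))).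
    apply: ct_concat; [exact: within_clamp|exact: within_clamp|].
    by rewrite cl0 cl1; have [_ ->] := c01 i; have [-> _] := d01 i.
  move=> s /I01E /andP[s0 s1]; rewrite /loop_concat /concat /=; case: ifP => h.
    by rewrite clE //; apply/andP; split; lra.
  have {}h : 2^-1 < s by rewrite ltNge h.
  by rewrite clE //; apply/andP; split; lra.
- move=> s /I01E /andP[s0 s1]; rewrite /loop_concat /=; case: (boolP (s <= 2^-1)) => h.
    by apply: Mc; apply/I01E/andP; split; lra.
  have {}h : 2^-1 < s by rewrite ltNge.
  by apply: Md; apply/I01E/andP; split; lra.
- move=> i; have [c0 c1] := c01 i; have [d0 d1] := d01 i.
  split; rewrite -[loop_concat c d i _]/(concat (c i) (d i) _); [by rewrite concat0|by rewrite concat1].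
Qed.

Lemma loop_rev_loop (c : 'I_n -> R -> T) : is_loop M x0 c -> is_loop M x0 (loop_rev c).
Proof.
move=> [cc Mc c01]; split.
- move=> i; apply: (@continuous_within _ _ (fun s => c i (cl (1 - s)))).
    have h := within_clamp (cc i); apply: (@ct_comp _ _ _ (fun s : R => 1 - s) _ _ h); cont.
  move=> s /I01E /andP[s0 s1]; rewrite /loop_rev clE //; apply/andP; split; lra.
- move=> s /I01E /andP[s0 s1]; apply: Mc; apply/I01E/andP; split; lra.
- by move=> i; rewrite /loop_rev subr0 subrr; have [-> ->] := c01 i.
Qed.

Lemma toP_mul C D : toP (@pb_mul R T M n x0 C D) = pmul (toP C) (toP D).
Proof.
have lc := pb_rep_loop C; have ld := pb_rep_loop D.
rewrite /pb_mul (toP_class _ (loop_concat_loop lc ld)) pmulE; apply: pclE.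
have [? ? _ _] := is_loop_pth (loop_concat_loop lc ld).
apply: hty_eq => // s /andP[s0 s1]; rewrite /encl /concat clE ?s0 //.
rewrite /loop_concat /=; case: (boolP (s <= 2^-1)) => h; congr enc; apply/funext => i; rewrite clE //.
  by apply/andP; split; lra.
have {}h : 2^-1 < s by rewrite ltNge.
by apply/andP; split; lra.
Qed.

Lemma toP_inv C : toP (@pb_inv R T M n x0 C) = pinv (toP C).
Proof.
have lc := pb_rep_loop C.
rewrite /pb_inv (toP_class _ (loop_rev_loop lc)) pinvE; apply: pclE.
have [? ? _ _] := is_loop_pth (loop_rev_loop lc).
apply: hty_eq => // s /andP[s0 s1]; rewrite /encl /revp clE ?s0 //.
rewrite /loop_rev; congr enc; apply/funext => i; rewrite clE //.
by apply/andP; split; lra.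
Qed.
End Link.

(** * The closed surface of genus g *)

Lemma for_pair (Z Y Y' : topologicalType) (f : Z -> Y) (g : Z -> Y') (z : Z) :
  {for z, continuous f} -> {for z, continuous g} -> {for z, continuous (fun z => (f z, g z))}.
Proof. by move=> cf cg; exact: (cvg_pair cf cg). Qed.

Section Euclid.
Variable R : realType.
(** The Euclidean norm, in which the boundary circles are round; the norm of the product type is the
    maximum norm and is used for charts. *)
Definition en (a b : R) := Num.sqrt (a ^+ 2 + b ^+ 2).
Lemma en_ge0 a b : 0 <= en a b. Proof. exact: sqrtr_ge0. Qed.
Lemma en_sqr a b : en a b ^+ 2 = a ^+ 2 + b ^+ 2.
Proof. by rewrite sqr_sqrtr // addr_ge0 // sqr_ge0. Qed.
Lemma en_le a b c : 0 <= c -> (en a b <= c) = (a ^+ 2 + b ^+ 2 <= c ^+ 2).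
Proof. by move=> c0; rewrite -en_sqr ler_sqr ?nnegrE // en_ge0. Qed.
Lemma en_ge a b c : 0 <= c -> (c <= en a b) = (c ^+ 2 <= a ^+ 2 + b ^+ 2).
Proof. by move=> c0; rewrite -en_sqr ler_sqr ?nnegrE // en_ge0. Qed.
Lemma enZ k a b : en (k * a) (k * b) = `|k| * en a b.
Proof. by rewrite /en !exprMn -mulrDr sqrtrM ?sqr_ge0 // sqrtr_sqr. Qed.
Lemma en_x0 a : en a 0 = `|a|. Proof. by rewrite /en expr0n addr0 sqrtr_sqr. Qed.
Lemma en_0x a : en 0 a = `|a|. Proof. by rewrite /en expr0n add0r sqrtr_sqr. Qed.
Lemma en_ge1 a b : `|a| <= en a b.
Proof. by rewrite en_ge // -normrX ger0_norm ?sqr_ge0 // lerDl sqr_ge0. Qed.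
Lemma en_ge2 a b : `|b| <= en a b.
Proof. by rewrite en_ge // -normrX ger0_norm ?sqr_ge0 // lerDr sqr_ge0. Qed.
(** Through the Cauchy-Schwarz inequality, which is read off Lagrange's identity. *)
Lemma en_triangle a b c d : en (a + c) (b + d) <= en a b + en c d.
Proof.
have h1 := en_ge0 a b; have h2 := en_ge0 c d.
have s1 := en_sqr a b; have s2 := en_sqr c d.
rewrite en_le ?addr_ge0 //; set A := en a b in h1 s1 *; set B := en c d in h2 s2 *.
suff h : a * c + b * d <= A * B.
  have -> : (a + c) ^+ 2 + (b + d) ^+ 2 = (a ^+ 2 + b ^+ 2) + (c ^+ 2 + d ^+ 2) + 2 * (a * c + b * d) by ring.
  have -> : (A + B) ^+ 2 = A ^+ 2 + B ^+ 2 + 2 * (A * B) by ring.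
  by rewrite s1 s2 lerD2l ler_pM2l.
have [neg|pos] := lerP (a * c + b * d) 0; first by rewrite (le_trans neg) // mulr_ge0.
rewrite -ler_sqr ?nnegrE ?mulr_ge0 ?(ltW pos) // exprMn s1 s2.
have -> : (a ^+ 2 + b ^+ 2) * (c ^+ 2 + d ^+ 2) = (a * c + b * d) ^+ 2 + (a * d - b * c) ^+ 2 by ring.
by rewrite lerDl sqr_ge0.
Qed.
Lemma en_le_sum a b : en a b <= `|a| + `|b|.
Proof. by have := en_triangle a 0 0 b; rewrite addr0 add0r en_x0 en_0x. Qed.
Lemma en_diff a b c d : `|en a b - en c d| <= en (a - c) (b - d).
Proof.
have h1 := en_triangle (a - c) (b - d) c d; rewrite !subrK in h1.
have h2 := en_triangle (c - a) (d - b) a b; rewrite !subrK in h2.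
have e : en (c - a) (d - b) = en (a - c) (b - d).
  by rewrite /en -(opprB a) -(opprB b) !sqrrN.
by rewrite ler_norml; apply/andP; split; lra.
Qed.
End Euclid.

Section ClosedSurface.
Variables (R : realType) (g : nat).
Notation plane := (R * R)%type.
Notation T := (R * R * R)%type.
Let rho : R := 3 * g%:R + 3.
Notation phi := (@surf_phi R g).
Notation M := (@closed_surface R g).

Lemma le_phi t x y : t <= phi x y <->
  t <= rho - en x y /\ forall k, (1 <= k <= g)%N -> t <= en (x - 3 * k%:R) y - 1.
Proof.
rewrite /surf_phi -/rho -/(en x y).
have h (s : seq nat) : t <= foldr (fun k acc => Num.min acc (en (x - 3 * k%:R) y - 1)) (rho - en x y) s <->
   t <= rho - en x y /\ forall k, k \in s -> t <= en (x - 3 * k%:R) y - 1.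
  elim: s => [|a s IH] /=; first by split=> [|[]].
  rewrite le_min; split.
    by move=> /andP[/IH[h1 h2] h3]; split=> // k; rewrite inE => /orP[/eqP->|/h2].
  move=> [h1 h2]; apply/andP; split; last by apply: h2; rewrite mem_head.
  by apply/IH; split=> // k ks; apply: h2; rewrite inE ks orbT.
rewrite h; split=> -[h1 h2]; split=> // k.
  by move=> hk; apply: h2; rewrite mem_iota add1n ltnS.
by rewrite mem_iota add1n ltnS; exact: h2.
Qed.

Lemma phi_le1 x y : phi x y <= rho - en x y. Proof. by have [/(_ (lexx _))[]] := le_phi (phi x y) x y. Qed.
Lemma phi_le2 x y k : (1 <= k <= g)%N -> phi x y <= en (x - 3 * k%:R) y - 1.
Proof. by move=> kg; have [/(_ (lexx _))[_ h] _] := le_phi (phi x y) x y; exact: h. Qed.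

Lemma phi_attained x y : phi x y = rho - en x y \/
  exists2 k, (1 <= k <= g)%N & phi x y = en (x - 3 * k%:R) y - 1.
Proof.
rewrite /surf_phi -/rho -/(en x y).
suff [->|[k]] : let v := foldr (fun k acc => Num.min acc (en (x - 3 * k%:R) y - 1)) (rho - en x y) (iota 1 g) in
   v = rho - en x y \/ exists2 k, k \in iota 1 g & v = en (x - 3 * k%:R) y - 1.
- by left.
- by rewrite mem_iota add1n ltnS => hk ->; right; exists k.
elim: (iota 1 g) => [|a s IH] /=; first by left.
rewrite /Num.min; case: ifP => _; last by right; exists a; rewrite ?mem_head.
case: IH => [->|[k ks ->]]; first by left.
by right; exists k; rewrite ?inE ?ks ?orbT.
Qed.

Lemma ct_en (Z : topologicalType) (a b : Z -> R) : continuous a -> continuous b -> continuous (fun z => en (a z) (b z)).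
Proof. by move=> ca cb; rewrite /en; cont. Qed.

Lemma phi_continuous : continuous (fun p : plane => phi p.1 p.2).
Proof.
rewrite /surf_phi; elim: (iota 1 g) => [|k s IH] /=.
  by apply: ctD; [exact: ct_cst|apply: ctN; apply: ct_en; cont].
apply: ct_min; first exact: IH.
by apply: ctD; [apply: ct_en; cont|exact: ct_cst].
Qed.

Lemma ct_phi (Z : topologicalType) (a b : Z -> R) : continuous a -> continuous b -> continuous (fun z => phi (a z) (b z)).
Proof. by move=> ca cb; apply: (@ct_comp _ _ _ (fun z => (a z, b z)) _ _ phi_continuous); cont. Qed.

(** Near a boundary circle [surf_phi] is the signed distance to it, with s = -1 for the outer circle
    and s = 1 for a hole; elsewhere near that circle no other boundary competes. *)
Definition circle_model (cx r0 s : R) := [/\ 1 <= r0, s ^+ 2 = 1 &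
  forall x y, `|en (x - cx) y - r0| < 2^-1 -> phi x y = s * (en (x - cx) y - r0)].

Lemma natr_le_g k : (1 <= k <= g)%N -> 1 <= k%:R :> R /\ k%:R <= g%:R :> R.
Proof. by move=> /andP[? ?]; rewrite !ler_nat ?ler1n. Qed.

Lemma outer_circle : circle_model 0 rho (-1).
Proof.
have g0 : 0 <= g%:R :> R by [].
split; rewrite ?sqrrN ?expr1n //; first by rewrite /rho; lra.
move=> x y; rewrite subr0 ltr_norml mulN1r opprB => /andP[h1 h2].
apply/le_anti; rewrite phi_le1 /=; apply/le_phi; split=> // k /natr_le_g [k1 kg].
have := en_triangle (x - 3 * k%:R) y (3 * k%:R) 0.
rewrite subrK addr0 en_x0 ger0_norm ?mulr_ge0 //.
rewrite /rho in h1 h2 *; lra.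
Qed.

Lemma hole_circle k : (1 <= k <= g)%N -> circle_model (3 * k%:R) 1 1.
Proof.
move=> kg; have [k1 k2] := natr_le_g kg; split; rewrite ?expr1n //.
move=> x y; rewrite ltr_norml mul1r => /andP[h1 h2].
apply/le_anti; rewrite phi_le2 //=; apply/le_phi; split.
  have := en_triangle (x - 3 * k%:R) y (3 * k%:R) 0.
  rewrite subrK addr0 en_x0 ger0_norm ?mulr_ge0 //.
  rewrite /rho; lra.
move=> j jg; have [->|jk] := eqVneq j k; first by [].
have h3 : 3 <= `|3 * k%:R - 3 * j%:R| :> R.
  rewrite -mulrBr normrM ger0_norm // ler_peMr //.
  case: (ltngtP j k) => h; last by rewrite h eqxx in jk.
    by rewrite -natrB ?(ltnW h) // ger0_norm // ler1n subn_gt0.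
  by rewrite distrC -natrB ?(ltnW h) // ger0_norm // ler1n subn_gt0.
have h4 := en_triangle (x - 3 * j%:R) y (- (x - 3 * k%:R)) (- y).
have e1 : x - 3 * j%:R + - (x - 3 * k%:R) = 3 * k%:R - 3 * j%:R by ring.
rewrite e1 subrr en_x0 in h4.
have e2 : en (- (x - 3 * k%:R)) (- y) = en (x - 3 * k%:R) y by rewrite /en !sqrrN.
rewrite e2 in h4; lra.
Qed.

Lemma circle_of x y : phi x y = 0 -> exists cx r0 s, circle_model cx r0 s /\ en (x - cx) y = r0.
Proof.
move=> p0; case: (phi_attained x y) => [|[k kg]]; rewrite p0 => h.
  by exists 0, rho, (-1); split; [exact: outer_circle|rewrite subr0; lra].
by exists (3 * k%:R), 1, 1; split; [exact: hole_circle|lra].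
Qed.

Lemma norm_plane_lt (w : plane) (r : R) : `|w| < r -> `|w.1| < r /\ `|w.2| < r.
Proof. by rewrite prod_normE gt_max => /andP. Qed.

(** Along a boundary circle two sheets meet, and the radius does not distinguish them. The signed
    height does: the chart keeps the angle and uses r0 plus the height as radial coordinate. *)
Lemma circle_chart cx r0 s x y : circle_model cx r0 s -> en (x - cx) y = r0 ->
  exists e f O, @chart R T M (x, y, 0) e f O.
Proof.
move=> [r01 s1 hphi] exy.
pose e (w : plane) : T :=
  let rw := en (w.1 - cx) w.2 in let k := (r0 + s * `|rw - r0|) / rw in
  (cx + k * (w.1 - cx), k * w.2, rw - r0).
pose f (q : T) : plane :=
  let k := (r0 + q.2) / en (q.1.1 - cx) q.1.2 in (cx + k * (q.1.1 - cx), k * q.1.2).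
pose O : set T := [set q : T | `|q.2| < 2^-1 /\ `|en (q.1.1 - cx) q.1.2 - r0| < 2^-1].
have ss : `|s| = 1 by apply/eqP; rewrite -(@eqrXn2 _ 2) // -normrX s1 normr1 expr1n.
have rng (a : R) : `|a - r0| < 2^-1 -> 0 < a by rewrite ltr_norml => /andP[? ?]; lra.
have rngs (a : R) : `|a| < 2^-1 -> `|r0 + s * `|a| - r0| < 2^-1 by move=> h; rewrite addrAC subrr add0r normrM ss mul1r normr_id.
have near_w (w : plane) : `|w - (x, y)| < 4^-1 -> `|en (w.1 - cx) w.2 - r0| < 2^-1.
  move=> /norm_plane_lt [/= h1 h2].
  have := en_diff (w.1 - cx) w.2 (x - cx) y; rewrite exy opprB addrA subrK => h3.
  have := en_le_sum (w.1 - x) (w.2 - y); lra.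
have e_xy : e (x, y) = (x, y, 0).
  rewrite /e /= exy subrr normr0 mulr0 addr0 divff ?mul1r; last by rewrite gt_eqF //; lra.
  by rewrite addrC subrK.
have q4 : 0 < 4^-1 :> R by rewrite invr_gt0.
have cen : continuous (fun q : T => en (q.1.1 - cx) q.1.2) by apply: ct_en; cont.
have cen2 : continuous (fun q : plane => en (q.1 - cx) q.2) by apply: ct_en; cont.
have oO : open O.
  have c1 : continuous (fun q : T => `|q.2|) by cont.
  have c2 : continuous (fun q : T => `|en (q.1.1 - cx) q.1.2 - r0|).
    by apply: ct_norm; apply: ctD; [exact: cen|exact: ct_cst].
  apply: openI.
    by apply: (@open_comp _ _ (fun q : T => `|q.2|) [set z | z < 2^-1]) => [q _|]; [exact: c1|exact: open_lt].
  apply: (@open_comp _ _ (fun q : T => `|en (q.1.1 - cx) q.1.2 - r0|) [set z | z < 2^-1]) => [q _|]; last exact: open_lt.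
  exact: c2.
have he (w : plane) : `|w - (x, y)| < 4^-1 -> [/\ {for w, continuous e}, M (e w), O (e w) & f (e w) = w].
  move=> /near_w hw; have rw0 := rng _ hw; set rw := en (w.1 - cx) w.2 in hw rw0.
  have zr : `|rw - r0| < 2^-1 by [].
  have r'0 := rng _ (rngs _ zr); set r' := r0 + s * `|rw - r0| in r'0.
  have er' : en ((e w).1.1 - cx) (e w).1.2 = r'.
    rewrite /e /= -/rw -/r' addrAC subrr add0r enZ -/rw ger0_norm ?divr_ge0 ?ltW // divfK // gt_eqF //.
  split.
  - have ck : {for w, continuous (fun w : plane => (r0 + s * `|en (w.1 - cx) w.2 - r0|) / en (w.1 - cx) w.2)}.
      apply: cvgM.
        have c : continuous (fun w : plane => r0 + s * `|en (w.1 - cx) w.2 - r0|).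
          apply: ctD; first exact: ct_cst; apply: ctM; first exact: ct_cst.
          by apply: ct_norm; apply: ctD; [exact: cen2|exact: ct_cst].
        exact: c.
      by apply: cvgV; [rewrite gt_eqF|exact: cen2].
    have c1 : continuous (fun w : plane => w.1 - cx) by cont.
    have c2 : continuous (fun w : plane => w.2) by cont.
    apply: (for_pair (for_pair _ _) _).
    + by apply: cvgD; [exact: cvg_cst|apply: cvgM; [exact: ck|exact: c1]].
    + by apply: cvgM; [exact: ck|exact: c2].
    + by apply: cvgD; [exact: cen2|exact: cvg_cst].
  - have hp : phi (e w).1.1 (e w).1.2 = `|rw - r0|.
      rewrite hphi er'; last exact: rngs.
      by rewrite /r' addrAC subrr add0r mulrA -expr2 s1 mul1r.
    by rewrite /closed_surface /= hp normr_ge0.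
  - by split; [exact: zr|rewrite er'; exact: rngs].
  - rewrite /f er' /e /= -/rw -/r' addrAC subrr add0r subrKC.
    have k1 : rw / r' * (r' / rw) = 1 by field; rewrite !gt_eqF.
    have k2 t : rw / r' * (r' / rw * t) = t by rewrite mulrA k1 mul1r.
    rewrite !k2 subrKC; by case: (w).
have ef q : O q -> M q -> e (f q) = q.
  case: q => [[a b] z] [/= hz hr] [/= ph0 hz2]; have r1 := rng _ hr.
  set r := en (a - cx) b in hr r1.
  have rz : r = r0 + s * `|z|.
    by rewrite hz2 hphi // mulrA -expr2 s1 mul1r subrKC.
  have z0 : 0 < r0 + z by move: hz; rewrite ltr_norml => /andP[? ?]; lra.
  have rw : en ((f (a, b, z)).1 - cx) (f (a, b, z)).2 = r0 + z.
    by rewrite /f /= addrAC subrr add0r enZ -/r ger0_norm ?divr_ge0 ?ltW // divfK // gt_eqF.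
  have zz : r0 + z - r0 = z by ring.
  have f1 : (f (a, b, z)).1 - cx = (r0 + z) / r * (a - cx) by rewrite /f /= -/r; ring.
  have f2 : (f (a, b, z)).2 = (r0 + z) / r * b by [].
  have k1 : r / (r0 + z) * ((r0 + z) / r) = 1 by field; rewrite !gt_eqF.
  have k2 t : r / (r0 + z) * ((r0 + z) / r * t) = t by rewrite mulrA k1 mul1r.
  by rewrite /e rw zz f1 f2 -rz !k2 subrKC.
have cf q : O q -> {for q, continuous f}.
  move=> [_ hr]; have r1 := rng _ hr.
  have ck : {for q, continuous (fun q : T => (r0 + q.2) / en (q.1.1 - cx) q.1.2)}.
    apply: cvgM; first by have c : continuous (fun q : T => r0 + q.2) by [cont]; exact: c.
    by apply: cvgV; [rewrite gt_eqF|exact: cen].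
  have c1 : continuous (fun q : T => q.1.1 - cx) by cont.
  have c2 : continuous (fun q : T => q.1.2) by cont.
  apply: for_pair.
    by apply: cvgD; [exact: cvg_cst|apply: cvgM; [exact: ck|exact: c1]].
  by apply: cvgM; [exact: ck|exact: c2].
have [e' [f' [O' [ch _]]]] := local_chart q4 he oO ef cf.
by rewrite e_xy in ch; exists e', f', O'.
Qed.

Lemma graph_chart x y s : s ^+ 2 = 1 -> 0 < phi x y -> exists e f O, @chart R T M (x, y, s * phi x y) e f O.
Proof.
move=> s1 p0.
have ss : `|s| = 1 by apply/eqP; rewrite -(@eqrXn2 _ 2) // -normrX s1 normr1 expr1n.
have cphi := phi_continuous.
have : nbhs (x, y) (fun p : plane => 0 < phi p.1 p.2) by exact: (cphi (x, y) _ (lt_nbhsr p0)).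
move=> /nbhs_ballP[r /= r0 hr].
pose e (w : plane) : T := (w.1, w.2, s * phi w.1 w.2).
pose f (q : T) : plane := q.1.
pose O : set T := [set q : T | 0 < s * q.2].
have ce : continuous e by rewrite /e; have c := ct_phi; cont; apply: c; cont.
have oO : open O.
  have c : continuous (fun q : T => s * q.2) by cont.
  by apply: (@open_comp _ _ (fun q : T => s * q.2) [set z | 0 < z]) => [q _|]; [exact: c|exact: open_gt].
have he (w : plane) : `|w - (x, y)| < r -> [/\ {for w, continuous e}, M (e w), O (e w) & f (e w) = w].
  move=> h; have pw : 0 < phi w.1 w.2 by apply: hr; rewrite -ball_normE /= distrC.
  split; first exact: ce.
  - by split; rewrite /= ?ltW // normrM ss mul1r ger0_norm // ltW.
  - by rewrite /O /e /= mulrA -expr2 s1 mul1r.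
  - by rewrite /f /e /=; case: (w).
have ef q : O q -> M q -> e (f q) = q.
  case: q => [[a b] z]; rewrite /O /= => sz [/= h1 h2]; rewrite /e /f /= -h2; congr pair.
  have -> : `|z| = s * z by rewrite -[`|z|]mul1r -ss -normrM gtr0_norm.
  by rewrite mulrA -expr2 s1 mul1r.
have cf q : O q -> {for q, continuous f} by move=> _; have c : continuous f by [rewrite /f; cont]; exact: c.
have [e' [f' [O' [ch _]]]] := local_chart r0 he oO ef cf.
by exists e', f', O'.
Qed.

Lemma closed_surface_surface : @surface R T M.
Proof.
move=> [[x y] z] [/= p0 hz]; have [pz|pnz] := eqVneq (phi x y) 0.
  have -> : z = 0 by move: hz; rewrite pz => /eqP; rewrite normr_eq0 => /eqP.
  have [cx [r0 [s [cm exy]]]] := circle_of pz; exact: circle_chart cm exy.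
have pp : 0 < phi x y by rewrite lt_def pnz.
have [zp|zn] := lerP 0 z.
  have -> : z = 1 * phi x y by rewrite mul1r -hz ger0_norm.
  by apply: graph_chart; rewrite ?expr1n.
have -> : z = -1 * phi x y by rewrite mulN1r -hz ltr0_norm // opprK.
by apply: graph_chart; rewrite ?sqrrN ?expr1n.
Qed.

Lemma closed_surface_compact : compact M.
Proof.
have cphi : continuous (fun q : T => phi q.1.1 q.1.2) by apply: ct_phi; cont.
have cl1 : closed [set q : T | 0 <= phi q.1.1 q.1.2].
  by apply: (@preimage_closed _ _ (fun q : T => phi q.1.1 q.1.2) [set z | 0 <= z]) => [q _|]; [exact: cphi|exact: closed_ge].
have cl2 : closed [set q : T | `|q.2| - phi q.1.1 q.1.2 = 0].
  have c : continuous (fun q : T => `|q.2| - phi q.1.1 q.1.2) by cont.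
  by apply: (@preimage_closed _ _ (fun q : T => `|q.2| - phi q.1.1 q.1.2) [set z | z = 0]) => [q _|]; [exact: c|exact: closed_eq].
have clM : closed M.
  have -> : M = [set q : T | 0 <= phi q.1.1 q.1.2] `&` [set q : T | `|q.2| - phi q.1.1 q.1.2 = 0].
    apply/seteqP; split=> q [h1 h2]; split => //=.
      by rewrite h2 subrr.
    by apply/eqP; rewrite -subr_eq0; apply/eqP.
  exact: closedI.
apply: (subclosed_compact clM (B := (`[- rho, rho]%classic `*` `[- rho, rho]%classic) `*` `[- rho, rho]%classic)).
  by apply: compact_setX; [apply: compact_setX|]; exact: segment_compact.
move=> [[x y] z] [/= h1 h2].
have h3 := phi_le1 x y; have h4 := en_ge1 x y; have h5 := en_ge2 x y; have h6 := en_ge0 x y.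
by split; [split|]; rewrite /= in_itv /= -ler_norml; lra.
Qed.

(** Moving away from the axis y = 0 at fixed x only increases the distance to the centres of the
    holes, so every point reaches the outer circle without meeting a hole, and then follows that
    circle. *)
Lemma closed_surface_pconn : @pconn R T M.
Proof.
have r0 : 0 < rho by rewrite /rho; have : 0 <= g%:R :> R by []; lra.
have sqr x t : x ^+ 2 <= rho ^+ 2 -> t ^+ 2 = 1 -> en x (t * Num.sqrt (rho ^+ 2 - x ^+ 2)) = rho.
  move=> h t1; rewrite /en exprMn t1 mul1r sqr_sqrtr ?subr_ge0 // subrKC sqrtr_sqr ger0_norm ?(ltW r0) //.
have outer x y : en x y = rho -> phi x y = 0.
  have [_ _ h] := outer_circle; move=> e; rewrite h subr0 e subrr ?mulr0 // normr0 invr_gt0.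
  by [].
have key q : M q -> exists c, @pth R T M q (rho, 0, 0) c.
  case: q => [[x y] z] [/= p0 hz].
  have := phi_le1 x y => hen.
  have enr : en x y <= rho by lra.
  have xr : x ^+ 2 <= rho ^+ 2.
    by rewrite -[x ^+ 2]ger0_norm ?sqr_ge0 // normrX ler_sqr ?nnegrE ?(ltW r0) // (le_trans (en_ge1 x y)).
  have [t [t1 yt]] : exists t : R, t ^+ 2 = 1 /\ y = t * `|y|.
    have [h|h] := lerP 0 y; [exists 1; rewrite expr1n mul1r ger0_norm //|exists (-1)].
    by rewrite sqrrN expr1n mulN1r ltr0_norm // opprK.
  have [s [s1 zs]] : exists s : R, s ^+ 2 = 1 /\ z = s * `|z|.
    have [h|h] := lerP 0 z; [exists 1; rewrite expr1n mul1r ger0_norm //|exists (-1)].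
    by rewrite sqrrN expr1n mulN1r ltr0_norm // opprK.
  have ss : `|s| = 1 by apply/eqP; rewrite -(@eqrXn2 _ 2) // -normrX s1 normr1 expr1n.
  pose Y := Num.sqrt (rho ^+ 2 - x ^+ 2).
  have yY : `|y| <= Y.
    rewrite -ler_sqr ?nnegrE ?sqrtr_ge0 // sqr_sqrtr ?subr_ge0 //.
    by move: enr; rewrite en_le ?(ltW r0) // -normrX ger0_norm ?sqr_ge0 //; lra.
  have ccl := @ct_cl R.
  pose y1 (u : R) := `|y| + cl u * (Y - `|y|).
  have cy1 : continuous y1 by rewrite /y1; cont.
  have y1b u : `|y| <= y1 u <= Y.
    have /andP[u0 u1] := cl01 u; rewrite /y1 lerDl mulr_ge0 ?subr_ge0 //=.
    by rewrite -lerBrDl ler_piMl // subr_ge0.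
  have p1 u : 0 <= phi x (t * y1 u).
    have /andP[b1 b2] := y1b u.
    have y10 : 0 <= y1 u by rewrite (le_trans _ b1).
    apply/le_phi; split.
      rewrite subr_ge0 en_le ?(ltW r0) // exprMn t1 mul1r -lerBrDl.
      by rewrite -[leRHS]sqr_sqrtr ?subr_ge0 // ler_sqr ?nnegrE ?sqrtr_ge0.
    move=> k kg; have := phi_le2 x y kg => h.
    suff : en (x - 3 * k%:R) y <= en (x - 3 * k%:R) (t * y1 u) by lra.
    rewrite en_ge ?en_ge0 // en_sqr exprMn t1 mul1r lerD2l.
    by rewrite -[y ^+ 2]ger0_norm ?sqr_ge0 // normrX ler_sqr ?nnegrE.
  have h1 : @pth R T M (x, y, z) (x, t * Y, 0) (fun u => (x, t * y1 u, s * phi x (t * y1 u))).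
    split.
    - by have := ct_phi; move=> c; cont; apply: c; cont.
    - by move=> u; split => //=; rewrite normrM ss mul1r ger0_norm.
    - by rewrite /y1 cl0 mul0r addr0 -yt -hz -zs.
    - by rewrite /y1 cl1 mul1r subrKC outer ?mulr0 // sqr.
  pose x1 (u : R) := x + cl u * (rho - x).
  have cx1 : continuous x1 by rewrite /x1; cont.
  have x1b u : x1 u ^+ 2 <= rho ^+ 2.
    have /andP[u0 u1] := cl01 u.
    have xb : `|x| <= rho by rewrite (le_trans (en_ge1 x y)).
    rewrite -[x1 u ^+ 2]ger0_norm ?sqr_ge0 // normrX ler_sqr ?nnegrE ?(ltW r0) //.
    move: xb; rewrite !ler_norml /x1 => /andP[xb1 xb2]; apply/andP; split; nra.
  have h2 : @pth R T M (x, t * Y, 0) (rho, 0, 0) (fun u => (x1 u, t * Num.sqrt (rho ^+ 2 - x1 u ^+ 2), 0)).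
    split.
    - by cont.
    - by move=> u; rewrite /closed_surface /= outer ?normr0 // sqr.
    - by rewrite /x1 cl0 mul0r addr0.
    - by rewrite /x1 cl1 mul1r subrKC subrr sqrtr0 mulr0.
  by eexists; exact: pth_concat h1 h2.
move=> a b /key[c hc] /key[d hd].
by exists (concat c (revp d)); exact: pth_concat hc (pth_rev hd).
Qed.
End ClosedSurface.

(** * Finite generation and alternating quotients of the pure braid groups *)

Section SigmaGroups.
Variables (R : realType) (g p : nat).
Notation T := (R * R * R)%type.
Notation Sg := (@Sigma R g p).
Notation M := (@closed_surface R g).

Lemma hausdorff_space3 : hausdorff_space T.
Proof. exact: norm_hausdorff. Qed.

(** The prescribed punctures are vertical half-lines; each meets the surface in at most one point,
    because the height is determined by its absolute value and its sign. *)
Lemma Sigma_finite_complement : exists2 F : set T, finite_set F & Sg = M `\` F.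
Proof.
pose q (k : nat) : T := (0, k%:R / k.+1%:R, surf_phi g 0 (k%:R / k.+1%:R)).
exists (@puncture_points R p `&` (q @` `I_p)).
  by apply: sub_finite_set (@subIsetr _ _ _) _; apply: finite_image; exact: finite_II.
apply/seteqP; split=> x [Mx nx]; split=> // h; apply: nx; first by case: h.
split=> //; case: x h Mx => -[x y] z [/= -> [z0 [k [kp ->]]]] [_ /= hz].
by exists k => //; rewrite /q -hz gtr0_norm.
Qed.

Lemma Sigma_surface : @surface R T Sg.
Proof.
have [F fF ->] := Sigma_finite_complement.
exact: (surface_minus hausdorff_space3 (@closed_surface_surface R g) fF).
Qed.

Lemma Sigma_minus_pconn (F : set T) : finite_set F -> @pconn R T (Sg `\` F).
Proof.
move=> fF; have [F' fF' ->] := Sigma_finite_complement; rewrite setDDl.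
apply: surface_minus_pconn; [exact: hausdorff_space3|exact: closed_surface_surface|exact: closed_surface_pconn|].
by rewrite finite_setU.
Qed.

Lemma Sigma_minus_fg (F : set T) x (hx : (Sg `\` F) x) : finite_set F -> loop_fg R hx.
Proof.
move=> fF; have [F' fF' E] := Sigma_finite_complement; move: hx; rewrite E setDDl => hx.
apply: surface_fg; [exact: hausdorff_space3|exact: closed_surface_surface|exact: closed_surface_compact|exact: closed_surface_pconn|].
by rewrite finite_setU.
Qed.

Notation loc n := (conf_local_transport hausdorff_space3 Sigma_surface (n := n)).

Lemma conf_Sigma_pconn n : @pconn R _ (conf Sg (n := n)).
Proof.
elim: n => [|n IH] /=.
  by move=> _ _ -> ->; exists (fun=> true); exact: pth_cst.
apply: (total_pconn (loc n)) => // y _.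
by apply: Sigma_minus_pconn; exact: finite_pts.
Qed.

Lemma conf_Sigma_fg n z (hz : conf Sg (n := n) z) : loop_fg R hz.
Proof.
elim: n z hz => [|n IH] z hz.
  exists set0; split; first exact: finite_set0.
  move=> l; suff -> : l = pone R hz by exact: gen1.
  have [c [hc ->]] := pclP l; apply: pclE; apply: hty_eq; [by case: hc|by case: hc|].
  by move=> s _; case: hc => _ + _ _; move=> /(_ s) /= ->; rewrite hz.
case: z hz => y x hz; case: (hz) => /= hy hx.
apply: (fib_fg (loc n) (By := hy) (Fx := hx)); [|exact: IH|].
  by apply: Sigma_minus_pconn; exact: finite_pts.
by apply: Sigma_minus_fg; exact: finite_pts.
Qed.

Definition Alt_quotient k n := forall z : confT T n, conf Sg z ->
  exists2 f : P R (conf Sg (n := n)) z z -> {perm 'I_k}, hom (@pmul R _ _ z z z) f & onto f 'Alt_('I_k)%G.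

(** Forgetting the last strand is surjective on loop groups, since the fibre is a connected
    surface. *)
Lemma Alt_quotientS k n : Alt_quotient k n -> Alt_quotient k n.+1.
Proof.
move=> h [y x] [/= hy hx]; have [f fM [f1 f2]] := h y hy.
exists (fun l : P R (conf Sg (n := n.+1)) (y, x) (y, x) => f (proj_cl l)).
  by move=> a b; rewrite -fM proj_clM.
split=> // s /f2 [l <-].
have [|l' <-] := @fib_surj _ _ _ _ _ (loc n) y hy x hx l; last by exists l'.
by apply: Sigma_minus_pconn; exact: finite_pts.
Qed.

Lemma Alt_quotient_leq k m n : (m <= n)%N -> Alt_quotient k m -> Alt_quotient k n.
Proof. by move=> /subnK <-; elim: (n - m)%N => // j IH /IH; exact: Alt_quotientS. Qed.

Section BraidGroup.
Variables (n : nat) (x0 : 'I_n -> T).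
Hypothesis hx0 : conf_space T Sg n x0.
Notation G := (@pure_braid_group R T Sg n x0).
Let hz : conf Sg (enc x0). Proof. exact/conf_enc. Qed.
Let one : G := projT1 (cid (toP_surj (pone R hz))).
Let toP1 : toP one = pone R hz. Proof. exact: projT2 (cid (toP_surj _)). Qed.

Lemma pb_laws : group_laws (@pb_mul R T Sg n x0) (@pb_inv R T Sg n x0) one.
Proof.
split=> *; apply: toP_inj; rewrite ?toP_mul ?toP_inv ?toP1.
- by rewrite pmulA.
- by rewrite pmul1p.
- by rewrite pmulp1.
- by rewrite pmulVp.
- by rewrite pmulpV.
Qed.

Lemma pb_gen (F : set (P R (conf Sg (n := n)) (enc x0) (enc x0))) C :
  loop_gen hz F (toP C) -> gen (@pb_mul R T Sg n x0) (@pb_inv R T Sg n x0) one (@toP R T Sg n x0 @^-1` F) C.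
Proof.
move: {-1}(toP C) (erefl (toP C)) => l El gl; elim: gl C El => [|b Fb|b b' _ h _ h'|b _ h] C E.
- by rewrite (toP_inj (etrans E (esym toP1))); exact: gen1.
- by apply: gen_in; rewrite /= E.
- have [D ED] := toP_surj b; have [D' ED'] := toP_surj b'.
  have -> : C = pb_mul D D' by apply: toP_inj; rewrite toP_mul ED ED'.
  by apply: genM; [exact: h|exact: h'].
- have [D ED] := toP_surj b.
  have -> : C = pb_inv D by apply: toP_inj; rewrite toP_inv ED.
  by apply: genV; exact: h.
Qed.

Lemma pb_fin_gen : fin_gen (@pb_mul R T Sg n x0) (@pb_inv R T Sg n x0) one.
Proof.
have [F [fF gF]] := conf_Sigma_fg hz.
exists (@toP R T Sg n x0 @^-1` F); split; last by move=> C; apply: pb_gen.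
by apply: finite_preimage => // a b _ _; exact: toP_inj.
Qed.

Lemma pb_R_infty : (forall k, (2 < k)%N -> odd k -> Alt_quotient k n) ->
  R_infty_property (@pb_mul R T Sg n x0) (@pb_inv R T Sg n x0).
Proof.
move=> h; apply: (R_infty_of_Alt_quotients pb_laws pb_fin_gen) => q pq q2.
have [|f fM [f1 f2]] := h q.+2 (ltnW (ltnW (leq_trans q2 (leqnn _)))) _ _ hz.
  by rewrite /= negbK; case: (even_prime pq) => // q2E; rewrite q2E in q2.
exists (fun C => f (toP C)); first by move=> C D; rewrite toP_mul fM.
by split=> // s /f2 [l <-]; have [C <-] := toP_surj l; exists C.
Qed.

Lemma pb_not_R_infty : (exists z (hz' : conf Sg (n := n) z), cyc R hz') ->
  ~ R_infty_property (@pb_mul R T Sg n x0) (@pb_inv R T Sg n x0).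
Proof.
move=> [z [hz' cz]]; have [c hc] := conf_Sigma_pconn hz' hz.
have [g' hg] := cyc_conj hz (pcl hc) cz.
have [D ED] := toP_surj g'.
apply: (@not_R_infty_cyclic _ _ _ _ pb_laws D) => C.
have -> : [set D] = @toP R T Sg n x0 @^-1` [set g'].
  by apply/seteqP; split=> C' /= E; [rewrite E|apply: toP_inj; rewrite E].
exact: pb_gen.
Qed.
End BraidGroup.
End SigmaGroups.

(** * Surjections onto finite groups obtained from holonomy *)

Section HolonomyQuotient.
Variables (R : realType) (Y : topologicalType) (gT : finGroupType).
Variables (X : set Y) (delta : Y -> Y -> gT).
Hypothesis dcoc : local_cocycle X delta.

Lemma hol_in (G : {group gT}) (c : R -> Y) : continuous c -> (forall s, X (c s)) ->
  (forall u v, delta u v \in G) -> hol delta c \in G.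
Proof.
move=> cc Xc hG; have [f f0 hf] := flat_exists dcoc cc Xc; rewrite (holE f0 hf).
apply: (@real_induction R (fun s => f s \in G)); first by rewrite f0 group1.
move=> s s01; have [e e0 he] := hf s s01; exists e => // u v u0 uv v1 hu hv fu.
by rewrite -(he u v) ?groupM //; apply/andP; split; lra.
Qed.

Lemma hol_rev (c : R -> Y) : continuous c -> (forall s, X (c s)) -> hol delta (revp c) = ((hol delta c)^-1)%g.
Proof.
move=> cc Xc; have crc : continuous (revp c) by rewrite /revp; cont.
have e1 : c 1 = revp c 0 by rewrite /revp subr0.
have := hol_concat dcoc cc Xc crc (fun s => Xc (1 - s)) e1.
rewrite (hol_hty dcoc (hty_concat_rev cc Xc)).
have -> : hol delta (fun _ : R => c 0) = 1%g.
  have h (u v : R) : 0 <= u <= 1 -> 0 <= v <= 1 -> delta (c 0) (c 0) = (1^-1 * 1)%g.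
    by move=> _ _; rewrite (delta_refl dcoc) // mulVg.
  by rewrite (hol_exact (c := fun=> c 0) (g := fun=> 1%g) h) mulVg.
by move/esym/eqP; rewrite mulg_eq1 => /eqP ->; rewrite invgK.
Qed.

(** The two loops need not start at the base point: joining them to it by a path conjugates their
    holonomies by an element t of [G], and the conjugated pair still generates [G]. *)
Lemma hol_quotient (G : {group gT}) (a b : gT) (x1 : Y) (la lb : R -> Y) x :
  @pconn R Y X -> (forall u v, delta u v \in G) -> G \subset <<[set a; b]%SET>>%g ->
  pth X x1 x1 la -> pth X x1 x1 lb -> hol delta la = a -> hol delta lb = b -> X x ->
  exists2 f : P R X x x -> gT, hom (@pmul R _ _ x x x) f & onto f G.
Proof.
move=> pX dG Gab pa pb ha hb Xx.
pose f (l : P R X x x) := hol delta (rep l).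
have fE c (h : pth X x x c) : f (pcl h) = hol delta c by rewrite /f; apply: (hol_hty dcoc); exact: hty_rep.
have fM : hom (@pmul R _ _ x x x) f.
  move=> l l'; have [c [hc ->]] := pclP l; have [d [hd ->]] := pclP l'.
  rewrite pmulE !fE; case: hc => cc Xc _ c1; case: hd => cd Xd d0 _.
  by apply: (hol_concat dcoc) => //; rewrite c1 d0.
have fG l : f l \in G by have [cc Xc _ _] := repP l; exact: hol_in.
exists f => //; split=> // s Gs.
have [d hd] : exists d : R -> Y, pth X x x1 d by apply: pX => //; case: pa => _ + <- _; apply.
pose t := hol delta d.
have Gt : t \in G by case: hd => cd Xd _ _; exact: hol_in.
have lift (c : R -> Y) : pth X x1 x1 c -> exists l, f l = (hol delta c ^ t^-1)%g.
  move=> hc; exists (pcl (pth_concat (pth_concat hd hc) (pth_rev hd))); rewrite fE.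
  case: (pth_concat hd hc) => cdc Xdc _ dc1; case: (pth_rev hd) => cr Xr r0 _.
  rewrite (hol_concat dcoc cdc Xdc cr Xr) ?dc1 ?r0 //.
  case: hd => cd Xd d0 d1; case: hc => cc Xc c0 _.
  by rewrite hol_rev // (hol_concat dcoc cd Xd cc Xc) ?d1 ?c0 // conjgE invgK mulgA.
pose I : {set gT} := [set s | `[< exists l, f l = s >]]%SET.
have gI : group_set I.
  apply/group_setP; split.
    rewrite inE; apply/asboolP; exists (pone R Xx).
    exact: (hom1 (loop_laws R Xx) fM).
  move=> u v; rewrite !inE => -[l <-] [l' <-]; exists (pmul l l'); exact: fM.
have mI u : u \in I -> exists l, f l = u by rewrite inE; move=> /asboolP.
suff /fintype.subsetP/(_ s Gs)/mI : G \subset Group gI by [].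
rewrite -(conjGid (groupVr Gt)).
have s1 : (G :^ t^-1 \subset <<[set a; b]%SET>> :^ t^-1)%g by rewrite conjSg.
apply: fintype.subset_trans s1 _.
have [l] := lift _ pa; have [l'] := lift _ pb; rewrite ha hb => El' El.
rewrite -genJ gen_subG; apply/fintype.subsetP => u /imsetP[v + ->].
by rewrite !inE => /orP[/eqP ->|/eqP ->]; [exists l|exists l'].
Qed.

Lemma local_cocycle_pullback (Y' : topologicalType) (X' : set Y') (h : Y' -> Y) :
  (forall x, X' x -> X (h x)) ->
  (forall x, X' x -> forall U, nbhs (h x) U -> exists2 N, nbhs x N & forall u, N u -> X' u -> U (h u)) ->
  local_cocycle X' (fun u v => delta (h u) (h v)).
Proof.
move=> hX hc x X'x; have [N nN hN] := dcoc (hX _ X'x).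
have [N' nN' hN'] := hc x X'x N nN; exists N' => // u v w Nu Nv Nw Xu Xv Xw.
by apply: hN; (exact: hX || exact: hN').
Qed.
End HolonomyQuotient.

(** * One strand on a surface of the second family *)

Section Cuts.
Variables (R : realType) (gT : finGroupType) (Y : topologicalType).
Variables (X : set Y) (x : Y -> R) (L : Y -> option bool) (xi : bool -> R) (e : bool -> gT).
Hypothesis cx : continuous x.

Lemma near_sign (h : Y -> R) q : continuous h -> h q != 0 -> \forall u \near q, (0 < h u) = (0 < h q).
Proof.
move=> ch nz; have [h0|h0] := ltP 0 (h q).
  have : nbhs q (h @^-1` [set t | 0 < t]) := ch q _ (lt_nbhsr h0).
  by apply: filterS.
have hn : h q < 0 by rewrite lt_neqAle nz.
have : nbhs q (h @^-1` [set t | t < 0]) := ch q _ (lt_nbhsl hn).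
by apply: filterS => u /= hu; apply/negbTE; rewrite -leNgt ltW.
Qed.

(* The holonomy picks up [e b] when a path in the region labelled [Some b]
   crosses the hypersurface [x = xi b] upwards. *)
Definition level (l : option bool) (t : R) : gT := if l is Some b then (if t < xi b then 1 else e b)%g else 1%g.
Definition crossing (u v : Y) : gT := if L u == L v then ((level (L u) (x u))^-1 * level (L u) (x v))%g else 1%g.

(** Away from both walls every level is locally constant, so the label may jump there without
    effect; on a wall the label has to be locally constant. *)
Lemma crossing_cocycle :
  (forall q, X q -> (forall b, x q != xi b) \/ \forall u \near q, X u -> L u = L q) ->
  local_cocycle X crossing.
Proof.
move=> h q Xq; have [nx|cL] := h q Xq; last first.
  exists (fun u => X u -> L u = L q) => // u v w Nu Nv Nw Xu Xv Xw.
  by rewrite /crossing !(Nu Xu, Nv Xv, Nw Xw) eqxx mulgA mulgK.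
have c b : \forall u \near q, (0 < xi b - x u) = (0 < xi b - x q).
  apply: (@near_sign (fun u => xi b - x u)); first by cont.
  by rewrite subr_eq0 eq_sym.
exists (fun u => forall l, level l (x u) = level l (x q)).
  near=> u => -[b|] //=; rewrite -subr_gt0 -[x q < _]subr_gt0.
  by have -> : (0 < xi b - x u) = (0 < xi b - x q) by case: b; near: u; exact: c.
move=> u v w Nu Nv Nw _ _ _; rewrite /crossing.
by rewrite !(Nu, Nv, Nw) !mulVg !if_same mulg1.
Unshelve. all: by end_near. Qed.

Lemma crossing_in (G : {group gT}) : (forall b, e b \in G) -> forall u v, crossing u v \in G.
Proof.
move=> eG u v; have lG l t : level l t \in G by case: l => [b|] /=; [case: ifP => _|].
by rewrite /crossing; case: ifP => _; rewrite ?groupM ?groupV.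
Qed.

Lemma hol_label (c : R -> Y) l : (forall s, 0 <= s <= 1 -> L (c s) = l) ->
  hol crossing c = ((level l (x (c 0%R)))^-1 * level l (x (c 1%R)))%g.
Proof.
move=> h; apply: (hol_exact (g := fun s => level l (x (c s)))) => u v u01 v01.
by rewrite /crossing !h // eqxx.
Qed.

Lemma hol_side (c : R -> Y) : (forall s b, 0 <= s <= 1 -> (x (c s) < xi b) = (x (c 0) < xi b)) ->
  hol crossing c = 1%g.
Proof.
move=> h; rewrite (@hol_exact R Y gT crossing c (fun=> 1%g)) ?mulVg // => u v u01 v01.
have lE s l : 0 <= s <= 1 -> level l (x (c s)) = level l (x (c 0)).
  by move=> s01; case: l => [b|] //=; rewrite h.
by rewrite /crossing !lE // !mulVg if_same.
Qed.
End Cuts.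

Lemma convex_lt (R : realFieldType) (a b c t : R) : 0 <= t <= 1 -> (b < c) = (a < c) ->
  (a + t * (b - a) < c) = (a < c).
Proof.
move=> /andP[t0 t1]; case: (ltP a c) => h; [move=> hb|move/negbT; rewrite -leNgt => hb].
  have [ab|ba] := lerP b a.
    by apply: le_lt_trans h; rewrite gerDl mulr_ge0_le0 // subr_le0.
  by apply: le_lt_trans hb; rewrite -lerBrDl ler_piMl // subr_ge0 ltW.
apply/negbTE; rewrite -leNgt; have [ab|ba] := lerP a b.
  by apply: le_trans h _; rewrite lerDl mulr_ge0 // subr_ge0.
apply: le_trans hb _; rewrite -lerBlDl; have : (1 - t) * (b - a) <= 0 by rewrite mulr_ge0_le0 ?subr_ge0 ?subr_le0 ?(ltW ba).
by rewrite mulrBl mul1r subr_le0.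
Qed.

Section Rectangle.
Variables (R : realType) (gT : finGroupType) (Y : topologicalType) (X : set Y).
Variables (up : R * R -> Y) (x : Y -> R) (L : Y -> option bool) (xi : bool -> R) (e : bool -> gT).
Hypotheses (cx : continuous x) (cup : continuous up) (xup : forall w, x (up w) = w.1).
Notation delta := (crossing x L xi e).
Hypothesis dcoc : local_cocycle X delta.
Variables (x1 xm x2 y1 y2 : R) (b : bool).
Hypothesis Hm : forall b', (xm < xi b') = (x1 < xi b').
Hypotheses (H1 : forall t, 0 <= t <= 1 -> X (up (x1, y1 + t * (y2 - y1))))
  (H2 : forall t, 0 <= t <= 1 -> X (up (x1 + t * (xm - x1), y2)))
  (H2' : forall t, 0 <= t <= 1 -> X (up (xm + t * (x2 - xm), y2)) /\ L (up (xm + t * (x2 - xm), y2)) = Some b)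
  (H3 : forall t, 0 <= t <= 1 -> X (up (x2, y1 + t * (y2 - y1))))
  (H4 : forall t, 0 <= t <= 1 -> X (up (x1 + t * (x2 - x1), y1)) /\ L (up (x1 + t * (x2 - x1), y1)) = None).

(** The loop goes around a rectangle. The vertical sides and the piece up to [xm] stay on one side
    of each wall, and the bottom side is unlabelled; so only the piece from [xm] to [x2], labelled
    [Some b], can contribute. *)
Lemma rectangle_hol : exists2 c : R -> Y, pth X (up (x1, y1)) (up (x1, y1)) c &
  hol delta c = ((level xi e (Some b) x1)^-1 * level xi e (Some b) x2)%g.
Proof.
have ccl := @ct_cl R.
have c01 (s : R) : 0 <= 1 - cl s <= 1 by have /andP[h0 h1] := cl01 s; apply/andP; split; lra.
pose s1 (s : R) := up (x1, y1 + cl s * (y2 - y1)).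
pose sm (s : R) := up (x1 + cl s * (xm - x1), y2).
pose s2 (s : R) := up (xm + cl s * (x2 - xm), y2).
pose s3 (s : R) := up (x2, y1 + (1 - cl s) * (y2 - y1)).
pose s4 (s : R) := up (x1 + (1 - cl s) * (x2 - x1), y1).
have p1 : pth X (up (x1, y1)) (up (x1, y2)) s1.
  split; rewrite /s1 ?cl0 ?cl1; [by cont|by move=> s; apply: H1; exact: cl01|by rewrite mul0r addr0|by rewrite mul1r subrKC].
have pm : pth X (up (x1, y2)) (up (xm, y2)) sm.
  split; rewrite /sm ?cl0 ?cl1; [by cont|by move=> s; apply: H2; exact: cl01|by rewrite mul0r addr0|by rewrite mul1r subrKC].
have p2 : pth X (up (xm, y2)) (up (x2, y2)) s2.
  split; rewrite /s2 ?cl0 ?cl1; [by cont|by move=> s; apply: (H2' _).1; exact: cl01|by rewrite mul0r addr0|by rewrite mul1r subrKC].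
have p3 : pth X (up (x2, y2)) (up (x2, y1)) s3.
  split; rewrite /s3 ?cl0 ?cl1 ?subr0 ?subrr; [by cont|by move=> s; apply: H3|by rewrite mul1r subrKC|by rewrite mul0r addr0].
have p4 : pth X (up (x2, y1)) (up (x1, y1)) s4.
  split; rewrite /s4 ?cl0 ?cl1 ?subr0 ?subrr; [by cont|by move=> s; apply: (H4 _).1|by rewrite mul1r subrKC|by rewrite mul0r addr0].
exists (concat (concat (concat s1 sm) s2) (concat s3 s4)).
  exact: pth_concat (pth_concat (pth_concat p1 pm) p2) (pth_concat p3 p4).
have hc z1 z2 z3 (c d : R -> Y) (hc : pth X z1 z2 c) (hd : pth X z2 z3 d) : hol delta (concat c d) = (hol delta c * hol delta d)%g.
  by case: hc hd => cc Xc _ <- [cd Xd d0 _]; rewrite (hol_concat dcoc).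
rewrite (hc _ _ _ _ _ (pth_concat (pth_concat p1 pm) p2) (pth_concat p3 p4)) (hc _ _ _ _ _ (pth_concat p1 pm) p2) (hc _ _ _ _ _ p1 pm) (hc _ _ _ _ _ p3 p4).
have -> : hol delta s1 = 1%g by apply: hol_side => s b' _; rewrite /s1 !xup.
have -> : hol delta sm = 1%g.
  apply: hol_side => s b' _; rewrite /sm !xup /= cl0 mul0r addr0; exact: convex_lt (cl01 s) (Hm b').
have -> : hol delta s3 = 1%g by apply: hol_side => s b' _; rewrite /s3 !xup.
have -> : hol delta s4 = 1%g.
  rewrite (@hol_label _ _ _ _ _ _ _ _ None) /= ?mulVg // => s _; exact: (H4 _).2.
rewrite !mul1g !mulg1 (@hol_label _ _ _ _ _ _ _ _ (Some b)); last by move=> s _; apply: (H2' _).2; exact: cl01.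
by case: p2 => _ _ -> ->; rewrite !xup /= Hm.
Qed.
End Rectangle.

Section OneStrand.
Variables (R : realType) (g p : nat).
Notation T := (R * R * R)%type.
Notation Sg := (@Sigma R g p).
Notation phi := (@surf_phi R g).

Lemma Alt_quotient_one k (delta : T -> T -> {perm 'I_k}) (a b : {perm 'I_k}) x1 (la lb : R -> T) :
  local_cocycle Sg delta -> (forall u v, delta u v \in ('Alt_('I_k))%g) ->
  ('Alt_('I_k))%g \subset <<[set a; b]%SET>>%g -> pth Sg x1 x1 la -> pth Sg x1 x1 lb ->
  hol delta la = a -> hol delta lb = b -> Alt_quotient R g p k 1.
Proof.
move=> dcoc dA Aab pa pb ha hb z hz.
have inc (c : R -> T) : pth Sg x1 x1 c -> pth (conf Sg (n := 1)) (true, x1) (true, x1) (fun s => (true, c s)).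
  by move=> [cc Xc <- c1]; split; [by cont|by move=> s; split; [by []|split; [exact: Xc|by case]]|by []|by rewrite c1].
refine (@hol_quotient _ _ _ _ (fun u v : confT T 1 => delta u.2 v.2) _ ('Alt_('I_k))%G a b _ _ _ z _ _ Aab (inc _ pa) (inc _ pb) ha hb hz) => //.
  apply: (local_cocycle_pullback dcoc (h := snd)) => [u [_ []] //|u _ U nU].
  by exists (fun v : confT T 1 => U v.2) => //; exact: cvg_snd.
exact: conf_Sigma_pconn.
Qed.

Definition up (w : R * R) : T := (w.1, w.2, phi w.1 w.2).
Lemma up_continuous : continuous up.
Proof. by rewrite /up; have c := @ct_phi R g; cont; apply: c; cont. Qed.

(** Besides 0 and 1/2 it is enough to know that the punctures lie between 2/3 and 1. *)
Lemma puncture_value k (t := k%:R / k.+1%:R : R) : [\/ t = 0, t = 2^-1 | 2 / 3 <= t < 1].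
Proof.
rewrite {}/t; case: k => [|[|k]]; [by apply: Or31; rewrite mul0r|by apply: Or32; rewrite div1r|apply: Or33].
have h : 0 <= k%:R :> R by [].
rewrite -[k.+3]addn3 -[k.+2]addn2 !natrD ler_pdivlMr ?ltr_pdivrMr; lra.
Qed.

Lemma Sigma_up (w : R * R) : 0 < phi w.1 w.2 ->
  (w.1 = 0 -> [\/ w.2 < 0, 0 < w.2 < 2^-1, 2^-1 < w.2 < 2 / 3 | 1 <= w.2]) -> Sg (up w).
Proof.
move=> ph np; split; first by split; rewrite /= ?ger0_norm // ltW.
move=> [/= /np h [_ [k [_ E]]]]; rewrite E in h.
move: h; have := puncture_value k; move: (_ / _) => u /=; clear.
by move=> [->|->|/andP[h1 h2]] [h3|/andP[h3 h4]|/andP[h3 h4]|h3]; lra.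
Qed.

Lemma phi_pos (x y : R) : `|x| + `|y| <= 3 * g%:R + 3 - 8^-1 ->
  (forall k, (1 <= k <= g)%N -> 9 / 8 <= `|x - 3 * k%:R| \/ 9 / 8 <= `|y|) -> 0 < phi x y.
Proof.
move=> h1 h2; apply: (@lt_le_trans _ _ (8^-1)); first by rewrite invr_gt0.
apply/le_phi; split; first by have := en_le_sum x y; lra.
move=> k /h2; have := en_ge1 (x - 3 * k%:R) y; have := en_ge2 (x - 3 * k%:R) y.
by move=> ? ? [] ?; lra.
Qed.

Variables (L : T -> option bool) (xi : bool -> R) (x1 y1 : R) (xm x2 y2 : bool -> R).
Hypothesis Lcst : forall q, Sg q -> (forall b, q.1.1 != xi b) \/ \forall u \near q, Sg u -> L u = L q.
Hypothesis side : forall b, (x1 < xi b) != (x2 b < xi b).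
Hypothesis Hm : forall b b', (xm b < xi b') = (x1 < xi b').
Hypotheses (H1 : forall b t, 0 <= t <= 1 -> Sg (up (x1, y1 + t * (y2 b - y1))))
  (H2 : forall b t, 0 <= t <= 1 -> Sg (up (x1 + t * (xm b - x1), y2 b)))
  (H2' : forall b t, 0 <= t <= 1 -> Sg (up (xm b + t * (x2 b - xm b), y2 b)) /\ L (up (xm b + t * (x2 b - xm b), y2 b)) = Some b)
  (H3 : forall b t, 0 <= t <= 1 -> Sg (up (x2 b, y1 + t * (y2 b - y1))))
  (H4 : forall b t, 0 <= t <= 1 -> Sg (up (x1 + t * (x2 b - x1), y1)) /\ L (up (x1 + t * (x2 b - x1), y1)) = None).

(** Two rectangles with a common corner, each crossing its own wall once under its own label, give
    loops whose holonomies are the two generators. *)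
Lemma Alt_quotient_cut k : (2 < k)%N -> odd k -> Alt_quotient R g p k 1.
Proof.
move=> k2 ok; have [a [b [aA bA Aab]]] := two_generated_Alt k2 ok.
pose ab c := if c then a else b.
(* The inverse compensates for a wall that is crossed downwards. *)
pose e c := if x1 < xi c then ab c else ((ab c)^-1)%g.
have ct : continuous (fun q : T => q.1.1) by cont.
have dcoc := crossing_cocycle (L := L) e ct Lcst.
have loop c : exists2 l : R -> T, pth Sg (up (x1, y1)) (up (x1, y1)) l & hol (crossing (fun q : T => q.1.1) L xi e) l = ab c.
  have [l pl hl] := rectangle_hol up_continuous (fun w => erefl) dcoc (Hm c) (H1 c) (H2 c) (H2' c) (H3 c) (H4 c).
  exists l => //; rewrite {}hl /level /e; have := side c.
  by case: (x1 < xi c); case: (x2 c < xi c) => // _; rewrite ?invg1 ?mul1g ?mulg1 ?invgK.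
have [la pa ha] := loop true; have [lb pb hb] := loop false.
apply: (Alt_quotient_one dcoc _ Aab pa pb ha hb); apply: (@crossing_in _ _ _ _ _ _ _ 'Alt_('I_k)%G) => c.
have abA : ab c \in ('Alt_('I_k))%g by rewrite /ab; case: c.
by rewrite /e; case: ifP; rewrite ?groupV.
Qed.
End OneStrand.

Section OneStrandCases.
Variables (R : realType) (p : nat).
Notation T := (R * R * R)%type.

Lemma Sigma_up_box g (x y X Y : R) : - X <= x <= X -> - Y <= y <= Y -> X + Y <= 3 * g%:R + 3 - 8^-1 ->
  (forall k, (1 <= k <= g)%N -> [\/ 9 / 8 <= x - 3 * k%:R, x - 3 * k%:R <= - (9 / 8), 9 / 8 <= y | y <= - (9 / 8)]) ->
  (x = 0 -> [\/ y < 0, 0 < y < 2^-1, 2^-1 < y < 2 / 3 | 1 <= y]) -> @Sigma R g p (up g (x, y)).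
Proof.
rewrite -!ler_norml => hx hy hXY hk h0; apply: Sigma_up => //=; apply: phi_pos; first by lra.
by move=> k /hk; rewrite !ler_normr; case=> ?; [left|left|right|right]; apply/orP; (left; lra) || (right; lra).
Qed.

Lemma natr_split k m : k%:R <= m%:R :> R \/ m.+1%:R <= k%:R :> R.
Proof. by rewrite !ler_nat; case: (leqP k m); [left|right]. Qed.

Lemma Sigma_hole g k (q : T) : (1 <= k <= g)%N -> @Sigma R g p q -> q.1.1 = 3 * k%:R -> q.1.2 != 0.
Proof.
move=> kg [[/= ph _] _] ex; apply/eqP => ey; move: ph; rewrite ex ey => /(fun h => le_trans h (phi_le2 _ _ kg)).
by rewrite subrr en_x0 normr0 sub0r oppr_ge0 ler10.
Qed.

Lemma Sigma_axis (q : T) g : (g <= 1)%N -> @Sigma R g p q -> q.1.1 = 0 -> `|q.1.2| < 1 -> q.2 != 0.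
Proof.
move=> g1 [[/= _ hz] _] ex hy; rewrite -normr_gt0 hz ex; apply: phi_pos.
  have g0 : 0 <= g%:R :> R by rewrite ler0n.
  by rewrite normr0 add0r; lra.
move=> k /andP[k0 kg]; left; rewrite sub0r normrN ger0_norm ?mulr_ge0 //.
have k1 : 1 <= k%:R :> R by rewrite ler1n.
lra.
Qed.

Lemma Sigma_puncture (q : T) g k : (k < p)%N -> @Sigma R g p q -> q.1.1 = 0 -> 0 < q.2 -> q.1.2 != k%:R / k.+1%:R.
Proof. by move=> kp [_ nq] ex ez; apply/eqP => ey; apply: nq; split=> //; split=> //; exists k. Qed.

Let cx : continuous (fun q : T => q.1.1). Proof. by cont. Qed.
Let cy : continuous (fun q : T => q.1.2). Proof. by cont. Qed.
Let cz : continuous (fun q : T => q.2). Proof. by cont. Qed.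

(** The cuts are the closed curves x = 3, y > 0 and x = 6, y > 0, each running through both sheets
    between a hole and the outer circle. The loops encircle the first and the second hole in the
    upper sheet, starting halfway between them; 19/4 separates the two labels. *)
Lemma Alt_quotient_genus g k : (1 < g)%N -> (2 < k)%N -> odd k -> Alt_quotient R g p k 1.
Proof.
move=> g2; have g2' : 2 <= g%:R :> R by rewrite ler_nat.
pose L (q : T) := if 0 < q.1.2 then Some (0 < 19 / 4 - q.1.1) else None.
pose xi (b : bool) : R := if b then 3 else 6.
pose xm (b : bool) : R := if b then 9 / 2 else 5.
pose x2 (b : bool) : R := if b then 3 / 2 else 29 / 4.
apply: (@Alt_quotient_cut R g p L xi (9 / 2) (- (3 / 2)) xm x2 (fun=> 3 / 2)).
- move=> q Sq; have [h|h] := pselect (forall b, q.1.1 != xi b); [by left|right].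
  have [b /negP/negPn/eqP xb] : exists b, ~ (q.1.1 != xi b) by apply/existsNP.
  have y0 : q.1.2 != 0.
    apply: (@Sigma_hole g (if b then 1%N else 2%N) _ _ Sq); first by case: (b); rewrite //= ltnW.
    by rewrite xb /xi; case: (b); lra.
  have x0 : 19 / 4 - q.1.1 != 0 by apply/eqP; rewrite xb /xi; case: (b); lra.
  near=> u => _; rewrite /L.
  have -> : (0 < u.1.2) = (0 < q.1.2) by near: u; exact: (near_sign cy y0).
  have -> // : (0 < 19 / 4 - u.1.1) = (0 < 19 / 4 - q.1.1).
  by near: u; apply: (@near_sign _ _ (fun u : T => 19 / 4 - u.1.1)) => //; cont.
- by case; rewrite /xi /x2; apply/eqP; case: ltP => ?; case: ltP => ? //; lra.
- by case; case; rewrite /xm /xi; apply/idP/idP => ?; lra.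
- move=> b t /andP[t0 t1]; apply: (@Sigma_up_box _ _ _ (9 / 2) (3 / 2)); try lra.
  by move=> j _; case: (natr_split j 1) => ?; [apply: Or41|apply: Or42]; lra.
- move=> b t /andP[t0 t1]; apply: (@Sigma_up_box _ _ _ 5 (3 / 2)); rewrite /xm; try (case: b; lra).
  by move=> j _; apply: Or43; lra.
- move=> b t /andP[t0 t1]; split.
    apply: (@Sigma_up_box _ _ _ (29 / 4) (3 / 2)); rewrite /xm /x2; try (case: b; lra).
    by move=> j _; apply: Or43; lra.
  rewrite /L /= ifT; last by lra.
  by congr Some; rewrite /xm /x2; case: b; apply/idP; lra.
- move=> b t /andP[t0 t1]; apply: (@Sigma_up_box _ _ _ (29 / 4) (3 / 2)); rewrite /x2; try (case: b; lra).
  move=> j /andP[j1 _]; have j1' : 1 <= j%:R :> R by rewrite ler1n.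
  case: b; first by apply: Or42; lra.
  by case: (natr_split j 2) => ?; [apply: Or41|apply: Or42]; lra.
- move=> b t /andP[t0 t1]; split.
    apply: (@Sigma_up_box _ _ _ (29 / 4) (3 / 2)); rewrite /x2; try (case: b; lra).
    by move=> j _; apply: Or44; lra.
  by rewrite /L /= ifF //; apply/negbTE; rewrite -leNgt; lra.
Unshelve. all: by end_near. Qed.

(** One cut is the arc x = 0, 0 < y < 1/2 of the upper sheet, which joins the first two punctures;
    the other is the closed curve x = 3, y > 0 through the hole. The loops encircle the first
    puncture and the hole. *)
Lemma Alt_quotient_torus k : (1 < p)%N -> (2 < k)%N -> odd k -> Alt_quotient R 1 p k 1.
Proof.
move=> p2.
pose L (q : T) := if (0 < q.2) && (0 < q.1.2) && (0 < 2^-1 - q.1.2) && (0 < 2 - q.1.1) then Some true else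
  if (0 < q.1.2) && (0 < q.1.1 - 2^-1) then Some false else None.
pose xi (b : bool) : R := if b then 0 else 3.
pose x2 (b : bool) : R := if b then -1 else 17 / 4.
pose y2 (b : bool) : R := if b then 4^-1 else 3 / 2.
apply: (@Alt_quotient_cut R 1 p L xi 1 (- (3 / 2)) (fun=> 1) x2 y2).
- move=> q Sq; have [h|h] := pselect (forall b, q.1.1 != xi b); [by left|right].
  have [b /negP/negPn/eqP xb] : exists b, ~ (q.1.1 != xi b) by apply/existsNP.
  have sy : q.1.2 != 0 -> \forall u \near q, (0 < u.1.2) = (0 < q.1.2) by move=> hy; exact: (near_sign cy hy).
  have x0 : \forall u \near q, (0 < 2 - u.1.1) = (0 < 2 - q.1.1).
    by apply: (@near_sign _ _ (fun u : T => 2 - u.1.1)); [cont|apply/eqP; rewrite xb /xi; case: (b); lra].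
  have x0' : \forall u \near q, (0 < u.1.1 - 2^-1) = (0 < q.1.1 - 2^-1).
    by apply: (@near_sign _ _ (fun u : T => u.1.1 - 2^-1)); [cont|apply/eqP; rewrite xb /xi; case: (b); lra].
  case: b xb => xb; last first.
    have y0 : q.1.2 != 0 by apply: (@Sigma_hole 1 1 _ _ Sq) => //; rewrite xb /xi; lra.
    near=> u => _; rewrite /L.
    have -> : (0 < u.1.2) = (0 < q.1.2) by near: u; exact: sy.
    have -> : (0 < u.1.1 - 2^-1) = (0 < q.1.1 - 2^-1) by near: u.
    have -> : (0 < 2 - u.1.1) = (0 < 2 - q.1.1) by near: u.
    have -> : (0 < 2 - q.1.1) = false by apply/negbTE; rewrite -leNgt xb /xi; lra.
    by rewrite !andbF.
  have e0 : (0 < q.1.1 - 2^-1) = false by apply/negbTE; rewrite -leNgt xb /xi; lra.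
  (* A point of the wall x = 0 with z <= 0 either lies strictly in the lower sheet or has |y| >= 1,
     far from the arc. In the upper sheet the ends of the arc are punctures, so the label cannot
     jump. *)
  have [zn|zp] := leP q.2 0.
    have [y1|y1] := ltP `|q.1.2| 1.
      have z0 := Sigma_axis (leqnn 1) Sq xb y1.
      near=> u => _; rewrite /L.
      have -> : (0 < u.2) = (0 < q.2) by near: u; exact: (near_sign cz z0).
      have -> : (0 < u.1.1 - 2^-1) = (0 < q.1.1 - 2^-1) by near: u.
      by rewrite ltNge zn e0 /= !andbF.
    have y0 : q.1.2 != 0 by rewrite -normr_gt0; lra.
    have y0' : 2^-1 - q.1.2 != 0 by apply: contraTneq y1 => ?; rewrite -ltNge ltr_norml; apply/andP; split; lra.
    have e1 : (0 < q.1.2) && (0 < 2^-1 - q.1.2) = false.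
      by apply/negbTE/negP => /andP[? ?]; move: y1; rewrite leNgt ltr_norml => /negP; apply; apply/andP; split; lra.
    near=> u => _; rewrite /L.
    have -> : (0 < u.1.2) = (0 < q.1.2) by near: u; exact: sy.
    have -> : (0 < 2^-1 - u.1.2) = (0 < 2^-1 - q.1.2).
      by near: u; apply: (@near_sign _ _ (fun u : T => 2^-1 - u.1.2)) => //; cont.
    have -> : (0 < u.1.1 - 2^-1) = (0 < q.1.1 - 2^-1) by near: u.
    by rewrite e0 -[X in if X && _ then _ else _]andbA e1 !andbF /= -[X in _ = if X && _ then _ else _]andbA e1 !andbF.
  have y0 : q.1.2 != 0 by have := @Sigma_puncture q 1 0 (ltnW p2) Sq xb zp; rewrite mul0r.
  have y0' : 2^-1 - q.1.2 != 0.
    by have := @Sigma_puncture q 1 1 p2 Sq xb zp; rewrite div1r subr_eq0 eq_sym.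
  near=> u => _; rewrite /L.
  have -> : (0 < u.2) = (0 < q.2) by near: u; apply: (near_sign cz); rewrite gt_eqF.
  have -> : (0 < u.1.2) = (0 < q.1.2) by near: u; exact: sy.
  have -> : (0 < 2^-1 - u.1.2) = (0 < 2^-1 - q.1.2).
    by near: u; apply: (@near_sign _ _ (fun u : T => 2^-1 - u.1.2)) => //; cont.
  have -> : (0 < u.1.1 - 2^-1) = (0 < q.1.1 - 2^-1) by near: u.
  by have -> : (0 < 2 - u.1.1) = (0 < 2 - q.1.1) by near: u.
- by case; rewrite /xi /x2; apply/eqP; case: ltP => ?; case: ltP => ? //; lra.
- by [].
- move=> b t /andP[t0 t1]; apply: (@Sigma_up_box _ _ _ 1 (3 / 2)); rewrite /y2; try (case: b; lra).
  move=> [|[|//]] // _; apply: Or42; lra.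
- move=> b t /andP[t0 t1]; apply: (@Sigma_up_box _ _ _ 1 (3 / 2)); rewrite /y2; try (case: b; lra).
  move=> [|[|//]] // _; apply: Or42; lra.
- move=> b t /andP[t0 t1].
  have Su : @Sigma R 1 p (up 1 (1 + t * (x2 b - 1), y2 b)).
    apply: (@Sigma_up_box _ _ _ (17 / 4) (3 / 2)); rewrite /x2 /y2; try (case: b; lra).
      by move=> [|[|//]] // _; case: b; [apply: Or42; lra|apply: Or43; lra].
    case: b => h; last by apply: Or44; lra.
    by apply: Or42; lra.
  split=> //; rewrite /L /up /=; case: b Su => Su; last first.
    rewrite (_ : 0 < 2^-1 - y2 false = false) ?andbF ?andFb; last by apply/negbTE; rewrite -leNgt /y2; lra.
    by rewrite ifT // /x2 /y2; apply/andP; split; lra.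
  rewrite ifT // /x2 /y2; apply/andP; split; last by lra.
  apply/andP; split; last by lra.
  apply/andP; split; last by lra.
  apply: phi_pos.
    have : `|1 + t * (-1 - 1)| <= 1 :> R by rewrite ler_norml; apply/andP; split; lra.
    by rewrite (ger0_norm (_ : 0 <= 4^-1)) ?invr_ge0 //; lra.
  move=> [|[|//]] // _; left; rewrite ler_normr; apply/orP; right; lra.
- move=> b t /andP[t0 t1]; apply: (@Sigma_up_box _ _ _ (17 / 4) (3 / 2)); rewrite /x2 /y2; try (case: b; lra).
  by move=> [|[|//]] // _; case: b; [apply: Or42; lra|apply: Or41; lra].
- move=> b t /andP[t0 t1]; split.
    apply: (@Sigma_up_box _ _ _ (17 / 4) (3 / 2)); rewrite /x2; try (case: b; lra).
      by move=> j _; apply: Or44; lra.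
    by move=> _; apply: Or41; lra.
  have e0 : (0 < - (3 / 2) :> R) = false by apply/negbTE; rewrite -leNgt; lra.
  by rewrite /L /= e0 /= andbF.
Unshelve. all: by end_near. Qed.

(** Both cuts lie on x = 0 in the upper sheet: the arcs from the first to the second and from the
    second to the third puncture, told apart by their labels. The values 1/4 and 7/12 are the
    midpoints of 0, 1/2 and of 1/2, 2/3. *)
Lemma Alt_quotient_sphere3 k : (2 < p)%N -> (2 < k)%N -> odd k -> Alt_quotient R 0 p k 1.
Proof.
move=> p3.
pose L (q : T) := if (0 < q.2) && (0 < 2 / 3 - q.1.2) then
   (if 0 < q.1.2 - 2^-1 then Some false else if 0 < q.1.2 then Some true else None) else None.
pose x2 (b : bool) : R := 4^-1.
pose y2 (b : bool) : R := if b then 4^-1 else 7 / 12.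
have pos (x y : R) : - 4^-1 <= x <= 4^-1 -> - 4^-1 <= y <= 7 / 12 -> 0 < surf_phi 0 x y.
  move=> hx /andP[hy1 hy2]; apply: phi_pos; last by case.
  have : `|x| <= 4^-1 by rewrite ler_norml.
  have : `|y| <= 7 / 12 by rewrite ler_norml; apply/andP; split; lra.
  by lra.
apply: (@Alt_quotient_cut R 0 p L (fun=> 0) (- 4^-1) (- 4^-1) (fun=> - 4^-1) x2 y2).
- move=> q Sq; have [h|h] := pselect (forall b : bool, q.1.1 != 0); [by left|right].
  have [b /negP/negPn/eqP xb] : exists b : bool, ~ (q.1.1 != 0) by apply/existsNP.
  clear h.
  have s23 : 2 / 3 - q.1.2 != 0 -> \forall u \near q, (0 < 2 / 3 - u.1.2) = (0 < 2 / 3 - q.1.2).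
    by apply: (@near_sign _ _ (fun u : T => 2 / 3 - u.1.2)); cont.
  have [zn|zp] := leP q.2 0.
    have [y1|y1] := ltP `|q.1.2| 1.
      have z0 := Sigma_axis (leqnSn 0) Sq xb y1.
      near=> u => _; rewrite /L.
      have -> : (0 < u.2) = (0 < q.2) by near: u; exact: (near_sign cz z0).
      by rewrite ltNge zn.
    have y0' : 2 / 3 - q.1.2 != 0 by apply: contraTneq y1 => ?; rewrite -ltNge ltr_norml; apply/andP; split; lra.
    have [y2p|y2n] := ltP 0 (2 / 3 - q.1.2); last first.
      near=> u => _; rewrite /L.
      have -> : (0 < 2 / 3 - u.1.2) = (0 < 2 / 3 - q.1.2) by near: u; exact: s23.
      by rewrite (ltNge 0 (2 / 3 - _)) y2n !andbF.
    have yn : q.1.2 < 0 by move: y1; rewrite ler_normr => /orP[]; lra.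
    have e0 : (0 < q.1.2) = false by apply/negbTE; rewrite -leNgt ltW.
    have e1 : (0 < q.1.2 - 2^-1) = false by apply/negbTE; rewrite -leNgt; lra.
    near=> u => _; rewrite /L.
    have -> : (0 < u.1.2) = (0 < q.1.2) by near: u; apply: (near_sign cy); rewrite lt_eqF.
    have -> : (0 < u.1.2 - 2^-1) = (0 < q.1.2 - 2^-1).
      by near: u; apply: (@near_sign _ _ (fun u : T => u.1.2 - 2^-1)); [cont|apply/eqP; lra].
    by rewrite e0 e1 !if_same.
  have y0 : q.1.2 != 0 by have := @Sigma_puncture q 0 0 (ltnW (ltnW p3)) Sq xb zp; rewrite mul0r.
  have y0' : q.1.2 - 2^-1 != 0.
    by have := @Sigma_puncture q 0 1 (ltnW p3) Sq xb zp; rewrite div1r subr_eq0.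
  have y0'' : 2 / 3 - q.1.2 != 0.
    by have := @Sigma_puncture q 0 2 p3 Sq xb zp; rewrite subr_eq0 eq_sym.
  near=> u => _; rewrite /L.
  have -> : (0 < u.2) = (0 < q.2) by near: u; apply: (near_sign cz); rewrite gt_eqF.
  have -> : (0 < u.1.2) = (0 < q.1.2) by near: u; exact: (near_sign cy).
  have -> : (0 < u.1.2 - 2^-1) = (0 < q.1.2 - 2^-1).
    by near: u; apply: (@near_sign _ _ (fun u : T => u.1.2 - 2^-1)) => //; cont.
  by have -> : (0 < 2 / 3 - u.1.2) = (0 < 2 / 3 - q.1.2) by near: u; exact: s23.
- by move=> b; rewrite /x2; apply/eqP; case: ltP => ?; case: ltP => ? //; lra.
- by [].
- by move=> b t /andP[t0 t1]; apply: (@Sigma_up_box _ _ _ 1 1); rewrite /y2; [case: b; lra..|case|case: b; lra].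
- by move=> b t /andP[t0 t1]; apply: (@Sigma_up_box _ _ _ 1 1); rewrite /y2; [case: b; lra..|case|case: b; lra].
- move=> b t /andP[t0 t1]; split.
    apply: (@Sigma_up_box _ _ _ 1 1); rewrite /x2 /y2; [case: b; lra..|by case|].
    by case: b => _; [apply: Or42; lra|apply: Or43; lra].
  rewrite /L /up /= ifT; last first.
    by apply/andP; split; [apply: pos; rewrite /x2 /y2; case: b; lra|rewrite /y2; case: b; lra].
  rewrite /y2; case: b.
    by rewrite ifF ?ifT //; [lra|apply/negbTE; rewrite -leNgt; lra].
  by rewrite ifT //; lra.
- by move=> b t /andP[t0 t1]; apply: (@Sigma_up_box _ _ _ 1 1); rewrite /x2 /y2; [case: b; lra..|case|case: b; lra].
- move=> b t /andP[t0 t1]; split.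
    apply: (@Sigma_up_box _ _ _ 1 1); rewrite /x2 /y2; [case: b; lra..|by case|].
    by move=> _; apply: Or41; lra.
  have e0 : (0 < - 4^-1 :> R) = false by apply/negbTE; rewrite -leNgt; lra.
  have e1 : (0 < - 4^-1 - 2^-1 :> R) = false by apply/negbTE; rewrite -leNgt; lra.
  by rewrite /L /= e0 e1 if_same.
Unshelve. all: by end_near. Qed.
End OneStrandCases.

(** * The sphere with at most two punctures *)

Section Transport.
Variables (R : realType) (Y Y' : topologicalType) (X : set Y) (X' : set Y') (g : Y -> Y') (f : Y' -> Y).
Hypotheses (tg : @tcont R _ _ X g) (tf : @tcont R _ _ X' f).
Hypotheses (gX : forall x, X x -> X' (g x)) (fX : forall y, X' y -> X (f y)) (gf : forall y, X' y -> g (f y) = y).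

Lemma hty_transport y y' (c d : R -> Y') : pth X' y y' c -> pth X' y y' d ->
  hty X (fun s => f (c s)) (fun s => f (d s)) -> hty X' c d.
Proof.
move=> [cc Xc _ _] [cd Xd _ _] /(hty_map tg gX).
by under eq_fun do rewrite gf //; under [X in hty _ _ X]eq_fun do rewrite gf //.
Qed.

(** Since [g] undoes [f], every loop of X' is the image under [g] of a loop of X, and a quotient of
    a cyclic group is cyclic. *)
Lemma cyc_transport y (hy : X' y) : cyc R (fX hy) -> cyc R hy.
Proof.
move=> [a ha].
have [c [hc Ec]] := pclP a.
have hgc : pth X' y y (fun s => g (c s)) by have := pth_map tg gX hc; rewrite gf.
exists (pcl hgc) => l; have [d [hd ->]] := pclP l.
have hfd := pth_map tf fX hd.
have H : forall b, loop_gen (fX hy) [set a] b -> forall e (he : pth X (f y) (f y) e) (he' : pth X' y y (fun s => g (e s))),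
    b = pcl he -> loop_gen hy [set pcl hgc] (pcl he').
  move=> b; elim=> [|b' ->|b1 b2 _ h1 _ h2|b1 _ h1] e he he' E.
  - suff -> : pcl he' = pone R hy by exact: gen1.
    apply: pclE; have := hty_map tg gX (pcl_hty E); rewrite gf // => h.
    by apply: hty_sym.
  - suff -> : pcl he' = pcl hgc by exact: gen_in.
    by apply: pclE; apply: hty_sym; apply: (hty_map tg gX); apply: (@pcl_hty _ _ _ _ _ _ _ hc he); rewrite -Ec.
  - have [e1 [he1 E1]] := pclP b1; have [e2 [he2 E2]] := pclP b2.
    have he1' : pth X' y y (fun s => g (e1 s)) by have := pth_map tg gX he1; rewrite gf.
    have he2' : pth X' y y (fun s => g (e2 s)) by have := pth_map tg gX he2; rewrite gf.
    suff -> : pcl he' = pmul (pcl he1') (pcl he2') by apply: genM; [exact: h1 E1|exact: h2 E2].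
    rewrite pmulE; apply: pclE; apply: hty_sym.
    have -> : concat (fun s => g (e1 s)) (fun s => g (e2 s)) = fun s => g (concat e1 e2 s).
      by apply/funext => s; rewrite /concat; case: ifP.
    by apply: (hty_map tg gX); apply: (@pcl_hty _ _ _ _ _ _ _ (pth_concat he1 he2) he); rewrite -E E1 E2 pmulE.
  - have [e1 [he1 E1]] := pclP b1.
    have he1' : pth X' y y (fun s => g (e1 s)) by have := pth_map tg gX he1; rewrite gf.
    suff -> : pcl he' = pinv (pcl he1') by apply: genV; exact: h1 E1.
    rewrite pinvE; apply: pclE; apply: hty_sym; apply: (hty_map tg gX (c := revp e1)).
    by apply: (@pcl_hty _ _ _ _ _ _ _ (pth_rev he1) he); rewrite -E E1 pinvE.
have hgfd : pth X' y y (fun s => g (f (d s))) by have := pth_map tg gX hfd; rewrite gf.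
have -> : pcl hd = pcl hgfd.
  apply: pclE; have [cd Xd _ _] := hd; apply: hty_eq => // s _; by rewrite gf.
exact: (H _ (ha (pcl hfd)) _ hfd hgfd erefl).
Qed.
End Transport.

(** * Stereographic coordinates and simple connectedness of the sphere *)

Section Sphere.
Variable R : realType.
Notation T := (R * R * R)%type.
Notation plane := (R * R)%type.
Notation S := (@closed_surface R 0).
Definition npole : T := (0, 0, 3).
Definition spole : T := (0, 0, -3).

Lemma poles_neq : npole <> spole.
Proof. by move=> /(congr1 snd) /= h; lra. Qed.

Lemma sphereP (q : T) : S q <-> `|q.2| = 3 - en q.1.1 q.1.2.
Proof.
have e : surf_phi 0 q.1.1 q.1.2 = 3 - en q.1.1 q.1.2 by rewrite /surf_phi /= mulr0 add0r.
by rewrite /closed_surface /= e; split=> [[]//|<-]; rewrite normr_ge0.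
Qed.

Lemma en0 (x y : R) : en x y = 0 -> x = 0 /\ y = 0.
Proof.
move=> h; have := en_ge1 x y; have := en_ge2 x y; rewrite h !normr_le0.
by move=> /eqP -> /eqP ->.
Qed.

Lemma sphere_npole (q : T) : S q -> 3 - Num.max q.2 0 = 0 -> q = npole.
Proof.
case: q => [[x y] z] /sphereP /= h; case: (lerP z 0) h => z0 h e; first by exfalso; lra.
have z3 : z = 3 by lra.
have [-> ->] : x = 0 /\ y = 0 by apply: en0; move: h; rewrite z3 ger0_norm //; lra.
by rewrite z3.
Qed.

Definition sden (q : T) : R := 3 - Num.max q.2 0.
(** A stereographic projection adapted to the double cone |z| = 3 - |(x, y)|. It keeps angles around
    the axis and sends the radius r to r/9 on the lower cone and to 1/r on the upper one; the two
    formulas agree at r = 3. *)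
Definition stereo (q : T) : plane := (q.1.1 / sden q ^+ 2, q.1.2 / sden q ^+ 2).
Definition unstereo (u : plane) : T :=
  let m := Num.max (en u.1 u.2) 3^-1 in
  (u.1 / m ^+ 2, u.2 / m ^+ 2, 9 * Num.min (en u.1 u.2) 3^-1 - m^-1).

Let m3 : 0 < 3^-1 :> R. Proof. by rewrite invr_gt0. Qed.

Let inv_le3 (e : R) : 3^-1 < e -> e^-1 <= 3.
Proof. by move=> h; have e0 := lt_trans m3 h; rewrite -[leRHS]invrK lef_pV2 ?posrE // ltW. Qed.

Lemma mden_gt0 (u : plane) : 0 < Num.max (en u.1 u.2) 3^-1.
Proof. by rewrite lt_max m3 orbT. Qed.

Lemma unstereo_sden (u : plane) : sden (unstereo u) = (Num.max (en u.1 u.2) 3^-1)^-1.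
Proof.
rewrite /sden /unstereo /=; case: (lerP (en u.1 u.2) 3^-1) => h.
  rewrite invrK; have : 9 * en u.1 u.2 - 3 <= 0 by lra.
  by move=> /max_idPr ->; rewrite subr0.
have h' := inv_le3 h.
have : 0 <= 9 * 3^-1 - (en u.1 u.2)^-1 by lra.
by move=> /max_idPl ->; lra.
Qed.

Lemma unstereo_sphere (u : plane) : S (unstereo u).
Proof.
apply/sphereP; rewrite /unstereo /=; set m := Num.max _ _; have m0 : 0 < m := mden_gt0 u.
have -> : en (u.1 / m ^+ 2) (u.2 / m ^+ 2) = en u.1 u.2 / m ^+ 2.
  by rewrite -!(mulrC (m ^+ 2)^-1) enZ ger0_norm // invr_ge0 sqr_ge0.
have e0 := en_ge0 u.1 u.2; rewrite {}/m in m0 *; case: (lerP (en u.1 u.2) 3^-1) m0 => h m0.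
  rewrite invrK exprVn invrK ler0_norm; last by lra.
  by lra.
have h' := inv_le3 h.
rewrite ger0_norm; last by lra.
have -> : en u.1 u.2 / en u.1 u.2 ^+ 2 = (en u.1 u.2)^-1 by field; rewrite gt_eqF.
by lra.
Qed.

Lemma unstereo_npole (u : plane) : unstereo u <> npole.
Proof.
move=> h; have := unstereo_sden u; rewrite h /sden /= => e.
have : 0 < (Num.max (en u.1 u.2) 3^-1)^-1 by rewrite invr_gt0 mden_gt0.
by rewrite -e (max_idPl _) // subrr ltxx.
Qed.

Lemma unstereoK (u : plane) : stereo (unstereo u) = u.
Proof.
rewrite /stereo unstereo_sden; have := mden_gt0 u; rewrite /unstereo /=.
case: u => a b /=; set m := Num.max _ _ => m0.
by congr pair; field; rewrite gt_eqF.
Qed.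

Lemma stereoK (q : T) : S q -> q <> npole -> unstereo (stereo q) = q.
Proof.
move=> Sq qN; have d0 : sden q != 0 by apply/eqP => /(sphere_npole Sq).
have e1 : en (stereo q).1 (stereo q).2 = en q.1.1 q.1.2 / sden q ^+ 2.
  by rewrite /stereo /= -!(mulrC (sden q ^+ 2)^-1) enZ ger0_norm // invr_ge0 sqr_ge0.
rewrite /unstereo e1 /stereo /=; move/sphereP: Sq; case: q {qN e1} d0 => [[x y] z] /=; rewrite /sden /=.
case: (lerP z 0) => z0 d0.
  rewrite ler0_norm // subr0 => h; have r : en x y = 3 + z by lra.
  have e0 := en_ge0 x y; rewrite r in e0 *.
  have h2 : (3 + z) / 3 ^+ 2 <= 3^-1 by lra.
  rewrite (max_idPr h2) (min_idPl h2); congr (_, _, _); lra.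
rewrite gtr0_norm // => h; have r : en x y = 3 - z by lra.
have e0 := en_ge0 x y; rewrite r in e0 *.
have d1 : 0 < 3 - z by rewrite lt_def d0.
have -> : (3 - z) / (3 - z) ^+ 2 = (3 - z)^-1 by field.
have h2 : 3^-1 <= (3 - z)^-1 by rewrite lef_pV2 ?posrE //; lra.
rewrite (max_idPl h2) (min_idPr h2) invrK; congr (_, _, _); last by lra.
  by rewrite exprVn invrK divfK // expf_neq0.
by rewrite exprVn invrK divfK // expf_neq0.
Qed.

Lemma unstereo_continuous : continuous unstereo.
Proof.
have ce := @ct_en R.
have cm : continuous (fun u : plane => Num.max (en u.1 u.2) 3^-1) by apply: ct_max; [apply: ce; cont|exact: ct_cst].
have cm2 : continuous (fun u : plane => (Num.max (en u.1 u.2) 3^-1 ^+ 2)^-1).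
  by apply: ct_inv; [exact: ctX|move=> u; rewrite expf_neq0 // gt_eqF // mden_gt0].
have cm1 : continuous (fun u : plane => (Num.max (en u.1 u.2) 3^-1)^-1).
  by apply: ct_inv => // u; rewrite gt_eqF // mden_gt0.
apply: ct_pair; first by apply: ct_pair; apply: ctM => //; cont.
apply: ctD; last exact: ctN.
by apply: ctM; [exact: ct_cst|apply: ct_min; [apply: ce; cont|exact: ct_cst]].
Qed.

Lemma stereo_tcont (X : set T) : (forall q, X q -> S q /\ q <> npole) -> @tcont R _ _ X stereo.
Proof.
move=> hX h ch Xh; rewrite /stereo.
have cd : continuous (fun p => (sden (h p) ^+ 2)^-1).
  apply: ct_inv; first by rewrite /sden; cont.
  by move=> p; rewrite expf_neq0 //; have [Sp pN] := hX _ (Xh p); apply/eqP => /(sphere_npole Sp).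
by apply: ct_pair; apply: ctM => //; cont.
Qed.

Lemma sphere_hty x y (c d : R -> T) : pth (S `\ npole) x y c -> pth (S `\ npole) x y d -> hty (S `\ npole) c d.
Proof.
move=> hc hd.
have us (u : plane) : [set: plane] u -> (S `\ npole) (unstereo u).
  by move=> _; split; [exact: unstereo_sphere|exact: unstereo_npole].
have su (q : T) : (S `\ npole) q -> [set: plane] (stereo q) by [].
have tsu : @tcont R _ _ (S `\ npole) stereo by apply: stereo_tcont => q [].
apply: (hty_transport (tcont_continuous unstereo_continuous) us (f := stereo) _ hc hd) => [q []|]; first exact: stereoK.
exact: (hty_convex (@convexT R) (pth_map tsu su hc) (pth_map tsu su hd)).
Qed.

Definition triv (X : set T) := forall x (hx : X x) (l : P R X x x), l = pone R hx.

Lemma triv_npole : triv (S `\ npole).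
Proof. by move=> x hx l; have [c [hc ->]] := pclP l; apply: pclE; apply: (sphere_hty hc (pth_cst R hx)). Qed.

(** In stereographic coordinates, translated so that s becomes the origin, this is the punctured
    plane. *)
Lemma cyc_sphere2 s x (hx : (S `\ npole `\ s) x) : S s -> s <> npole -> cyc R hx.
Proof.
move=> Ss sN.
pose g (u : plane) := unstereo (u + stereo s); pose f (q : T) : plane := stereo q - stereo s.
have gX u : punctured u -> (S `\ npole `\ s) (g u).
  move=> u0; split; first by split; [exact: unstereo_sphere|exact: unstereo_npole].
  by move=> /= E; apply: u0; apply: (addIr (stereo s)); rewrite add0r -[LHS]unstereoK -/(g u) E.
have fX q : (S `\ npole `\ s) q -> punctured (f q).
  move=> [[Sq qN] qs] /eqP; rewrite subr_eq0 => /eqP E; apply: qs.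
  by rewrite /= -(stereoK Sq qN) E stereoK.
have cg : continuous g.
  have c := unstereo_continuous.
  by have ca : continuous (fun u : plane => u + stereo s) by [apply: ctDv; [exact: ct_id|exact: ct_cst]]; rewrite /g; cont.
have tf : @tcont R _ _ (S `\ npole `\ s) f.
  move=> h ch Xh; apply: ctDv; last exact: ct_cst.
  by apply: (stereo_tcont _ ch Xh) => q [[]].
have gf q : (S `\ npole `\ s) q -> g (f q) = q by move=> [[Sq qN] _]; rewrite /g /f subrK stereoK.
exact: (@cyc_transport R _ _ _ _ g f (tcont_continuous cg) tf gX fX gf x hx (punctured_cycP (fX x hx))).
Qed.

Definition flip (q : T) : T := (q.1, - q.2).
Lemma flip_sphere q : S q -> S (flip q). Proof. by move=> /sphereP h; apply/sphereP; rewrite /= normrN. Qed.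
Lemma flipK q : flip (flip q) = q. Proof. by case: q => a b; rewrite /flip /= opprK. Qed.
Lemma flip_spole q : flip q = npole <-> q = spole.
Proof. by split=> [h|->]; [rewrite -[q]flipK h|rewrite /flip /= opprK]. Qed.

Lemma sphere_hty_spole x y (c d : R -> T) : pth (S `\ spole) x y c -> pth (S `\ spole) x y d -> hty (S `\ spole) c d.
Proof.
have cf : continuous flip by rewrite /flip; cont.
have fs q : (S `\ spole) q -> (S `\ npole) (flip q).
  by move=> [Sq qs]; split; [exact: flip_sphere|move=> /flip_spole].
have fn q : (S `\ npole) q -> (S `\ spole) (flip q).
  by move=> [Sq qs]; split; [exact: flip_sphere|move=> h; apply: qs; rewrite /= -[q]flipK; apply/flip_spole].
move=> hc hd; apply: (hty_transport (tcont_continuous cf) fn (f := flip) _ hc hd) => [q _|]; first exact: flipK.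
by apply: sphere_hty; apply: (pth_map (tcont_continuous cf) fs); eassumption.
Qed.

(** The complements of the two poles are simply connected and their intersection is connected, so
    the generators supplied by [nerve_generation] are all trivial. *)
Lemma triv_sphere : triv S.
Proof.
pose V (b : bool) : set T := if b then S `\ npole else S `\ spole.
have VS b : V b `<=` S by case: b => q [].
have htyV b x y (c d : R -> T) : pth (V b) x y c -> pth (V b) x y d -> hty (V b) c d.
  by case: b; [exact: sphere_hty|exact: sphere_hty_spole].
have fin2 : finite_set [set npole; spole] by rewrite finite_setU; split; exact: finite_set1.
have fin1 (b : bool) : finite_set [set (if b then npole else spole)] by exact: finite_set1.
have pS (F : set T) : finite_set F -> @pconn R T (S `\` F).
  by apply: surface_minus_pconn; [exact: hausdorff_space3|exact: closed_surface_surface|exact: closed_surface_pconn].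
have pV b : @pconn R T (V b) by case: b; apply: pS; exact: finite_set1.
pose x0 := unstereo (1, 0).
have Sx0 : S x0 by exact: unstereo_sphere.
have x0n : x0 <> npole by exact: unstereo_npole.
have x0s : x0 <> spole.
  move=> h; have := unstereoK (1, 0); rewrite -/x0 h /stereo /= mul0r => /(congr1 fst) /= /eqP.
  by rewrite eq_sym oner_eq0.
have Vx0 b : V b x0 by case: b.
have base : forall l : P R S x0 x0, l = pone R Sx0.
  apply: (@nerve_generation _ _ S x0 bool V (fun=> x0) (fun=> pone R Sx0) (fun l => l = pone R Sx0) VS).
  - by move=> a b -> ->; rewrite pmulp1.
  - by move=> a ->; rewrite -[pinv _]pmul1p (pmulpV Sx0).
  - move=> x Sx; have cl1 (q : T) : closed [set q] by apply: (finite_closed (@hausdorff_space3 R)); exact: finite_set1.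
    have ne (a : T) : x <> a -> \forall y \near x, y <> a.
      by move=> xa; have : nbhs x (~` [set a]) by apply: open_nbhs_nbhs; split=> //; exact: closed_openC.
    have [xN|xN] := pselect (x = npole).
      exists false; have xs : x <> spole by rewrite xN; exact: poles_neq.
      by apply: filterS (ne _ xs) => y ys Sy.
    by exists true; apply: filterS (ne _ xN) => y yN Sy.
  - by move=> b x Vx; exact: pV.
  - move=> b a h; rewrite pmul1p; apply: pclE; apply: (hty_sub (@VS b)).
    exact: htyV h (pth_cst R (Vx0 b)).
  - move=> i j u a b ha hb; rewrite !pmul1p.
    suff -> : pcl (pth_sub (@VS i) ha) = pcl (pth_sub (@VS j) hb) by rewrite (pmulpV Sx0).
    have Vi : V i u by case: ha => _ + _ <-; apply.
    have Vj : V j u by case: hb => _ + _ <-; apply.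
    have [ij|ij] := eqVneq i j.
      move: ha hb Vi Vj; rewrite ij => ha hb _ _; apply: pclE; apply: (hty_sub (@VS j)); exact: htyV ha hb.
    have [un us] : u <> npole /\ u <> spole by move: ij Vi Vj; case: (i); case: (j) => // _ [_ h1] [_ h2].
    have Su : S u by exact: (VS i).
    have [|| d hd] := @pS _ fin2 x0 u; [by split=> // -[]|by split=> // -[]|].
    have sub b' : S `\` [set npole; spole] `<=` V b'.
      by move=> q [Sq nq]; case: b'; split=> // qq; apply: nq; [left|right].
    have h1 := htyV _ _ _ _ _ ha (pth_sub (@sub i) hd); have h2 := htyV _ _ _ _ _ hb (pth_sub (@sub j) hd).
    apply: pclE; apply: hty_trans (hty_sub (@VS i) h1) _; apply: hty_sym; exact: (hty_sub (@VS j) h2).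
move=> x Sx l; have [d hd] := @closed_surface_pconn R 0 _ _ Sx0 Sx.
have [l' ->] := conj_surj (pcl hd) l.
by rewrite (base l') /pconj pmulp1 (pmulVp Sx).
Qed.
End Sphere.

(** * The cyclic pure braid groups of the sphere with few points *)

Section SmallSphere.
Variable R : realType.
Notation T := (R * R * R)%type.
Notation S := (@closed_surface R 0).
Notation N := (npole R).
Definition second_puncture : T := unstereo (0, 2).
Notation s := second_puncture.

Lemma second_punctureE : s = (0, 2^-1, 5 / 2).
Proof.
have h : 3^-1 <= 2 :> R by lra.
rewrite /s /unstereo /= en_0x ger0_norm // (max_idPl h) (min_idPr h).
by congr (_, _, _); [rewrite mul0r|field|field].
Qed.

Lemma Sigma_sphere p : (p <= 2)%N ->
  @Sigma R 0 p = S `\` [set q | ((0 < p)%N /\ q = N) \/ ((1 < p)%N /\ q = s)].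
Proof.
move=> p2; apply/seteqP; split=> q [Sq nq]; split=> // h; apply: nq.
  have z3 : 0 < 3 :> R by []. 
  case: h => -[hp ->].
    by split=> //; split=> //; exists 0%N; rewrite mul0r.
  rewrite second_punctureE; split=> //; split; first by rewrite /= divr_gt0.
  by exists 1%N; rewrite div1r.
case: h => x0 [z0 [k [kp ky]]]; move/sphereP: Sq; rewrite x0 en_0x gtr0_norm // => hz.
case: k kp ky => [|[|k]] kp ky; last by case: p p2 kp => [|[|[|]]].
  left; split=> //; move: x0 hz ky {z0}; case: q => [[x y] z] /= -> ->; rewrite mul0r => ->.
  by rewrite normr0 subr0.
right; split=> //; move: x0 hz ky {z0}; case: q => [[x y] z] /= -> ->; rewrite div1r => ->.
by rewrite second_punctureE ger0_norm ?invr_ge0 //; congr pair; lra.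
Qed.

Notation loc p n := (conf_local_transport (@hausdorff_space3 R) (@Sigma_surface R 0 p) (n := n)).

(** In the tower of fibrations each fibre is the sphere minus the punctures and the earlier strands,
    at most two points in all. Only the last fibre can be the sphere minus two points, with a cyclic
    group; the earlier ones are simply connected. *)
Lemma small_sphere_cyc p n : (p <= 2)%N -> (0 < n)%N -> (n + p <= 3)%N ->
  exists z (hz : conf (@Sigma R 0 p) (n := n) z), cyc R hz.
Proof.
move=> p2 n0 np.
have Ss : S (spole R) by apply/sphereP; rewrite /= en_x0 normr0 normrN ger0_norm ?subr0.
have SN : S N by apply/sphereP; rewrite /= en_x0 normr0 ger0_norm ?subr0.
have NS := @poles_neq R.
pose x0 : T := unstereo (1, 0).
have Sx0 : S x0 by exact: unstereo_sphere.
have x0n : x0 <> N by exact: unstereo_npole.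
have x0s : x0 <> spole R.
  move=> h; have := unstereoK (1 : R, 0); rewrite -/x0 h /stereo /= mul0r => /(congr1 fst) /= /eqP.
  by rewrite eq_sym oner_eq0.
have ssp : second_puncture <> spole R.
  by rewrite second_punctureE => /(congr1 (fun q : T => q.1.2)) /= /eqP; rewrite invr_eq0 pnatr_eq0.
have sN : second_puncture <> N by exact: unstereo_npole.
have Ssec : S second_puncture by exact: unstereo_sphere.
have tr0 (X : set T) (l : P R (conf X (n := 0)) true true) : l = pone R (erefl : conf X (n := 0) true).
  have [c [hc ->]] := pclP l; apply: pclE; have [cc Xc _ _] := hc; apply: hty_eq => // r _.
  exact: Xc.
have triv_cyc (Y : topologicalType) (X : set Y) x (hx : X x) : (forall l : P R X x x, l = pone R hx) -> cyc R hx.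
  by move=> h; exists (pone R hx) => l; rewrite (h l); exact: gen1.
have Eset (A B : set T) : (forall q, A q <-> B q) -> A = B by move=> h; apply/seteqP; split=> q /h.
case: p p2 np => [|[|[|//]]] _ np.
- have SE : @Sigma R 0 0 = S.
    by rewrite Sigma_sphere //; apply: Eset => q; split=> [[]//|Sq]; split=> // -[[]|[]].
  have h1 : conf (@Sigma R 0 0) (n := 1) (true, N) by split=> //; split=> //=; rewrite SE.
  have F0 : triv (@Sigma R 0 0 `\` pts (true : confT T 0)) by rewrite /= setD0 SE; exact: triv_sphere.
  have tr1 := fib_trivial (loc 0%N 0) h1 (tr0 _) (F0 N h1.2).
  case: n n0 np => [//|[|[|[|//]]]] _ _; first by exists (true, N), h1; exact: triv_cyc.
    have h2 : conf (@Sigma R 0 0) (n := 2) (true, N, spole R).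
      by split=> //; split; [rewrite SE|move=> /= [[]|/esym /NS]].
    have F1 : triv (@Sigma R 0 0 `\` pts ((true, N) : confT T 1)).
      rewrite SE; have -> : S `\` pts ((true, N) : confT T 1) = S `\ N; last exact: triv_npole.
      by rewrite /= set0U.
    exists (true, N, spole R), h2; apply: triv_cyc.
    exact: (fib_trivial (loc 0%N 1) h2 tr1 (F1 _ h2.2)).
  have h2 : conf (@Sigma R 0 0) (n := 2) (true, N, spole R).
    by split=> //; split; [rewrite SE|move=> /= [[]|/esym /NS]].
  have F1 : triv (@Sigma R 0 0 `\` pts ((true, N) : confT T 1)).
    rewrite SE; have -> : S `\` pts ((true, N) : confT T 1) = S `\ N; last exact: triv_npole.
    by rewrite /= set0U.
  have tr2 := fib_trivial (loc 0%N 1) h2 tr1 (F1 _ h2.2).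
  have h3 : conf (@Sigma R 0 0) (n := 3) (true, N, spole R, x0).
    by split=> //; split; [rewrite SE|move=> /= [[[]|]|]].
  have F2 : forall x (hx : (@Sigma R 0 0 `\` pts ((true, N, spole R) : confT T 2)) x), cyc R hx.
    have -> : @Sigma R 0 0 `\` pts ((true, N, spole R) : confT T 2) = S `\ N `\ spole R.
      by rewrite SE /= set0U setDDl.
    by move=> x hx; apply: cyc_sphere2 => // /esym.
  exists (true, N, spole R, x0), h3; exact: (fib_cyc (loc 0%N 2) (Fx := h3.2) h3 tr2 (F2 _ _)).
- have SE : @Sigma R 0 1 = S `\ N.
    rewrite Sigma_sphere //; apply: Eset => q; split=> -[Sq nq]; split=> // h; apply: nq; first by left.
    by case: h => -[].
  have h1 : conf (@Sigma R 0 1) (n := 1) (true, spole R).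
    by split=> //; split=> //=; rewrite SE; split=> // /esym.
  have F0 : triv (@Sigma R 0 1 `\` pts (true : confT T 0)) by rewrite /= setD0 SE; exact: triv_npole.
  have tr1 := fib_trivial (loc 1%N 0) h1 (tr0 _) (F0 _ h1.2).
  rewrite addn1 in np; case: n n0 np => [//|[|[|//]]] _ _; first by exists (true, spole R), h1; exact: triv_cyc.
  have h2 : conf (@Sigma R 0 1) (n := 2) (true, spole R, x0).
    by split=> //; split; [rewrite SE|move=> /= [[]|]].
  have F1 : forall x (hx : (@Sigma R 0 1 `\` pts ((true, spole R) : confT T 1)) x), cyc R hx.
    have -> : @Sigma R 0 1 `\` pts ((true, spole R) : confT T 1) = S `\ N `\ spole R.
      by rewrite SE /= set0U.
    by move=> x hx; apply: cyc_sphere2 => // /esym.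
  exists (true, spole R, x0), h2; exact: (fib_cyc (loc 1%N 1) (Fx := h2.2) h2 tr1 (F1 _ _)).
- have SE : @Sigma R 0 2 = S `\ N `\ second_puncture.
    rewrite Sigma_sphere //; apply: Eset => q; split.
      by move=> [Sq nq]; split; [split=> //|]; move=> h; apply: nq; [left|right].
    by move=> [[Sq qN] qs]; split=> // -[[_ /qN]|[_ /qs]].
  have h1 : conf (@Sigma R 0 2) (n := 1) (true, spole R).
    by split=> //; split=> //=; rewrite SE; split; [split=> // /esym|move=> /esym].
  have F0 : forall x (hx : (@Sigma R 0 2 `\` pts (true : confT T 0)) x), cyc R hx.
    have -> : @Sigma R 0 2 `\` pts (true : confT T 0) = S `\ N `\ second_puncture by rewrite /= setD0.
    by move=> x hx; exact: cyc_sphere2.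
  rewrite addn2 in np; case: n n0 np => [//|[|//]] _ _; exists (true, spole R), h1.
  exact: (fib_cyc (loc 2%N 0) (Fx := h1.2) h1 (tr0 _) (F0 _ _)).
Qed.
End SmallSphere.

Import ComplexField.
Local Open Scope complex_scope.
Lemma for_ext (Z Y : topologicalType) (f g : Z -> Y) (z : Z) : f =1 g ->
  {for z, continuous g} -> {for z, continuous f}.
Proof. by move/funext ->. Qed.

Section ComplexContinuity.
Variables (R : realType) (Z : topologicalType).
Implicit Types (f g : Z -> R[i]) (z : Z).
Notation Re := (@complex.Re R). Notation Im := (@complex.Im R).

(** Complex numbers serve only for the algebra; the cross ratio is finally a point of the real
    plane, so continuity is stated for its two components. *)
Definition cplx_continuous f z := {for z, continuous (fun z => Re (f z))} /\ {for z, continuous (fun z => Im (f z))}.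

Lemma cplx_continuousB f g z : cplx_continuous f z -> cplx_continuous g z -> cplx_continuous (fun z => f z - g z) z.
Proof.
move=> [f1 f2] [g1 g2]; split.
  by apply: (@for_ext _ _ _ (fun z => Re (f z) - Re (g z))) => [u|]; [rewrite raddfB|exact: cvgB f1 g1].
by apply: (@for_ext _ _ _ (fun z => Im (f z) - Im (g z))) => [u|]; [rewrite raddfB|exact: cvgB f2 g2].
Qed.

Lemma cplx_continuousM f g z : cplx_continuous f z -> cplx_continuous g z -> cplx_continuous (fun z => f z * g z) z.
Proof.
move=> [f1 f2] [g1 g2].
have re (a b : R[i]) : Re (a * b) = Re a * Re b - Im a * Im b by case: a; case: b.
have im (a b : R[i]) : Im (a * b) = Re a * Im b + Im a * Re b by case: a; case: b.
split.
  by apply: (for_ext (fun u => re (f u) (g u))); apply: cvgB; exact: cvgM.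
by apply: (for_ext (fun u => im (f u) (g u))); apply: cvgD; exact: cvgM.
Qed.

Lemma cplx_continuousV f z : f z != 0 -> cplx_continuous f z -> cplx_continuous (fun z => (f z)^-1) z.
Proof.
move=> nz [f1 f2].
have re (a : R[i]) : Re a^-1 = Re a / (Re a ^+ 2 + Im a ^+ 2) by case: a.
have im (a : R[i]) : Im a^-1 = - Im a / (Re a ^+ 2 + Im a ^+ 2) by case: a => x y /=; rewrite mulNr.
have cd : {for z, continuous (fun z => (Re (f z) ^+ 2 + Im (f z) ^+ 2)^-1)}.
  apply: cvgV; last by apply: cvgD; exact: cvgM.
  apply: contra nz; case: (f z) => x y /=; rewrite paddr_eq0 ?sqr_ge0 // !sqrf_eq0 => /andP[/eqP -> /eqP ->].
  by rewrite eq_complex /= !eqxx.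
split; first by apply: (for_ext (fun u => re (f u))); exact: cvgM.
by apply: (for_ext (fun u => im (f u))); apply: cvgM => //; exact: cvgN.
Qed.
End ComplexContinuity.

(** * The cross ratio of four distinct points on the sphere *)

Section CrossRatio.
Variable R : realType.
Notation T := (R * R * R)%type.
Notation plane := (R * R)%type.
Notation S := (@closed_surface R 0).
Notation N := (npole R).
Notation C := R[i].

(** In affine coordinates z = a / b this is (z1 - z2)(z3 - z4) / ((z3 - z2)(z1 - z4)); the
    homogeneous form allows a point at infinity. *)
Definition lam (a1 b1 a2 b2 a3 b3 a4 b4 : C) : C :=
  ((a1 * b2 - a2 * b1) * (a3 * b4 - a4 * b3)) / ((a3 * b2 - a2 * b3) * (a1 * b4 - a4 * b1)).

Lemma lam_scale c1 c2 c3 c4 a1 b1 a2 b2 a3 b3 a4 b4 : c1 != 0 -> c2 != 0 -> c3 != 0 -> c4 != 0 ->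
  lam (c1 * a1) (c1 * b1) (c2 * a2) (c2 * b2) (c3 * a3) (c3 * b3) (c4 * a4) (c4 * b4) = lam a1 b1 a2 b2 a3 b3 a4 b4.
Proof.
move=> h1 h2 h3 h4; rewrite /lam.
have -> : (c1 * a1 * (c2 * b2) - c2 * a2 * (c1 * b1)) * (c3 * a3 * (c4 * b4) - c4 * a4 * (c3 * b3)) =
  (c1 * c2 * c3 * c4) * ((a1 * b2 - a2 * b1) * (a3 * b4 - a4 * b3)) by ring.
have -> : (c3 * a3 * (c2 * b2) - c2 * a2 * (c3 * b3)) * (c1 * a1 * (c4 * b4) - c4 * a4 * (c1 * b1)) =
  (c1 * c2 * c3 * c4) * ((a3 * b2 - a2 * b3) * (a1 * b4 - a4 * b1)) by ring.
by rewrite -mulf_div divff ?mul1r // !mulf_neq0.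
Qed.

(** The value 1 is excluded by the Pluecker relation: the difference of numerator and denominator
    is, up to sign, the product of the two remaining determinants. *)
Lemma lam_neq a1 b1 a2 b2 a3 b3 a4 b4 : a1 * b2 - a2 * b1 != 0 -> a3 * b4 - a4 * b3 != 0 ->
  a3 * b2 - a2 * b3 != 0 -> a1 * b4 - a4 * b1 != 0 -> a1 * b3 - a3 * b1 != 0 -> a2 * b4 - a4 * b2 != 0 ->
  lam a1 b1 a2 b2 a3 b3 a4 b4 != 0 /\ lam a1 b1 a2 b2 a3 b3 a4 b4 != 1.
Proof.
move=> h12 h34 h32 h14 h13 h24; have d0 := mulf_neq0 h32 h14; split.
  by rewrite mulf_neq0 ?invr_eq0 // mulf_neq0.
apply: contra (mulf_neq0 h13 h24) => /eqP E.
have {}E : (a1 * b2 - a2 * b1) * (a3 * b4 - a4 * b3) = (a3 * b2 - a2 * b3) * (a1 * b4 - a4 * b1).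
  by rewrite -[LHS](divfK d0) -[_ / _]/(lam a1 b1 a2 b2 a3 b3 a4 b4) E mul1r.
by rewrite -subr_eq0 in E *; apply/eqP; rewrite -[RHS](subrr ((a3 * b2 - a2 * b3) * (a1 * b4 - a4 * b1))) -{1}E; ring.
Qed.

(** With the fourth point at infinity and the third one unit from the second, the cross ratio is a
    translation in the first point. This supplies an explicit section. *)
Lemma lam_affine (U1 U2 U3 b1 b2 b3 a4 : C) : b1 != 0 -> b2 != 0 -> b3 != 0 -> a4 != 0 -> U3 = U2 + 1 ->
  lam (U1 * b1) b1 (U2 * b2) b2 (U3 * b3) b3 a4 0 = U1 - U2.
Proof.
move=> h1 h2 h3 h4 ->; rewrite /lam; apply: (canLR (mulfK _)).
  have -> : ((U2 + 1) * b3 * b2 - U2 * b2 * b3) * (U1 * b1 * 0 - a4 * b1) = - (b3 * b2 * a4 * b1) by ring.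
  by rewrite oppr_eq0 !mulf_neq0.
by ring.
Qed.

(* Homogeneous coordinates of the stereographic projection: two sections over
   the complements of the two poles, proportional on the overlap. *)
Definition alpha (t : bool) (q : T) : C :=
  if t then ((3 - Num.max (- q.2) 0) ^+ 2)%:C else q.1.1 +i* q.1.2.
Definition beta (t : bool) (q : T) : C :=
  if t then (9 * q.1.1) +i* (- (9 * q.1.2)) else (sden q ^+ 2)%:C.
Definition bad_pole (t : bool) : T := if t then spole R else N.
(** The section regular at the north pole is selected only at that pole. The selection is
    discontinuous, but the cross ratio does not see it. *)
Definition near_pole (q : T) : bool := `[< q = N >].
Definition cplx (u : plane) : C := u.1 +i* u.2.

Lemma rescale q : S q -> q <> N -> q <> spole R ->
  exists2 c, c != 0 & alpha false q = c * alpha true q /\ beta false q = c * beta true q.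
Proof.
move=> Sq qN qs; rewrite /alpha /beta; set d := (3 - Num.max (- q.2) 0) ^+ 2.
have hs := (sphereP q).1 Sq.
have d0 : d != 0.
  apply: expf_neq0; apply/eqP => e.
  have := @sphere_npole R (flip q) (flip_sphere Sq) e; by move=> /flip_spole.
have dC : d%:C != 0 by rewrite fmorph_eq0.
have z0 : q.1.1 +i* q.1.2 != 0 :> C.
  apply/eqP => -[x0 y0]; move: hs; rewrite x0 y0 en_x0 normr0 subr0 => hz.
  have eqT (p : T) : p.1.1 = 0 -> p.1.2 = 0 -> p = (0, 0, p.2) by case: p => [[a b] c] /= -> ->.
  case: (ger0P q.2) hz => _ hz; first by apply: qN; rewrite (eqT q x0 y0) hz.
  by apply: qs; rewrite (eqT q x0 y0) /spole -hz opprK.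
exists ((q.1.1 +i* q.1.2) / d%:C); first by rewrite mulf_neq0 ?invr_eq0.
split; first by rewrite divfK.
(* On either cone one of the two denominators is 3 and the other is the radius, so their product is
   three times the radius. *)
have key : (q.1.1 ^+ 2 + q.1.2 ^+ 2) * 9 = sden q ^+ 2 * d.
  rewrite -en_sqr; have -> : en q.1.1 q.1.2 = 3 - `|q.2| by lra.
  rewrite /sden /d; case: (lerP q.2 0) => hz.
    by rewrite ler0_norm // (max_idPl _) ?oppr_ge0 //; ring.
  by rewrite gtr0_norm // (max_idPr _) ?oppr_le0 ?ltW //; ring.
rewrite mulrAC; apply: (canRL (mulfK dC)).
rewrite -rmorphM -key; simpc; congr (_ +i* _); ring.
Qed.

Lemma section_change t q : S q -> q <> bad_pole t -> exists2 c, c != 0 &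
  alpha (near_pole q) q = c * alpha t q /\ beta (near_pole q) q = c * beta t q.
Proof.
move=> Sq; rewrite /near_pole /bad_pole; case: asboolP => qN qp.
  case: t qp => qp; last by case: qp.
  by exists 1; rewrite ?oner_neq0 // !mul1r.
case: t qp => qp; first exact: rescale.
by exists 1; rewrite ?oner_neq0 // !mul1r.
Qed.

Notation A q := (alpha (near_pole q) q). Notation B q := (beta (near_pole q) q).

Lemma finite_section q : S q -> q <> N -> A q = cplx (stereo q) * B q /\ B q != 0.
Proof.
move=> Sq qN; rewrite /near_pole; case: asboolP => // _; rewrite /alpha /beta.
have d0 : sden q ^+ 2 != 0 by apply: expf_neq0; apply/eqP => /(sphere_npole Sq).
split; last by rewrite fmorph_eq0.
by rewrite /cplx /stereo; simpc; rewrite !divfK.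
Qed.

Lemma pole_section : A N = 9%:C /\ B N = 0.
Proof.
rewrite /near_pole; case: asboolP => // _; rewrite /alpha /beta /= !mulr0 oppr0; split=> //.
by rewrite (max_idPr _) ?oppr_le0 // subr0; congr (_%:C); ring.
Qed.

Lemma cplx_inj : injective cplx.
Proof. by move=> [a b] [c d] [/= -> ->]. Qed.

Lemma det_neq0 q q' : S q -> S q' -> q <> q' -> A q * B q' - A q' * B q != 0.
Proof.
move=> Sq Sq'; have C9 : 9%:C != 0 :> C by rewrite fmorph_eq0 pnatr_eq0.
have [aN bN] := pole_section.
have [->|qN] := pselect (q = N); have [->|qN'] := pselect (q' = N) => // ne.
- by have [_ b0] := finite_section Sq' qN'; rewrite aN bN mulr0 subr0 mulf_neq0.
- by have [_ b0] := finite_section Sq qN; rewrite aN bN mulr0 sub0r oppr_eq0 mulf_neq0.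
have [-> b0] := finite_section Sq qN; have [-> b0'] := finite_section Sq' qN'.
have -> : cplx (stereo q) * B q * B q' - cplx (stereo q') * B q' * B q = (cplx (stereo q) - cplx (stereo q')) * (B q * B q') by ring.
rewrite !mulf_neq0 // subr_eq0; apply/eqP => /cplx_inj E; apply: ne.
by rewrite -(stereoK Sq qN) E stereoK.
Qed.

Section Configuration.
Variables (Z : topologicalType) (X : set Z) (f : 'I_4 -> Z -> T).
Hypothesis cf : forall i, continuous (f i).
Hypothesis fS : forall i z, X z -> S (f i z).
Hypothesis fI : forall i j z, X z -> f i z = f j z -> i = j.
Let i0 : 'I_4 := inord 0. Let i1 : 'I_4 := inord 1. Let i2 : 'I_4 := inord 2. Let i3 : 'I_4 := inord 3.

Definition lamt (t : 'I_4 -> bool) (z : Z) : C :=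
  lam (alpha (t i0) (f i0 z)) (beta (t i0) (f i0 z)) (alpha (t i1) (f i1 z)) (beta (t i1) (f i1 z))
      (alpha (t i2) (f i2 z)) (beta (t i2) (f i2 z)) (alpha (t i3) (f i3 z)) (beta (t i3) (f i3 z)).
Definition cross_ratio (z : Z) : plane :=
  let l := lamt (fun i => near_pole (f i z)) z in (complex.Re l, complex.Im l).

Let det z i j : X z -> i != j -> A (f i z) * B (f j z) - A (f j z) * B (f i z) != 0.
Proof. by move=> Xz ij; apply: det_neq0; [exact: fS|exact: fS|move=> /(fI Xz) E; rewrite E eqxx in ij]. Qed.
Let ne (a b : nat) : (a < 4)%N -> (b < 4)%N -> a != b -> (inord a : 'I_4) != inord b.
Proof. by move=> ha hb; apply: contra => /eqP/(congr1 val); rewrite /= !inordK // => ->. Qed.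

Lemma cross_ratio_neq z : X z -> cross_ratio z <> (0, 0) /\ cross_ratio z <> (1, 0).
Proof.
move=> Xz; have [l0 l1] := @lam_neq _ _ _ _ _ _ _ _ (det Xz (@ne 0 1 isT isT isT)) (det Xz (@ne 2 3 isT isT isT))
  (det Xz (@ne 2 1 isT isT isT)) (det Xz (@ne 0 3 isT isT isT)) (det Xz (@ne 0 2 isT isT isT)) (det Xz (@ne 1 3 isT isT isT)).
split; move=> E; [move/negP: l0; apply|move/negP: l1; apply]; move: E; rewrite /cross_ratio /lamt -/i0 -/i1 -/i2 -/i3.
  by case: (lam _ _ _ _ _ _ _ _) => a b [/= -> ->]; rewrite eq_complex /= !eqxx.
by case: (lam _ _ _ _ _ _ _ _) => a b [/= -> ->]; rewrite eq_complex /= !eqxx.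
Qed.

Lemma cplx_continuous_alpha t i z : cplx_continuous (fun z => alpha t (f i z)) z.
Proof.
have c := @cf i; have cst : continuous (fun _ : Z => 0 : R) by exact: ct_cst.
case: t; split; rewrite /alpha /=.
- have h : continuous (fun z => (3 - Num.max (- (f i z).2) 0) ^+ 2) by cont. exact: h.
- exact: cst.
- have h : continuous (fun z => (f i z).1.1) by cont. exact: h.
- have h : continuous (fun z => (f i z).1.2) by cont. exact: h.
Qed.

Lemma cplx_continuous_beta t i z : cplx_continuous (fun z => beta t (f i z)) z.
Proof.
have c := @cf i; have cst : continuous (fun _ : Z => 0 : R) by exact: ct_cst.
case: t; split; rewrite /beta /=.
- have h : continuous (fun z => 9 * (f i z).1.1) by cont. exact: h.
- have h : continuous (fun z => - (9 * (f i z).1.2)) by cont. exact: h.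
- have h : continuous (fun z => sden (f i z) ^+ 2) by [rewrite /sden; cont]. exact: h.
- exact: cst.
Qed.

Lemma cross_ratio_continuous z : X z -> forall U, nbhs (cross_ratio z) U ->
  exists2 N, nbhs z N & forall u, N u -> X u -> U (cross_ratio u).
Proof.
(* The sections selected at z are frozen, which gives a continuous expression near z. Nearby no
   point meets the pole excluded for its frozen section, so by [lam_scale] the value is the cross
   ratio. *)
move=> Xz U nU; pose t i := near_pole (f i z).
have ctd a b : cplx_continuous (fun z => alpha (t a) (f a z) * beta (t b) (f b z) - alpha (t b) (f b z) * beta (t a) (f a z)) z.
  by apply: cplx_continuousB; apply: cplx_continuousM; (exact: cplx_continuous_alpha || exact: cplx_continuous_beta).
have [cr ci] : cplx_continuous (lamt t) z.
  apply: cplx_continuousM; first exact: cplx_continuousM.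
  apply: cplx_continuousV; last exact: cplx_continuousM.
  exact: mulf_neq0 (det Xz (@ne 2 1 isT isT isT)) (det Xz (@ne 0 3 isT isT isT)).
have nG : \forall u \near z, U (complex.Re (lamt t u), complex.Im (lamt t u)).
  exact: (cvg_pair cr ci) _ nU.
have nb i : \forall u \near z, f i u <> bad_pole (t i).
  have : nbhs (f i z) (~` [set bad_pole (t i)]).
    apply: open_nbhs_nbhs; split.
      by apply: closed_openC; apply: (finite_closed (@hausdorff_space3 R)); exact: finite_set1.
    rewrite /= /bad_pole /t /near_pole; case: asboolP => [->|//]; exact: poles_neq.
  by move=> h; exact: (cf h).
exists (fun u => U (complex.Re (lamt t u), complex.Im (lamt t u)) /\
    [/\ f i0 u <> bad_pole (t i0), f i1 u <> bad_pole (t i1), f i2 u <> bad_pole (t i2) & f i3 u <> bad_pole (t i3)]).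
  by near=> u; split; [near: u; exact: nG|split; near: u; exact: nb].
move=> u [hU [hb0 hb1 hb2 hb3]] Xu; rewrite /cross_ratio.
suff -> : lamt (fun i => near_pole (f i u)) u = lamt t u by [].
rewrite /lamt.
have [c0 n0 [-> ->]] := section_change (fS i0 Xu) hb0.
have [c1 n1 [-> ->]] := section_change (fS i1 Xu) hb1.
have [c2 n2 [-> ->]] := section_change (fS i2 Xu) hb2.
have [c3 n3 [-> ->]] := section_change (fS i3 Xu) hb3.
exact: lam_scale.
Unshelve. all: by end_near. Qed.
End Configuration.
End CrossRatio.

(** * Alternating quotients for the sphere with at most two punctures *)

Section FewPunctures.
Variable R : realType.
Notation T := (R * R * R)%type.
Notation plane := (R * R)%type.
Notation S := (@closed_surface R 0).
Notation N := (npole R).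
Notation s := (second_puncture R).

Definition twice_punctured : set plane := [set u | u <> (0, 0) /\ u <> (1, 0)].

(** The cuts are the vertical half-lines above 0 and 1, the loops are rectangles around these points
    with a common corner between them, and the line x = 3/4 separates the labels. *)
Lemma twice_punctured_holonomy k : (2 < k)%N -> odd k ->
  exists (delta : plane -> plane -> {perm 'I_k}) (a b : {perm 'I_k}) (x1 : plane) (la lb : R -> plane),
  [/\ local_cocycle twice_punctured delta, (forall u v, delta u v \in ('Alt_('I_k))%g) &
    ('Alt_('I_k))%g \subset <<[set a; b]%SET>>%g] /\
  [/\ pth twice_punctured x1 x1 la, pth twice_punctured x1 x1 lb, hol delta la = a & hol delta lb = b].
Proof.
move=> k2 ok; have [a [b [aA bA Aab]]] := two_generated_Alt k2 ok.
pose L (u : plane) := if 0 < u.2 then Some (0 < 3 / 4 - u.1) else None.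
pose xi (c : bool) : R := if c then 0 else 1.
pose ab c := if c then a else b.
pose e c := if (2^-1 : R) < xi c then ab c else ((ab c)^-1)%g.
pose xm (c : bool) : R := if c then 2^-1 else 7 / 8.
pose x2 (c : bool) : R := if c then -1 else 2.
have cx : continuous (fun u : plane => u.1) by cont.
have cy : continuous (fun u : plane => u.2) by cont.
have dcoc : local_cocycle twice_punctured (crossing (fun u : plane => u.1) L xi e).
  apply: crossing_cocycle => // u [u0 u1].
  have [h|h] := pselect (forall c, u.1 != xi c); [by left|right].
  have [c /negP/negPn/eqP xc] : exists c, ~ (u.1 != xi c) by apply/existsNP.
  have y0 : u.2 != 0.
    by apply/eqP => y0; case: c xc => xc; [apply: u0|apply: u1]; rewrite [u]surjective_pairing xc y0.
  have x0 : 3 / 4 - u.1 != 0 by clear h u0 u1; apply/eqP; rewrite xc /xi; case: c {xc}; lra.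
  near=> v => _; rewrite /L.
  have -> : (0 < v.2) = (0 < u.2) by near: v; exact: (near_sign cy y0).
  have -> // : (0 < 3 / 4 - v.1) = (0 < 3 / 4 - u.1).
  by near: v; apply: (@near_sign _ _ (fun v : plane => 3 / 4 - v.1)) => //; cont.
have neq (x y : R) : y != 0 \/ (x != 0 /\ x != 1) -> twice_punctured (x, y).
  by move=> h; split=> -[ex ey]; move: h; rewrite ex ey ?eqxx => -[|[]].
have loop c : exists2 l : R -> plane, pth twice_punctured (2^-1, -1) (2^-1, -1) l &
    hol (crossing (fun u : plane => u.1) L xi e) l = ab c.
  have [|||||||l pl hl] := @rectangle_hol R _ _ twice_punctured (fun u : plane => u) (fun u => u.1) L xi e _ (fun w => erefl) dcoc
      2^-1 (xm c) (x2 c) (-1) 1 c.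
  - exact: ct_id.
  - by case; rewrite /xm /xi; case: c; apply/idP/idP => ?; lra.
  - by move=> t t01; apply: neq; right; split; apply/eqP; lra.
  - by move=> t t01; apply: neq; left; rewrite oner_neq0.
  - move=> t /andP[t0 t1]; split; first by apply: neq; left; rewrite oner_neq0.
    by rewrite /L /= ltr01; congr Some; rewrite /xm /x2; case: c; apply/idP; lra.
  - by move=> t t01; apply: neq; right; rewrite /x2; case: c; split; apply/eqP; lra.
  - move=> t t01; split; first by apply: neq; left; rewrite oppr_eq0 oner_neq0.
    by rewrite /L /= ifF //; apply/negbTE; rewrite -leNgt; lra.
  exists l => //; rewrite {}hl /level /e.
  have : ((2^-1 : R) < xi c) != (x2 c < xi c).
    by rewrite /xi /x2; case: c; apply/eqP; case: ltP => ?; case: ltP => ? //; lra.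
  by case: (_ < xi c); case: (x2 c < xi c) => // _; rewrite ?invg1 ?mul1g ?mulg1 ?invgK.
have [la pa ha] := loop true; have [lb pb hb] := loop false.
exists (crossing (fun u : plane => u.1) L xi e), a, b, (2^-1, -1), la, lb; split; split=> //.
apply: (@crossing_in _ _ _ _ _ _ _ 'Alt_('I_k)%G) => c.
have abA : ab c \in ('Alt_('I_k))%g by rewrite /ab; case: c.
by rewrite /e; case: ifP; rewrite ?groupV.
Unshelve. all: by end_near. Qed.

(** One unit to the left of the second puncture in stereographic coordinates, as [lam_affine]
    requires. *)
Definition third_point : T := unstereo (-1, 2).
Notation s2 := third_point.

(** The four points are strands or punctures, whichever are available. Holonomy on the twice
    punctured plane is pulled back along the cross ratio, and its loops are realised by moving one
    point while three stay fixed. *)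
Lemma Alt_quotient_cross_ratio p m k (f1 f2 f3 f4 : confT T m -> T) (lift : T -> confT T m) :
  (2 < k)%N -> odd k ->
  [/\ continuous f1, continuous f2, continuous f3 & continuous f4] -> continuous lift ->
  (forall z, conf (@Sigma R 0 p) z -> [/\ S (f1 z), S (f2 z), S (f3 z) & S (f4 z)] /\
    [/\ f1 z <> f2 z, f1 z <> f3 z & f1 z <> f4 z] /\ [/\ f2 z <> f3 z, f2 z <> f4 z & f3 z <> f4 z]) ->
  (forall q, S q -> q <> N -> q <> s -> q <> s2 -> conf (@Sigma R 0 p) (lift q)) ->
  (forall q, [/\ f1 (lift q) = q, f2 (lift q) = s2, f3 (lift q) = s & f4 (lift q) = N]) ->
  Alt_quotient R 0 p k m.
Proof.
move=> k2 ok [c1 c2 c3 c4] cl hz hl hf z zc.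
pose f (i : 'I_4) z := nth f4 [:: f1; f2; f3; f4] i z.
have f0E : f (inord 0) = f1 by apply/funext => u; rewrite /f inordK.
have f1E : f (inord 1) = f2 by apply/funext => u; rewrite /f inordK.
have f2E : f (inord 2) = f3 by apply/funext => u; rewrite /f inordK.
have f3E : f (inord 3) = f4 by apply/funext => u; rewrite /f inordK.
have cf i : continuous (f i).
  by case: i => [[|[|[|[|//]]]] hi].
have fS i u : conf (@Sigma R 0 p) u -> S (f i u).
  by move=> /hz [[h1 h2 h3 h4] _]; case: i => [[|[|[|[|//]]]] hi].
have fI i j u : conf (@Sigma R 0 p) u -> f i u = f j u -> i = j.
  move=> /hz [_ [[n1 n2 n3] [n4 n5 n6]]] E; apply: val_inj; move: E.
  by case: i => [[|[|[|[|//]]]] hi]; case: j => [[|[|[|[|//]]]] hj]; rewrite /f /= => E //; exfalso;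
    (exact: n1 E || exact: n2 E || exact: n3 E || exact: n4 E || exact: n5 E || exact: n6 E ||
     exact: n1 (esym E) || exact: n2 (esym E) || exact: n3 (esym E) || exact: n4 (esym E) || exact: n5 (esym E) || exact: n6 (esym E)).
have [delta [a [b [x1 [la [lb [[dcoc dA Aab] [pa pb ha hb]]]]]]]] := twice_punctured_holonomy k2 ok.
pose h := cross_ratio f.
pose pos (u : plane) := unstereo (u + (-1, 2)).
have cpos : continuous pos.
  have cu := @unstereo_continuous R.
  by have ca : continuous (fun u : plane => u + (-1, 2)) by [apply: ctDv; [exact: ct_id|exact: ct_cst]]; rewrite /pos; cont.
have uinj (u v : plane) : unstereo u = unstereo v -> u = v by move=> E; rewrite -[u]unstereoK E unstereoK.
have hpos u : twice_punctured u -> conf (@Sigma R 0 p) (lift (pos u)).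
  move=> [u0 u1]; apply: hl.
  - exact: unstereo_sphere.
  - exact: unstereo_npole.
  - move=> /uinj E; apply: u1; apply: (addIr (-1, 2)); rewrite E.
    have -> : (1, 0) + (-1, 2) = (1 + -1, 0 + 2) :> plane by [].
    by rewrite subrr add0r.
  - by move=> /uinj E; apply: u0; apply: (addIr (-1, 2)); rewrite E add0r.
(* With the other three points in normal position, moving the first point recovers every value of
   the cross ratio, so loops can be lifted explicitly. *)
have hK u : h (lift (pos u)) = u.
  have [q1 q2 q3 q4] := hf (pos u).
  rewrite /h /cross_ratio /lamt f0E f1E f2E f3E q1 q2 q3 q4.
  have [-> b1] := finite_section (unstereo_sphere (u + (-1, 2))) (@unstereo_npole R _).
  have [-> b2] := finite_section (unstereo_sphere (-1, 2)) (@unstereo_npole R (-1, 2)).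
  have [-> b3] := finite_section (unstereo_sphere (0, 2)) (@unstereo_npole R (0, 2)).
  have [-> ->] := pole_section R.
  rewrite !unstereoK lam_affine //.
  - by case: u {q1 q2 q3 q4 b1} => x y; rewrite /cplx /=; congr pair; ring.
  - by rewrite eq_complex /= pnatr_eq0.
  - by apply/eqP; rewrite eq_complex /=; apply/andP; split; apply/eqP; ring.
have pl (c : R -> plane) : pth twice_punctured x1 x1 c ->
    pth (conf (@Sigma R 0 p) (n := m)) (lift (pos x1)) (lift (pos x1)) (fun r => lift (pos (c r))).
  by move=> [cc Xc c0 c1']; split; [cont|by move=> r; exact: hpos|by rewrite c0|by rewrite c1'].
have hc (c : R -> plane) : hol (fun u v => delta (h u) (h v)) (fun r => lift (pos (c r))) = hol delta c.
  have -> : hol delta c = hol delta (fun r => h (lift (pos (c r)))) by congr hol; apply/funext => r; rewrite hK.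
  by [].
refine (@hol_quotient _ _ _ _ (fun u v : confT T m => delta (h u) (h v)) _ ('Alt_('I_k))%G a b _ _ _ z _ _ Aab (pl _ pa) (pl _ pb) _ _ zc) => //.
- apply: (local_cocycle_pullback dcoc) => u cu; first by have := cross_ratio_neq fS fI cu.
  exact: (cross_ratio_continuous cf fS fI cu).
- exact: conf_Sigma_pconn.
- by rewrite hc.
- by rewrite hc.
Qed.

Lemma Alt_quotient_sphere p k : (p <= 2)%N -> (2 < k)%N -> odd k -> Alt_quotient R 0 p k (4 - p).
Proof.
move=> p2 k2 ok.
have Ss2 : S s2 by exact: unstereo_sphere. have s2N : s2 <> N by exact: unstereo_npole.
have Ss : S s by exact: unstereo_sphere. have sN : s <> N by exact: unstereo_npole.
have SN : S N by apply/sphereP; rewrite /= en_x0 normr0 ger0_norm ?subr0.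
have ss2 : s <> s2.
  move=> /(congr1 (@stereo R)); rewrite !unstereoK => /(congr1 fst) /= /eqP.
  by rewrite eq_sym oppr_eq0 oner_eq0.
case: p p2 => [|[|[|//]]] _.
- have SE : @Sigma R 0 0 = S.
    by rewrite Sigma_sphere //; apply/seteqP; split=> [q []//|q Sq]; split=> // -[[]|[]].
  apply: (@Alt_quotient_cross_ratio 0 4 k (fun z => z.1.1.1.2) (fun z => z.1.1.2) (fun z => z.1.2) (fun z => z.2)
    (fun q => (true, q, s2, s, N))) => //; [by split; cont|by cont| |].
  + move=> [[[[o q1] q2] q3] q4] /= [[[[_ [S1 _]] [S2 n2]] [S3 n3]] [S4 n4]]; move: S1 S2 S3 S4 => /=.
    rewrite SE => S1 S2 S3 S4; split=> //; split; split=> E.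
    * by apply: n2; right.
    * by apply: n3; left; right.
    * by apply: n4; left; left; right.
    * by apply: n3; right.
    * by apply: n4; left; right.
    * by apply: n4; right.
  + move=> q Sq qN qs qs2; split; [split; [split; [split; [by []|]|]|]|]; rewrite SE; split=> //.
    * by move=> /= [[]|/esym].
    * by move=> /= [[[]|/esym]|].
    * by move=> /= [[[[]|/esym]|/esym]|/esym].
- have SE : @Sigma R 0 1 = S `\ N.
    rewrite Sigma_sphere //; apply/seteqP; split=> q [Sq nq]; split=> // h; apply: nq; first by left.
    by case: h => -[].
  apply: (@Alt_quotient_cross_ratio 1 3 k (fun z => z.1.1.2) (fun z => z.1.2) (fun z => z.2) (fun=> N)
    (fun q => (true, q, s2, s))) => //; [by split; cont|by cont| |].
  + move=> [[[o q1] q2] q3] /= [[[_ [S1 _]] [S2 n2]] [S3 n3]]; move: S1 S2 S3 => /=.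
    rewrite SE => -[S1 N1] [S2 N2] [S3 N3]; split=> //; split; split=> // E.
    * by apply: n2; right.
    * by apply: n3; left; right.
    * by apply: n3; right.
  + move=> q Sq qN qs qs2; split; [split; [split; [by []|]|]|]; rewrite SE; (split; [split=> //|]) => //.
    * by move=> /= [[]|/esym].
    * by move=> /= [[[]|/esym]|].
- have SE : @Sigma R 0 2 = S `\ N `\ s.
    rewrite Sigma_sphere //; apply/seteqP; split=> q.
      by move=> [Sq nq]; split; [split=> //|]; move=> h; apply: nq; [left|right].
    by move=> [[Sq qN] qs]; split=> // -[[_ /qN]|[_ /qs]].
  apply: (@Alt_quotient_cross_ratio 2 2 k (fun z => z.1.2) (fun z => z.2) (fun=> s) (fun=> N)
    (fun q => (true, q, s2))) => //; [by split; cont|by cont| |].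
  + move=> [[o q1] q2] /= [[_ [S1 _]] [S2 n2]]; move: S1 S2 => /=.
    rewrite SE => -[[S1 N1] M1] [[S2 N2] M2]; split=> //; split; split=> // E.
    by apply: n2; right.
  + move=> q Sq qN qs qs2; split; [split; [by []|]|]; rewrite SE; (split; [split; [split=> //|]|]) => //.
    * by move=> /esym.
    * by move=> /= [[]|/esym].
Qed.
End FewPunctures.

Theorem theorem1p1 (R : realType) (g p n : nat) :
  in_F1 g p \/ in_F2 g p -> (1 <= n)%N ->
  forall x0 : 'I_n -> (R * R * R)%type,
    conf_space _ (@Sigma R g p) n x0 ->
    (R_infty_property (@pb_mul R _ (@Sigma R g p) n x0) (@pb_inv R _ (@Sigma R g p) n x0)
     <->
     [\/ in_F2 g p,
         [/\ g = 0%N, p = 0%N & (4 <= n)%N],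
         [/\ g = 0%N, p = 1%N & (3 <= n)%N]
       | [/\ g = 0%N, p = 2%N & (2 <= n)%N]]).
Proof.
move=> h12 n1 x0 hx0.
(* The three bounds on n for p = 0, 1, 2 are the single condition that strands and punctures
   together number at least four. *)
have few : g = 0%N -> (p <= 2)%N -> (4 - p <= n)%N ->
    R_infty_property (@pb_mul R _ (@Sigma R g p) n x0) (@pb_inv R _ (@Sigma R g p) n x0).
  move=> g0 p2 hn; subst g; apply: (pb_R_infty hx0) => k k2 ok.
  exact: (Alt_quotient_leq hn (@Alt_quotient_sphere R _ _ p2 k2 ok)).
split; last first.
  case=> [hF2|[g0 p0 hn]|[g0 p0 hn]|[g0 p0 hn]]; try by apply: few => //; rewrite p0.
  apply: (pb_R_infty hx0) => k k2 ok; apply: (Alt_quotient_leq n1).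
  case: hF2 => -[hg hp].
  - exact: Alt_quotient_genus.
  - by move: hg hp => -> hp; exact: Alt_quotient_sphere3.
  - by move: hg hp => -> hp; exact: Alt_quotient_torus.
  - exact: Alt_quotient_genus.
move=> hR; case: h12 => [[g0 p2]|]; last by move=> ?; apply: Or41.
(* With at most three points in all the group is cyclic, which contradicts [hR]. *)
subst g; have [hn|hn] := leqP (n + p) 3.
  by have := pb_not_R_infty hx0 (@small_sphere_cyc R _ _ p2 n1 hn).
case: p p2 hn {few hR hx0} => [|[|[|//]]] _ hn.
- by apply: Or42; split=> //; rewrite addn0 in hn.
- by apply: Or43; split=> //; rewrite addn1 in hn.
- by apply: Or44; split=> //; rewrite addn2 in hn.
Qed.
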